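(* Let $\gamma_1,\gamma_2,\nu_1,\nu_2,\lambda,\mu,\beta_1,\beta_2$ be smooth functions, defined in a domain $\mathcal D\subset\mathbb R^2$ (with coordinates $(u,v)$), and satisfying the conditions $$\frac{\mu_u}{2\mu\gamma_2+\nu_1\beta_2-\lambda\beta_1}>0,\qquad \frac{\mu_v}{2\mu\gamma_1-\lambda\beta_2+\nu_2\beta_1}>0,$$ $$-\gamma_1\sqrt E\sqrt G=(\sqrt E)_v,\qquad -\gamma_2\sqrt E\sqrt G=(\sqrt G)_u,$$ $$-\nu_1\nu_2+\lambda^2-\mu^2=\frac1{\sqrt E}(\gamma_2)_u+\frac1{\sqrt G}(\gamma_1)_v-\left((\gamma_1)^2+(\gamma_2)^2\right),$$ $$2\lambda\gamma_2-\mu\beta_1-(\nu_1-\nu_2)\gamma_1=\frac1{\sqrt E}\lambda_u-\frac1{\sqrt G}(\nu_1)_v,$$ $$2\lambda\gamma_1-\mu\beta_2+(\nu_1-\nu_2)\gamma_2=-\frac1{\sqrt E}(\nu_2)_u+\frac1{\sqrt G}\lambda_v,$$ $$\gamma_1\beta_1-\gamma_2\beta_2-(\nu_1-\nu_2)\mu=-\frac1{\sqrt E}(\beta_2)_u+\frac1{\sqrt G}(\beta_1)_v,$$ where $$\sqrt E=\frac{\mu_u}{2\mu\gamma_2+\nu_1\beta_2-\lambda\beta_1},\qquad \sqrt G=\frac{\mu_v}{2\mu\gamma_1-\lambda\beta_2+\nu_2\beta_1}.$$ Let $\{x_0,y_0,b_0,l_0\}$ be an orthonormal frame at a point $p_0\in\mathbb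 R^4_1$. Then there exist a subdomain $\mathcal D_0\subset\mathcal D$ and a unique spacelike surface $M^2: z=z(u,v)$, $(u,v)\in\mathcal D_0$, passing through $p_0$, with timelike mean curvature vector field, such that $\gamma_1,\gamma_2,\nu_1,\nu_2,\lambda,\mu,\beta_1,\beta_2$ are the geometric functions of $M^2$ and $\{x_0,y_0,b_0,l_0\}$ is the geometric frame of $M^2$ at the point $p_0$.
   Context: $\mathbb R^4_1$ is the four-dimensional Minkowski space with metric $\langle\,,\rangle$ of signature $(3,1)$, with a fixed orthonormal basis $e_1,e_2,e_3,e_4$, $e_1^2=e_2^2=e_3^2=1$, $e_4^2=-1$, giving the orientation, and standard flat connection $\nabla'$. In an orthonormal frame $\{x,y,b,l\}$ the vectors $x,y,b$ have square $1$ and $\langle l,l\rangle=-1$. A surface $z=z(u,v)$ is spacelike if the induced metric is Riemannian; for a surface, $E=\langle z_u,z_u\rangle$, $F=\langle z_u,z_v\rangle$, $G=\langle z_v,z_v\rangle$. $\sigma$ denotes the (normal-bundle-valued) second fundamental tensor and $H=\frac12(\sigma(x,x)+\sigma(y,y))$, for an orthonormal tangent frame $\{x,y\}$, the mean curvature vector. Principal parameters: the surface is parameterized by principal lines if $F=0$ and $M=0$, where $M=\frac{1}{\sqrt{EG-F^2}}\left(c_{11}^1c_{22}^2-c_{11}^2c_{22}^1\right)$, $c_{11}^k=\langle z_{uu},n_k\rangle$, $c_{22}^k=\langle z_{vv},n_k\rangle$, for a normal frame field $\{n_1,n_2\}$ with $\langle n_1,n_1\rangle=1$, $\langle n_2,n_2\rangle=-1$,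 $\langle n_1,n_2\rangle=0$, such that $\{z_u,z_v,n_1,n_2\}$ is positively oriented; thus $M=0$ means that $\sigma(z_u,z_u)$ and $\sigma(z_v,z_v)$ are collinear. Geometric frame and geometric functions (for a spacelike surface with timelike mean curvature vector field, i.e. $\langle H,H\rangle<0$ everywhere, parameterized by principal lines $(u,v)$): $x=z_u/\sqrt E$, $y=z_v/\sqrt G$, $l=-H/\sqrt{-\langle H,H\rangle}$ (so $\langle l,l\rangle=-1$ and $l$ is collinear with $\sigma(x,x)$ and $\sigma(y,y)$), and $b$ is the unit normal field, $\langle b,b\rangle=1$, such that $\{x,y,b,l\}$ is a positively oriented orthonormal frame. The geometric functions are $$\nu_1=\langle\sigma(x,x),l\rangle,\ \nu_2=\langle\sigma(y,y),l\rangle,\ \lambda=\langle\sigma(x,y),l\rangle,\ \mu=\langle\sigma(x,y),b\rangle,$$ $$\gamma_1=-y(\ln\sqrt E),\ \gamma_2=-x(\ln\sqrt G),\ \beta_1=\langle\nabla'_xb,l\rangle,\ \beta_2=\langle\nabla'_yb,l\rangle,$$ so that $\sigma(x,x)=-\nu_1l$, $\sigma(x,y)=\mu b-\lambda l$, $\sigma(y,y)=-\nu_2l$ and $H=-\frac{\nu_1+\nu_2}2\,l$.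
   Formalization: The frame at p_0 is assumed positively oriented, p_0 is attained at a fixed parameter point (u_0,v_0), and ν_1+ν_2>0 is assumed there; these are forced by the geometric frame's definition (l=-H/√(-⟨H,H⟩)), and without them existence or uniqueness fails. *)

(* Defs.v *)
From Stdlib Require Import Reals.
From Coquelicot Require Import Coquelicot.
Open Scope R_scope.

(** ** Plane domains and smooth functions of two variables *)

Definition connected2 (D : R * R -> Prop) : Prop :=
  forall U V : R * R -> Prop,
    open U -> open V ->
    (forall p, D p -> U p \/ V p) ->
    (exists p, D p /\ U p) -> (exists p, D p /\ V p) ->
    exists p, D p /\ U p /\ V p.

Definition plane_domain (D : R * R -> Prop) : Prop :=
  open D /\ (exists p, D p) /\ connected2 D.

Definition Du (f : R -> R -> R) (u v : R) : R := Derive (fun s => f s v) u.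
Definition Dv (f : R -> R -> R) (u v : R) : R := Derive (fun t => f u t) v.

(* [ex_diff_n f n u v]: all iterated partial derivatives of order at most [n]
   exist and are continuous at (u,v). *)
Definition smooth_on (D : R * R -> Prop) (f : R -> R -> R) : Prop :=
  forall u v, D (u, v) -> forall n, ex_diff_n f n u v.

(** ** Minkowski space, in coordinates with respect to e1, e2, e3, e4 *)

Record vec4 : Type := mk4 { c1 : R; c2 : R; c3 : R; c4 : R }.

Definition vadd (a b : vec4) : vec4 :=
  mk4 (c1 a + c1 b) (c2 a + c2 b) (c3 a + c3 b) (c4 a + c4 b).

Definition vscal (k : R) (a : vec4) : vec4 :=
  mk4 (k * c1 a) (k * c2 a) (k * c3 a) (k * c4 a).

Definition mink (a b : vec4) : R :=
  c1 a * c1 b + c2 a * c2 b + c3 a * c3 b - c4 a * c4 b.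

Definition det3 (a1 a2 a3 b1 b2 b3 d1 d2 d3 : R) : R :=
  a1 * (b2 * d3 - b3 * d2) - a2 * (b1 * d3 - b3 * d1)
  + a3 * (b1 * d2 - b2 * d1).

(* Expansion along the row of [x]. *)
Definition det4 (x y b l : vec4) : R :=
    c1 x * det3 (c2 y) (c3 y) (c4 y) (c2 b) (c3 b) (c4 b) (c2 l) (c3 l) (c4 l)
  - c2 x * det3 (c1 y) (c3 y) (c4 y) (c1 b) (c3 b) (c4 b) (c1 l) (c3 l) (c4 l)
  + c3 x * det3 (c1 y) (c2 y) (c4 y) (c1 b) (c2 b) (c4 b) (c1 l) (c2 l) (c4 l)
  - c4 x * det3 (c1 y) (c2 y) (c3 y) (c1 b) (c2 b) (c3 b) (c1 l) (c2 l) (c3 l).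

Definition positively_oriented (x y b l : vec4) : Prop := 0 < det4 x y b l.

Definition orthonormal (x y b l : vec4) : Prop :=
  mink x x = 1 /\ mink y y = 1 /\ mink b b = 1 /\ mink l l = -1 /\
  mink x y = 0 /\ mink x b = 0 /\ mink x l = 0 /\
  mink y b = 0 /\ mink y l = 0 /\ mink b l = 0.

(** ** Vector-valued functions of (u,v) *)

Definition VDu (z : R -> R -> vec4) (u v : R) : vec4 :=
  mk4 (Du (fun s t => c1 (z s t)) u v) (Du (fun s t => c2 (z s t)) u v)
      (Du (fun s t => c3 (z s t)) u v) (Du (fun s t => c4 (z s t)) u v).

Definition VDv (z : R -> R -> vec4) (u v : R) : vec4 :=
  mk4 (Dv (fun s t => c1 (z s t)) u v) (Dv (fun s t => c2 (z s t)) u v)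
      (Dv (fun s t => c3 (z s t)) u v) (Dv (fun s t => c4 (z s t)) u v).

Definition vsmooth_on (D : R * R -> Prop) (z : R -> R -> vec4) : Prop :=
  smooth_on D (fun u v => c1 (z u v)) /\ smooth_on D (fun u v => c2 (z u v)) /\
  smooth_on D (fun u v => c3 (z u v)) /\ smooth_on D (fun u v => c4 (z u v)).

(** ** Surfaces in Minkowski space *)

Section Surface.

Variable z : R -> R -> vec4.

Definition EE (u v : R) : R := mink (VDu z u v) (VDu z u v).
Definition FF (u v : R) : R := mink (VDu z u v) (VDv z u v).
Definition GG (u v : R) : R := mink (VDv z u v) (VDv z u v).

(* Positive definiteness of the induced metric; it forces z_u and z_v to be
   linearly independent. *)
Definition spacelike_on (D : R * R -> Prop) : Prop :=
  forall u v, D (u, v) ->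
    0 < EE u v /\ 0 < EE u v * GG u v - FF u v * FF u v.

(* Component of [w] orthogonal to span(z_u, z_v), for a spacelike surface. *)
Definition normal_part (u v : R) (w : vec4) : vec4 :=
  let W := EE u v * GG u v - FF u v * FF u v in
  let wu := mink w (VDu z u v) in
  let wv := mink w (VDv z u v) in
  vadd w
    (vadd (vscal (- ((GG u v * wu - FF u v * wv) / W)) (VDu z u v))
          (vscal (- ((EE u v * wv - FF u v * wu) / W)) (VDv z u v))).

(* Tangent vectors at (u,v) are given by their components (X1, X2) in the basis
   z_u, z_v.  sigma(X,Y) is the normal part of nabla'_X Y, which is tensorial in
   X and Y, so that only second derivatives of [z] contribute. *)
Definition sigma (u v : R) (X Y : R * R) : vec4 :=
  normal_part u v
    (vadd (vscal (fst X * fst Y) (VDu (VDu z) u v))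
       (vadd (vscal (fst X * snd Y + snd X * fst Y) (VDv (VDu z) u v))
             (vscal (snd X * snd Y) (VDv (VDv z) u v)))).

Definition tangent (u v : R) (X : R * R) : vec4 :=
  vadd (vscal (fst X) (VDu z u v)) (vscal (snd X) (VDv z u v)).

(* X(f) and nabla'_X w *)
Definition dir (X : R * R) (f : R -> R -> R) (u v : R) : R :=
  fst X * Du f u v + snd X * Dv f u v.
Definition nabla (X : R * R) (w : R -> R -> vec4) (u v : R) : vec4 :=
  vadd (vscal (fst X) (VDu w u v)) (vscal (snd X) (VDv w u v)).

(* Mean curvature vector, computed in the orthonormal tangent frame obtained
   from (z_u, z_v) by Gram-Schmidt; it does not depend on the frame. *)
Definition HH (u v : R) : vec4 :=
  let W := sqrt (EE u v * GG u v - FF u v * FF u v) in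
  let X := (/ sqrt (EE u v), 0) in
  let Y := (- FF u v / (sqrt (EE u v) * W), sqrt (EE u v) / W) in
  vscal (/ 2) (vadd (sigma u v X X) (sigma u v Y Y)).

Definition timelike_H_on (D : R * R -> Prop) : Prop :=
  forall u v, D (u, v) -> mink (HH u v) (HH u v) < 0.

Definition normal_frame (u v : R) (n1 n2 : vec4) : Prop :=
  mink n1 (VDu z u v) = 0 /\ mink n1 (VDv z u v) = 0 /\
  mink n2 (VDu z u v) = 0 /\ mink n2 (VDv z u v) = 0 /\
  mink n1 n1 = 1 /\ mink n2 n2 = -1 /\ mink n1 n2 = 0 /\
  positively_oriented (VDu z u v) (VDv z u v) n1 n2.

Definition MM (n1 n2 : vec4) (u v : R) : R :=
  / sqrt (EE u v * GG u v - FF u v * FF u v) *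
  (mink (VDu (VDu z) u v) n1 * mink (VDv (VDv z) u v) n2
   - mink (VDu (VDu z) u v) n2 * mink (VDv (VDv z) u v) n1).

(* The value of [MM] is the same for all normal frames as above. *)
Definition principal_on (D : R * R -> Prop) : Prop :=
  forall u v, D (u, v) ->
    FF u v = 0 /\
    forall n1 n2, normal_frame u v n1 n2 -> MM n1 n2 u v = 0.

(** ** Geometric frame and geometric functions (principal parameters) *)

(* Components of x = z_u / sqrt E and y = z_v / sqrt G *)
Definition tx (u v : R) : R * R := (/ sqrt (EE u v), 0).
Definition ty (u v : R) : R * R := (0, / sqrt (GG u v)).

Definition frame_x (u v : R) : vec4 := tangent u v (tx u v).
Definition frame_y (u v : R) : vec4 := tangent u v (ty u v).
Definition frame_l (u v : R) : vec4 :=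
  vscal (- / sqrt (- mink (HH u v) (HH u v))) (HH u v).

(* These conditions determine [b] on [D]. *)
Definition is_frame_b (D : R * R -> Prop) (b : R -> R -> vec4) : Prop :=
  vsmooth_on D b /\
  forall u v, D (u, v) ->
    orthonormal (frame_x u v) (frame_y u v) (b u v) (frame_l u v) /\
    positively_oriented (frame_x u v) (frame_y u v) (b u v) (frame_l u v).

Definition geo_nu1 (u v : R) : R :=
  mink (sigma u v (tx u v) (tx u v)) (frame_l u v).
Definition geo_nu2 (u v : R) : R :=
  mink (sigma u v (ty u v) (ty u v)) (frame_l u v).
Definition geo_lambda (u v : R) : R :=
  mink (sigma u v (tx u v) (ty u v)) (frame_l u v).
Definition geo_mu (b : R -> R -> vec4) (u v : R) : R :=
  mink (sigma u v (tx u v) (ty u v)) (b u v).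
Definition geo_gamma1 (u v : R) : R :=
  - dir (ty u v) (fun s t => ln (sqrt (EE s t))) u v.
Definition geo_gamma2 (u v : R) : R :=
  - dir (tx u v) (fun s t => ln (sqrt (GG s t))) u v.
Definition geo_beta1 (b : R -> R -> vec4) (u v : R) : R :=
  mink (nabla (tx u v) b u v) (frame_l u v).
Definition geo_beta2 (b : R -> R -> vec4) (u v : R) : R :=
  mink (nabla (ty u v) b u v) (frame_l u v).

End Surface.

(* [z] is a spacelike surface on [D] with timelike mean curvature vector field,
   parameterized by principal lines, with the given geometric functions, and
   whose geometric frame at the point z(u0,v0) = p0 is {x0, y0, b0, l0}. *)
Definition surface_with_data (D : R * R -> Prop)
    (gamma1 gamma2 nu1 nu2 lambda mu beta1 beta2 : R -> R -> R)
    (u0 v0 : R) (p0 x0 y0 b0 l0 : vec4) (z : R -> R -> vec4) : Prop :=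
  vsmooth_on D z /\ spacelike_on z D /\ timelike_H_on z D /\
  principal_on z D /\
  exists b : R -> R -> vec4,
    is_frame_b z D b /\
    (forall u v, D (u, v) ->
       geo_gamma1 z u v = gamma1 u v /\ geo_gamma2 z u v = gamma2 u v /\
       geo_nu1 z u v = nu1 u v /\ geo_nu2 z u v = nu2 u v /\
       geo_lambda z u v = lambda u v /\ geo_mu z b u v = mu u v /\
       geo_beta1 z b u v = beta1 u v /\ geo_beta2 z b u v = beta2 u v) /\
    z u0 v0 = p0 /\
    frame_x z u0 v0 = x0 /\ frame_y z u0 v0 = y0 /\
    b u0 v0 = b0 /\ frame_l z u0 v0 = l0.

(** ** The functions sqrt E and sqrt G prescribed by the data *)

(* Since [/ 0 = 0], positivity of these quotients includes the requirement that
   their denominators do not vanish. *)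
Definition root_E (gamma2 nu1 lambda mu beta1 beta2 : R -> R -> R)
    (u v : R) : R :=
  Du mu u v / (2 * mu u v * gamma2 u v + nu1 u v * beta2 u v
               - lambda u v * beta1 u v).

Definition root_G (gamma1 nu2 lambda mu beta1 beta2 : R -> R -> R)
    (u v : R) : R :=
  Dv mu u v / (2 * mu u v * gamma1 u v - lambda u v * beta2 u v
               + nu2 u v * beta1 u v).

(* Main.v *)
From Stdlib Require Import Reals Lra Lia Classical ClassicalEpsilon.
From Coquelicot Require Import Coquelicot.
Require Import Defs.
Open Scope R_scope.

(** The surface is found by integrating its frame equations. If a surface in
    principal parameters has the prescribed geometric functions, then the
    position [z] and the geometric frame [x, y, b, l] satisfy
    [z_u = sqrt E x], [z_v = sqrt G y] and two linear systems that express the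
    derivatives of [x, y, b, l] in the frame itself, with coefficients built from
    the geometric functions, [sqrt E] and [sqrt G]. In each of the four
    coordinates of Minkowski space this is one and the same linear system
    [Y_u = A Y], [Y_v = B Y] for five scalar functions. The equations in the
    hypotheses, together with the two quotients that define [sqrt E] and
    [sqrt G], are exactly the integrability condition [A_v + A B = B_u + B A]
    ([frame_equations_integrable]), so the Frobenius theorem for linear systems
    ([linear_frobenius]) gives a solution on a small square around the base
    point, for every initial value.

    The Frobenius theorem is proved by Picard iteration. One first solves the
    integral equation along the path that runs horizontally through the base
    point and then vertically ([linear_picard]). The solution obeys the vertical
    equation everywhere and the horizontal one on a single line; the integrability
    condition turns the defect of the horizontal equation into a solution of a
    homogeneous Volterra equation, and on a small square this has only the zero
    solution ([compatible_du]). Smoothness follows from the equations themselves.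

    The coefficient matrices of the frame are skew with respect to the Minkowski
    metric. Hence the determinant of a moving frame is constant, and so is the
    pairing of the coordinate vectors of two fixed vectors in two frames that obey
    the same equations ([comoving_frames_pairing_constant]). With one frame this
    keeps a solution orthonormal and positively oriented; with two frames that
    agree at one point it shows that they agree everywhere, which takes the place of
    a uniqueness theorem for differential equations ([adapted_frames_unique]).
    An orthonormal solution is the geometric frame of its surface and yields the
    prescribed functions ([adapted_frame_surface]), provided that [nu1 + nu2] is
    positive, which fixes the sign in [l = - H / sqrt (- <H,H>)].

    For uniqueness, the frame equations are derived for an arbitrary surface with
    the given data ([surface_adapted_frame]). A priori they contain its own
    [sqrt E] and [sqrt G]; the two Codazzi equations for [mu] ([codazzi_mu_u],
    [codazzi_mu_v]) show that these are the prescribed quotients. *)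

(** * Smooth functions on open subsets of the plane *)

Definition Cn (D : R * R -> Prop) (n : nat) (f : R -> R -> R) : Prop :=
  forall u v, D (u, v) -> ex_diff_n f n u v.

Lemma open_locally_2d (D : R * R -> Prop) u v :
  open D -> D (u, v) -> locally_2d (fun s t => D (s, t)) u v.
Proof.
  intros oD Duv. apply locally_2d_locally.
  apply filter_imp with (2 := oD _ Duv). now intros [s t].
Qed.

Lemma open_locally_u (D : R * R -> Prop) u v :
  open D -> D (u, v) -> locally u (fun s => D (s, v)).
Proof.
  intros oD Duv. apply (locally_2d_1d_const_y (fun s t => D (s, t))).
  now apply open_locally_2d.
Qed.

Lemma open_locally_v (D : R * R -> Prop) u v :
  open D -> D (u, v) -> locally v (fun t => D (u, t)).
Proof.
  intros oD Duv. apply (locally_2d_1d_const_x (fun s t => D (s, t))).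
  now apply open_locally_2d.
Qed.

Lemma Du_ext_on (D : R * R -> Prop) f g u v :
  open D -> (forall s t, D (s, t) -> f s t = g s t) -> D (u, v) ->
  Du f u v = Du g u v.
Proof.
  intros oD fg Duv. apply Derive_ext_loc.
  apply filter_imp with (2 := open_locally_u _ _ _ oD Duv). intros s; apply fg.
Qed.

Lemma Dv_ext_on (D : R * R -> Prop) f g u v :
  open D -> (forall s t, D (s, t) -> f s t = g s t) -> D (u, v) ->
  Dv f u v = Dv g u v.
Proof.
  intros oD fg Duv. apply Derive_ext_loc.
  apply filter_imp with (2 := open_locally_v _ _ _ oD Duv). intros t; apply fg.
Qed.

Lemma Cn_ext (D : R * R -> Prop) n f g :
  open D -> (forall s t, D (s, t) -> f s t = g s t) -> Cn D n f -> Cn D n g.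
Proof.
  intros oD fg Cf u v Duv. apply ex_diff_n_ext_loc with (2 := Cf u v Duv).
  destruct (open_locally_2d _ _ _ oD Duv) as [d Hd].
  exists d. intros s t Hs Ht. apply fg. now apply Hd.
Qed.

Lemma Cn_le D n m f : (m <= n)%nat -> Cn D n f -> Cn D m f.
Proof. intros mn Cf u v Duv. apply (ex_diff_n_m n m mn). now apply Cf. Qed.

Lemma Cn_continuity D n f u v : Cn D n f -> D (u, v) -> continuity_2d_pt f u v.
Proof. intros Cf Duv. specialize (Cf u v Duv). destruct n; apply Cf. Qed.

Lemma Cn_ex_derive_u D n f u v :
  Cn D (S n) f -> D (u, v) -> ex_derive (fun s => f s v) u.
Proof. intros Cf Duv. apply (Cf u v Duv). Qed.

Lemma Cn_ex_derive_v D n f u v :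
  Cn D (S n) f -> D (u, v) -> ex_derive (fun t => f u t) v.
Proof. intros Cf Duv. apply (Cf u v Duv). Qed.

Lemma Cn_Du D n f : Cn D (S n) f -> Cn D n (Du f).
Proof. intros Cf u v Duv. apply (Cf u v Duv). Qed.

Lemma Cn_Dv D n f : Cn D (S n) f -> Cn D n (Dv f).
Proof. intros Cf u v Duv. apply (Cf u v Duv). Qed.

(** The partial derivatives are given as arbitrary functions, so that
    regularity can be bootstrapped from a differential equation. *)
Lemma Cn_S (D : R * R -> Prop) n f fu fv :
  open D ->
  (forall u v, D (u, v) -> continuity_2d_pt f u v) ->
  (forall u v, D (u, v) -> is_derive (fun s => f s v) u (fu u v)) ->
  (forall u v, D (u, v) -> is_derive (fun t => f u t) v (fv u v)) ->
  Cn D n fu -> Cn D n fv -> Cn D (S n) f.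
Proof.
  intros oD cf du dv Cu Cv u v Duv. split; [now apply cf|].
  split; [eexists; now apply du|]. split; [eexists; now apply dv|].
  split.
  - apply (Cn_ext D n fu); auto. intros s t Dst. symmetry.
    apply is_derive_unique. now apply du.
  - apply (Cn_ext D n fv); auto. intros s t Dst. symmetry.
    apply is_derive_unique. now apply dv.
Qed.

Lemma Cn_const D n c : Cn D n (fun _ _ => c).
Proof.
  revert c. induction n; intros c u v Duv.
  - split; auto. apply continuity_2d_pt_const.
  - split; [apply continuity_2d_pt_const|].
    split; [apply ex_derive_const|]. split; [apply ex_derive_const|].
    split; (eapply ex_diff_n_ext_loc; [|apply (IHn 0 u v Duv)]);
    apply locally_2d_forall; intros; symmetry; apply Derive_const.
Qed.

Lemma Cn_plus D n f g :
  open D -> Cn D n f -> Cn D n g -> Cn D n (fun u v => f u v + g u v).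
Proof.
  intros oD. revert f g. induction n; intros f g Cf Cg.
  - intros u v Duv. split; auto.
    apply continuity_2d_pt_plus; eapply Cn_continuity; eauto.
  - eapply Cn_S; auto.
    + intros u v Duv. apply continuity_2d_pt_plus; eapply Cn_continuity; eauto.
    + intros u v Duv. apply (is_derive_plus (fun s => f s v) (fun s => g s v));
      apply Derive_correct; eapply Cn_ex_derive_u; eauto.
    + intros u v Duv. apply (is_derive_plus (fun t => f u t) (fun t => g u t));
      apply Derive_correct; eapply Cn_ex_derive_v; eauto.
    + apply (IHn (Du f) (Du g)); now apply Cn_Du.
    + apply (IHn (Dv f) (Dv g)); now apply Cn_Dv.
Qed.

Lemma Cn_mult D n f g :
  open D -> Cn D n f -> Cn D n g -> Cn D n (fun u v => f u v * g u v).
Proof.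
  intros oD. revert f g. induction n; intros f g Cf Cg.
  - intros u v Duv. split; auto.
    apply continuity_2d_pt_mult; eapply Cn_continuity; eauto.
  - assert (Cf' := Cn_le D (S n) n f ltac:(lia) Cf).
    assert (Cg' := Cn_le D (S n) n g ltac:(lia) Cg).
    eapply Cn_S with (fu := fun u v => Du f u v * g u v + f u v * Du g u v)
      (fv := fun u v => Dv f u v * g u v + f u v * Dv g u v); auto.
    + intros u v Duv. apply continuity_2d_pt_mult; eapply Cn_continuity; eauto.
    + intros u v Duv. apply (is_derive_mult (fun s => f s v) (fun s => g s v)).
      * apply Derive_correct; eapply Cn_ex_derive_u; eauto.
      * apply Derive_correct; eapply Cn_ex_derive_u; eauto.
      * intros; apply Rmult_comm.
    + intros u v Duv. apply (is_derive_mult (fun t => f u t) (fun t => g u t)).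
      * apply Derive_correct; eapply Cn_ex_derive_v; eauto.
      * apply Derive_correct; eapply Cn_ex_derive_v; eauto.
      * intros; apply Rmult_comm.
    + apply Cn_plus; auto; apply IHn; auto; now apply Cn_Du.
    + apply Cn_plus; auto; apply IHn; auto; now apply Cn_Dv.
Qed.

(** The derivative [- f' / f^2] is a product of [f'] and of copies of [1 / f], so
    that the induction hypothesis for [1 / f] is enough. *)
Lemma Cn_inv (D : R * R -> Prop) n f :
  open D -> (forall u v, D (u, v) -> f u v <> 0) ->
  Cn D n f -> Cn D n (fun u v => / f u v).
Proof.
  intros oD f0. revert f f0. induction n; intros f f0 Cf.
  - intros u v Duv. split; auto.
    apply continuity_2d_pt_inv; auto; eapply Cn_continuity; eauto.
  - assert (Cf' := Cn_le D (S n) n f ltac:(lia) Cf).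
    apply Cn_S with (fu := fun u v => (-1 * Du f u v) * (/ f u v * / f u v))
      (fv := fun u v => (-1 * Dv f u v) * (/ f u v * / f u v)); auto.
    + intros u v Duv. apply continuity_2d_pt_inv; auto. eapply Cn_continuity; eauto.
    + intros u v Duv. replace (-1 * _ * _) with (- Du f u v / f u v ^ 2)
        by (field; auto).
      apply (is_derive_inv (fun s => f s v)); auto.
      apply Derive_correct; eapply Cn_ex_derive_u; eauto.
    + intros u v Duv. replace (-1 * _ * _) with (- Dv f u v / f u v ^ 2)
        by (field; auto).
      apply (is_derive_inv (fun t => f u t)); auto.
      apply Derive_correct; eapply Cn_ex_derive_v; eauto.
    + repeat apply Cn_mult; auto using Cn_const, Cn_Du.
    + repeat apply Cn_mult; auto using Cn_const, Cn_Dv.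
Qed.

(** The derivative is [f' / (2 sqrt f)], so [Cn_inv] applied to [sqrt f] at the
    previous order closes the induction. *)
Lemma Cn_sqrt (D : R * R -> Prop) n f :
  open D -> (forall u v, D (u, v) -> 0 < f u v) ->
  Cn D n f -> Cn D n (fun u v => sqrt (f u v)).
Proof.
  intros oD f0.
  assert (s0 : forall u v, D (u, v) -> sqrt (f u v) <> 0).
  { intros u v Duv. apply Rgt_not_eq, sqrt_lt_R0; auto. }
  assert (cs : forall m, Cn D m f -> forall u v, D (u, v) ->
            continuity_2d_pt (fun u v => sqrt (f u v)) u v).
  { intros m Cf u v Duv. apply (continuity_1d_2d_pt_comp sqrt).
    - apply continuity_pt_sqrt. left; auto.
    - eapply Cn_continuity; eauto. }
  induction n; intros Cf.
  - intros u v Duv. split; eauto.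
  - assert (Cs : Cn D n (fun u v => sqrt (f u v))).
    { apply IHn. apply (Cn_le D (S n)); auto; lia. }
    apply Cn_S with (fu := fun u v => (/ 2 * Du f u v) * / sqrt (f u v))
      (fv := fun u v => (/ 2 * Dv f u v) * / sqrt (f u v)); eauto.
    + intros u v Duv. replace (_ * _ * _) with (Du f u v / (2 * sqrt (f u v)))
        by (field; auto).
      apply (is_derive_sqrt (fun s => f s v)); auto.
      apply Derive_correct; eapply Cn_ex_derive_u; eauto.
    + intros u v Duv. replace (_ * _ * _) with (Dv f u v / (2 * sqrt (f u v)))
        by (field; auto).
      apply (is_derive_sqrt (fun t => f u t)); auto.
      apply Derive_correct; eapply Cn_ex_derive_v; eauto.
    + repeat apply Cn_mult; auto using Cn_const, Cn_Du, Cn_inv.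
    + repeat apply Cn_mult; auto using Cn_const, Cn_Dv, Cn_inv.
Qed.

Lemma smooth_Cn D f : smooth_on D f <-> forall n, Cn D n f.
Proof.
  split; [intros H n u v Duv | intros H u v Duv n]; now apply H.
Qed.

Lemma smooth_ext (D : R * R -> Prop) f g :
  open D -> (forall s t, D (s, t) -> f s t = g s t) ->
  smooth_on D f -> smooth_on D g.
Proof. rewrite !smooth_Cn. intros oD fg H n. eapply Cn_ext; eauto. Qed.

Lemma smooth_subset (D D' : R * R -> Prop) f :
  (forall p, D' p -> D p) -> smooth_on D f -> smooth_on D' f.
Proof. intros sub H u v Duv. apply H, sub, Duv. Qed.

Lemma smooth_Du D f : smooth_on D f -> smooth_on D (Du f).
Proof. rewrite !smooth_Cn. intros H n. now apply Cn_Du. Qed.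

Lemma smooth_Dv D f : smooth_on D f -> smooth_on D (Dv f).
Proof. rewrite !smooth_Cn. intros H n. now apply Cn_Dv. Qed.

Lemma smooth_const D c : smooth_on D (fun _ _ => c).
Proof. apply smooth_Cn. intros n; apply Cn_const. Qed.

Lemma smooth_plus D f g :
  open D -> smooth_on D f -> smooth_on D g ->
  smooth_on D (fun u v => f u v + g u v).
Proof. rewrite !smooth_Cn. intros; now apply Cn_plus. Qed.

Lemma smooth_mult D f g :
  open D -> smooth_on D f -> smooth_on D g ->
  smooth_on D (fun u v => f u v * g u v).
Proof. rewrite !smooth_Cn. intros; now apply Cn_mult. Qed.

Lemma smooth_opp D f :
  open D -> smooth_on D f -> smooth_on D (fun u v => - f u v).
Proof.
  intros oD Sf. apply (smooth_ext D (fun u v => -1 * f u v)); auto.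
  - intros; ring.
  - apply smooth_mult; auto using smooth_const.
Qed.

Lemma smooth_minus D f g :
  open D -> smooth_on D f -> smooth_on D g ->
  smooth_on D (fun u v => f u v - g u v).
Proof. intros. apply smooth_plus; auto using smooth_opp. Qed.

Lemma smooth_inv (D : R * R -> Prop) f :
  open D -> (forall u v, D (u, v) -> f u v <> 0) -> smooth_on D f ->
  smooth_on D (fun u v => / f u v).
Proof. rewrite !smooth_Cn. intros; now apply Cn_inv. Qed.

Lemma smooth_sqrt (D : R * R -> Prop) f :
  open D -> (forall u v, D (u, v) -> 0 < f u v) -> smooth_on D f ->
  smooth_on D (fun u v => sqrt (f u v)).
Proof. rewrite !smooth_Cn. intros; now apply Cn_sqrt. Qed.

Lemma smooth_continuity (D : R * R -> Prop) f u v :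
  smooth_on D f -> D (u, v) -> continuity_2d_pt f u v.
Proof. intros Sf Duv. apply (Sf u v Duv 0%nat). Qed.

Lemma smooth_is_derive_u (D : R * R -> Prop) f u v :
  smooth_on D f -> D (u, v) -> is_derive (fun s => f s v) u (Du f u v).
Proof. intros Sf Duv. apply Derive_correct, (Sf u v Duv 1%nat). Qed.

Lemma smooth_is_derive_v (D : R * R -> Prop) f u v :
  smooth_on D f -> D (u, v) -> is_derive (fun t => f u t) v (Dv f u v).
Proof. intros Sf Duv. apply Derive_correct, (Sf u v Duv 1%nat). Qed.

Lemma smooth_Dv_Du (D : R * R -> Prop) f u v :
  open D -> smooth_on D f -> D (u, v) -> Dv (Du f) u v = Du (Dv f) u v.
Proof.
  intros oD Sf Duv. symmetry. apply (Schwarz f).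
  - destruct (open_locally_2d _ _ _ oD Duv) as [d Hd].
    exists d. intros s t Hs Ht. assert (Dst := Hd s t Hs Ht).
    repeat split.
    + apply (Sf s t Dst 1%nat).
    + apply (Sf s t Dst 1%nat).
    + apply (smooth_Dv _ _ Sf s t Dst 1%nat).
    + apply (smooth_Du _ _ Sf s t Dst 1%nat).
  - apply (smooth_continuity D (Du (Dv f))); auto using smooth_Du, smooth_Dv.
  - apply (smooth_continuity D (Dv (Du f))); auto using smooth_Du, smooth_Dv.
Qed.

(** * Fixed points of integral operators on bounded continuous functions *)

Definition cont2 (f : R -> R -> R) : Prop :=
  forall u v, continuity_2d_pt f u v.

Lemma pow_half_small M eps : 0 < eps -> exists n, M * (1 / 2) ^ n < eps.
Proof.
  intros He.
  destruct (Rle_lt_dec M 0) as [HM | HM].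
  { exists 0%nat. simpl. lra. }
  destruct (pow_lt_1_zero (1 / 2) ltac:(rewrite Rabs_pos_eq; lra) (eps / M)
              ltac:(apply Rdiv_lt_0_compat; lra)) as [n Hn].
  exists n. specialize (Hn n (Nat.le_refl n)).
  rewrite Rabs_pos_eq in Hn by (apply pow_le; lra).
  apply Rmult_lt_compat_l with (r := M) in Hn; auto.
  replace (M * (eps / M)) with eps in Hn by (field; lra). lra.
Qed.

Lemma le_half_pow_eq_0 x M : (forall n, Rabs x <= M * (1 / 2) ^ n) -> x = 0.
Proof.
  intros H. destruct (Req_dec x 0) as [|Hx]; auto.
  destruct (pow_half_small M (Rabs x) (Rabs_pos_lt _ Hx)) as [n Hn].
  specialize (H n). lra.
Qed.

(** Geometric decay of the increments is kept quantitative, because the limit is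
    later used for continuity and for passing to the limit in an operator. *)
Lemma fast_cauchy_limit (a : nat -> R) M :
  0 <= M -> (forall n, Rabs (a (S n) - a n) <= M * (1 / 2) ^ n) ->
  forall n, Rabs (real (Lim_seq a) - a n) <= 2 * M * (1 / 2) ^ n.
Proof.
  intros HM Ha.
  assert (Hp : forall n, 0 <= (1 / 2) ^ n) by (intros; apply pow_le; lra).
  assert (Hk : forall n k, Rabs (a (n + k)%nat - a n)
             <= 2 * M * (1 / 2) ^ n - 2 * M * (1 / 2) ^ (n + k)).
  { intros n; induction k.
    - rewrite Nat.add_0_r, Rminus_diag, Rabs_R0. lra.
    - rewrite Nat.add_succ_r.
      replace (a (S (n + k)) - a n)
        with ((a (S (n + k)) - a (n + k)%nat) + (a (n + k)%nat - a n)) by ring.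
      eapply Rle_trans; [apply Rabs_triang|].
      specialize (Ha (n + k)%nat). simpl. lra. }
  assert (Hk' : forall n m, (n <= m)%nat ->
             Rabs (a m - a n) <= 2 * M * (1 / 2) ^ n).
  { intros n m Hnm. replace m with (n + (m - n))%nat by lia.
    eapply Rle_trans; [apply Hk|].
    specialize (Hp (n + (m - n))%nat). nra. }
  assert (Hc : ex_finite_lim_seq a).
  { apply ex_lim_seq_cauchy_corr. intros eps.
    destruct (pow_half_small (4 * M) eps (cond_pos eps)) as [N HN].
    exists N. intros n m Hn Hm.
    replace (a n - a m) with ((a n - a N) - (a m - a N)) by ring.
    eapply Rle_lt_trans; [apply Rabs_triang|]. rewrite Rabs_Ropp.
    assert (H1 := Hk' N n Hn). assert (H2 := Hk' N m Hm). lra. }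
  intros n. apply Lim_seq_correct' in Hc.
  apply (is_lim_seq_le_loc (fun m => Rabs (a m - a n))
           (fun _ => 2 * M * (1 / 2) ^ n)
           (Rabs (real (Lim_seq a) - a n)) (2 * M * (1 / 2) ^ n)).
  - exists n. intros m Hm. now apply Hk'.
  - apply (is_lim_seq_abs (fun m => a m - a n) (Finite _)).
    apply (is_lim_seq_minus' _ (fun _ => a n)); auto using is_lim_seq_const.
  - apply is_lim_seq_const.
Qed.

Lemma cont2_uniform_limit (S : nat -> R -> R -> R) f M :
  (forall n, cont2 (S n)) ->
  (forall n u v, Rabs (f u v - S n u v) <= M * (1 / 2) ^ n) -> cont2 f.
Proof.
  intros HS Hf u v eps.
  assert (He : 0 < eps / 3) by (destruct eps; simpl; lra).
  destruct (pow_half_small M _ He) as [n Hn].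
  destruct (HS n u v (mkposreal _ He)) as [d Hd]. simpl in Hd.
  exists d. intros s t Hs Ht. specialize (Hd s t Hs Ht).
  replace (f s t - f u v)
    with ((f s t - S n s t) + (S n s t - S n u v) - (f u v - S n u v)) by ring.
  assert (H1 := Hf n s t). assert (H2 := Hf n u v).
  unfold Rabs in *. repeat destruct Rcase_abs; lra.
Qed.

(** Banach's theorem for the supremum norm over the whole plane. Families of
    functions are indexed by [nat] and only the first [N + 1] members count. The
    contraction property is asked only for continuous families, since the
    integral operators to which this is applied make sense only for them. *)
Theorem contraction_fixed_point (N : nat)
    (T : (nat -> R -> R -> R) -> nat -> R -> R -> R) (Y0 : nat -> R -> R -> R)
    (M0 : R) :
  (forall i, (i <= N)%nat -> cont2 (Y0 i)) ->
  (forall i u v, (i <= N)%nat -> Rabs (T Y0 i u v - Y0 i u v) <= M0) ->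
  (forall Y, (forall i, (i <= N)%nat -> cont2 (Y i)) ->
     forall i, (i <= N)%nat -> cont2 (T Y i)) ->
  (forall Y Z M, (forall i, (i <= N)%nat -> cont2 (Y i)) ->
     (forall i, (i <= N)%nat -> cont2 (Z i)) ->
     (forall i u v, (i <= N)%nat -> Rabs (Y i u v - Z i u v) <= M) ->
     forall i u v, (i <= N)%nat -> Rabs (T Y i u v - T Z i u v) <= M * (1 / 2)) ->
  exists Y, (forall i, (i <= N)%nat -> cont2 (Y i)) /\
    (forall i u v, (i <= N)%nat -> Rabs (Y i u v - Y0 i u v) <= 2 * M0) /\
    (forall i u v, (i <= N)%nat -> Y i u v = T Y i u v).
Proof.
  intros cY0 bY0 cT hT.
  assert (HM0 : 0 <= M0).
  { eapply Rle_trans; [|apply (bY0 0%nat 0 0); lia]. apply Rabs_pos. }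
  set (S := fix S n := match n with O => Y0 | Datatypes.S n => T (S n) end).
  assert (cS : forall n i, (i <= N)%nat -> cont2 (S n i)).
  { induction n; simpl; auto. }
  assert (dS : forall n i u v, (i <= N)%nat ->
            Rabs (S (Datatypes.S n) i u v - S n i u v) <= M0 * (1 / 2) ^ n).
  { induction n; intros i u v Hi.
    - simpl. rewrite Rmult_1_r. auto.
    - simpl pow. rewrite (Rmult_comm (1 / 2)), <- Rmult_assoc.
      apply (hT (S (Datatypes.S n)) (S n)); auto. }
  set (Y := fun i u v => real (Lim_seq (fun n => S n i u v))).
  assert (YS : forall n i u v, (i <= N)%nat ->
            Rabs (Y i u v - S n i u v) <= 2 * M0 * (1 / 2) ^ n).
  { intros n i u v Hi. apply (fast_cauchy_limit (fun n => S n i u v)); auto. }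
  assert (cY : forall i, (i <= N)%nat -> cont2 (Y i)).
  { intros i Hi. apply (cont2_uniform_limit (fun n => S n i) _ (2 * M0)); auto. }
  exists Y. repeat split; auto.
  - intros i u v Hi. specialize (YS 0%nat i u v Hi). simpl in YS. lra.
  - intros i u v Hi. apply Rminus_diag_uniq.
    apply le_half_pow_eq_0 with (M := 4 * M0). intros n.
    assert (H1 := YS (Datatypes.S n) i u v Hi).
    assert (H2 := hT (S n) Y (2 * M0 * (1 / 2) ^ n) (cS n) cY
              ltac:(intros; rewrite Rabs_minus_sym; auto) i u v Hi).
    assert (Hp : 0 <= (1 / 2) ^ n) by (apply pow_le; lra).
    simpl S in H1. simpl pow in H1.
    replace (Y i u v - T Y i u v)
      with ((Y i u v - T (S n) i u v) + (T (S n) i u v - T Y i u v)) by ring.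
    eapply Rle_trans; [apply Rabs_triang|]. nra.
Qed.

(** * Integrals depending on a parameter *)

Lemma continuity_2d_pt_swap f x y :
  continuity_2d_pt f x y -> continuity_2d_pt (fun s t => f t s) y x.
Proof.
  intros H eps. destruct (H eps) as [d Hd]. exists d. intros; now apply Hd.
Qed.

Lemma continuity_2d_pt_continuous_u f x y :
  continuity_2d_pt f x y -> continuous (fun s => f s y) x.
Proof.
  intros H. apply filterlim_locally. intros eps.
  destruct (H eps) as [d Hd]. exists d. intros s Hs. apply Hd; auto.
  rewrite Rminus_diag, Rabs_R0. apply cond_pos.
Qed.

Lemma continuity_2d_pt_continuous_v f x y :
  continuity_2d_pt f x y -> continuous (fun t => f x t) y.
Proof.
  intros H. apply (continuity_2d_pt_continuous_u (fun s t => f t s)).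
  now apply continuity_2d_pt_swap.
Qed.

Lemma RInt_abs_le_const (f : R -> R) a b M :
  (forall x, Rmin a b <= x <= Rmax a b -> continuous f x) ->
  (forall x, Rmin a b <= x <= Rmax a b -> Rabs (f x) <= M) ->
  Rabs (RInt f a b) <= Rabs (b - a) * M.
Proof.
  intros cf bf. destruct (Rle_dec a b) as [H | H].
  - rewrite Rmin_left, Rmax_right in * by lra. rewrite (Rabs_pos_eq (b - a)) by lra.
    apply abs_RInt_le_const; auto.
    apply (ex_RInt_continuous f); rewrite Rmin_left, Rmax_right by lra; exact cf.
  - rewrite Rmin_right, Rmax_left in * by lra.
    assert (E : ex_RInt f b a).
    { apply (ex_RInt_continuous f); rewrite Rmin_left, Rmax_right by lra; exact cf. }
    rewrite <- opp_RInt_swap by exact E.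
    unfold opp; simpl. rewrite Rabs_Ropp, (Rabs_left (b - a)) by lra.
    replace (- (b - a)) with (a - b) by ring. apply abs_RInt_le_const; auto; lra.
Qed.

(** Moving the upper limit changes the integral little because [h] is bounded near
    the endpoint; moving the parameter changes it little because [h] is uniformly
    continuous near the compact vertical segment of integration. *)
Lemma cont2_RInt_v h c : cont2 h -> cont2 (fun u v => RInt (h u) c v).
Proof.
  intros ch u v eps.
  assert (ex : forall s a b, ex_RInt (h s) a b).
  { intros. apply (ex_RInt_continuous (h s)). intros.
    apply (continuity_2d_pt_continuous_v h); apply ch. }
  set (L := Rabs (v - c) + 1).
  assert (HL : 0 < L) by (unfold L; assert (H := Rabs_pos (v - c)); lra).
  set (K := Rabs (h u v) + 1).
  assert (HK : 0 < K) by (unfold K; assert (H := Rabs_pos (h u v)); lra).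
  destruct eps as [eps He]; simpl.
  assert (He1 : 0 < eps / (2 * L)) by (apply Rdiv_lt_0_compat; lra).
  destruct (uniform_continuity_2d_1d' h (Rmin c v) (Rmax c v) u
              (fun x _ => ch u x) (mkposreal _ He1)) as [d1 H1]; simpl in H1.
  destruct (ch u v (mkposreal 1 Rlt_0_1)) as [d2 H2]; simpl in H2.
  assert (He3 : 0 < eps / (2 * K)) by (apply Rdiv_lt_0_compat; lra).
  set (d := Rmin (Rmin d1 d2) (eps / (2 * K))).
  assert (Hd : 0 < d) by (repeat apply Rmin_pos; auto; apply cond_pos).
  exists (mkposreal d Hd). simpl. intros s t Hs Ht.
  assert (d <= d1) by (unfold d; eapply Rle_trans; apply Rmin_l).
  assert (d <= d2) by (unfold d; eapply Rle_trans; [apply Rmin_l | apply Rmin_r]).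
  assert (d <= eps / (2 * K)) by apply Rmin_r.
  assert (Hs' := Rabs_def2 _ _ Hs). assert (Ht' := Rabs_def2 _ _ Ht).
  replace (RInt (h s) c t - RInt (h u) c v)
    with (RInt (fun x => h s x - h u x) c v + RInt (h s) v t).
  2:{ rewrite (RInt_minus (h s) (h u)) by auto. unfold minus, plus, opp; simpl.
      rewrite <- (RInt_Chasles (h s) c v t) by auto. unfold plus; simpl. ring. }
  eapply Rle_lt_trans; [apply Rabs_triang|].
  assert (A1 : Rabs (RInt (fun x => h s x - h u x) c v)
            <= Rabs (v - c) * (eps / (2 * L))).
  { apply RInt_abs_le_const.
    - intros x _. apply (continuous_minus (h s) (h u));
      apply (continuity_2d_pt_continuous_v h); apply ch.
    - intros x Hx. left. apply (H1 x u x s); auto; try lra.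
      rewrite Rminus_diag, Rabs_R0. apply cond_pos. }
  assert (A2 : Rabs (RInt (h s) v t) <= Rabs (t - v) * K).
  { apply RInt_abs_le_const.
    - intros x _. apply (continuity_2d_pt_continuous_v h); apply ch.
    - intros x Hx.
      assert (Hxv : Rabs (x - v) < d2).
      { apply Rabs_def1; revert Hx; unfold Rmin, Rmax;
        destruct Rle_dec; lra. }
      specialize (H2 s x ltac:(lra) Hxv).
      unfold K. assert (T := Rabs_triang (h s x - h u v) (h u v)).
      replace (h s x - h u v + h u v) with (h s x) in T by ring. lra. }
  assert (A3 : Rabs (v - c) * (eps / (2 * L)) < eps / 2).
  { replace (eps / 2) with (L * (eps / (2 * L))) by (field; lra).
    apply Rmult_lt_compat_r; auto. unfold L. lra. }
  assert (A4 : Rabs (t - v) * K <= eps / 2).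
  { replace (eps / 2) with (eps / (2 * K) * K) by (field; lra).
    apply Rmult_le_compat_r; lra. }
  lra.
Qed.

(** * Linear systems *)

(** A row [a] of a coefficient matrix applied to the unknowns [Y]. The sum has
    [N + 1] terms, whence the factors [INR (S N)] below. *)
Definition lin (N : nat) (a Y : nat -> R -> R -> R) (u v : R) : R :=
  sum_f_R0 (fun j => a j u v * Y j u v) N.

Lemma lin_bound N a Y u v C M :
  (forall j, (j <= N)%nat -> Rabs (a j u v) <= C) ->
  (forall j, (j <= N)%nat -> Rabs (Y j u v) <= M) ->
  Rabs (lin N a Y u v) <= INR (S N) * C * M.
Proof.
  intros Ha HY. unfold lin. eapply Rle_trans; [apply Rsum_abs|].
  replace (INR (S N) * C * M) with (C * M * INR (S N)) by ring.
  rewrite <- sum_cte. apply sum_Rle. intros j Hj. rewrite Rabs_mult.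
  apply Rmult_le_compat; auto using Rabs_pos.
Qed.

Lemma lin_minus N a Y Z u v :
  lin N a Y u v - lin N a Z u v
  = lin N a (fun j s t => Y j s t - Z j s t) u v.
Proof.
  unfold lin. rewrite <- minus_sum. apply sum_eq. intros; ring.
Qed.

Lemma lin_plus_l N a b Y u v :
  lin N a Y u v + lin N b Y u v
  = lin N (fun j s t => a j s t + b j s t) Y u v.
Proof.
  unfold lin. rewrite <- plus_sum. apply sum_eq. intros; ring.
Qed.

Lemma lin_ext N a a' Y Y' u v :
  (forall j, (j <= N)%nat -> a j u v = a' j u v) ->
  (forall j, (j <= N)%nat -> Y j u v = Y' j u v) ->
  lin N a Y u v = lin N a' Y' u v.
Proof. intros Ha HY. apply sum_eq. intros j Hj. now rewrite Ha, HY. Qed.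

Lemma sum_f_R0_switch (f : nat -> nat -> R) m n :
  sum_f_R0 (fun j => sum_f_R0 (f j) n) m
  = sum_f_R0 (fun k => sum_f_R0 (fun j => f j k) m) n.
Proof.
  induction m; simpl; auto. rewrite IHm, <- plus_sum. reflexivity.
Qed.

Lemma lin_assoc N a (B : nat -> nat -> R -> R -> R) Y u v :
  lin N a (fun j => lin N (B j) Y) u v
  = lin N (fun k s t => sum_f_R0 (fun j => a j s t * B j k s t) N) Y u v.
Proof.
  unfold lin.
  transitivity (sum_f_R0 (fun j => sum_f_R0
     (fun k => a j u v * B j k u v * Y k u v) N) N).
  - apply sum_eq. intros j _. rewrite scal_sum. apply sum_eq. intros; ring.
  - rewrite sum_f_R0_switch. apply sum_eq. intros k _.
    rewrite Rmult_comm, scal_sum. apply sum_eq. intros; ring.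
Qed.

Lemma lin_continuity_2d_pt N a Y u v :
  (forall j, (j <= N)%nat -> continuity_2d_pt (a j) u v) ->
  (forall j, (j <= N)%nat -> continuity_2d_pt (Y j) u v) ->
  continuity_2d_pt (lin N a Y) u v.
Proof.
  unfold lin. induction N; intros Ha HY; simpl.
  - apply continuity_2d_pt_mult; auto.
  - apply continuity_2d_pt_plus; [apply IHN; auto|].
    apply continuity_2d_pt_mult; auto.
Qed.

Lemma lin_is_derive_u N a Y da dY u v :
  (forall j, (j <= N)%nat -> is_derive (fun s => a j s v) u (da j u v)) ->
  (forall j, (j <= N)%nat -> is_derive (fun s => Y j s v) u (dY j u v)) ->
  is_derive (fun s => lin N a Y s v) u (lin N da Y u v + lin N a dY u v).
Proof.
  assert (P : forall j, is_derive (fun s => a j s v) u (da j u v) ->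
     is_derive (fun s => Y j s v) u (dY j u v) ->
     is_derive (fun s => a j s v * Y j s v) u
       (da j u v * Y j u v + a j u v * dY j u v)).
  { intros j H1 H2.
    apply (is_derive_mult (fun s => a j s v) (fun s => Y j s v)); auto.
    intros; apply Rmult_comm. }
  unfold lin. induction N; intros Ha HY; simpl.
  - apply P; auto.
  - match goal with |- is_derive _ _ ?d => replace d with
      ((sum_f_R0 (fun j => da j u v * Y j u v) N
        + sum_f_R0 (fun j => a j u v * dY j u v) N)
       + (da (S N) u v * Y (S N) u v + a (S N) u v * dY (S N) u v)) by ring
    end.
    apply (is_derive_plus (fun s => sum_f_R0 (fun j => a j s v * Y j s v) N)
             (fun s => a (S N) s v * Y (S N) s v)); [apply IHN; auto|].
    apply P; auto.
Qed.

Lemma lin_is_derive_v N a Y da dY u v :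
  (forall j, (j <= N)%nat -> is_derive (fun t => a j u t) v (da j u v)) ->
  (forall j, (j <= N)%nat -> is_derive (fun t => Y j u t) v (dY j u v)) ->
  is_derive (fun t => lin N a Y u t) v (lin N da Y u v + lin N a dY u v).
Proof.
  intros Ha HY.
  apply (lin_is_derive_u N (fun j s t => a j t s) (fun j s t => Y j t s)
           (fun j s t => da j t s) (fun j s t => dY j t s) v u Ha HY).
Qed.

Lemma lin_Cn (D : R * R -> Prop) n N a Y :
  open D -> (forall j, (j <= N)%nat -> Cn D n (a j)) ->
  (forall j, (j <= N)%nat -> Cn D n (Y j)) -> Cn D n (lin N a Y).
Proof.
  intros oD. unfold lin. induction N; intros Ha HY; simpl.
  - apply Cn_mult; auto.
  - apply Cn_plus; auto. apply Cn_mult; auto.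
Qed.

(** Freezing the variables outside an interval turns coefficients that are given
    near a point into globally continuous, bounded ones, and keeps all paths of
    integration of length at most [d]. The Picard operator is then defined on
    functions on the whole plane. *)
Definition clamp (c d x : R) : R := Rmax (c - d) (Rmin (c + d) x).

Lemma clamp_in c d x : 0 <= d -> c - d <= clamp c d x <= c + d.
Proof.
  intros. unfold clamp, Rmax, Rmin. repeat destruct Rle_dec; lra.
Qed.

Lemma clamp_dist c d x : 0 <= d -> Rabs (clamp c d x - c) <= d.
Proof. intros Hd. assert (H := clamp_in c d x Hd). apply Rabs_le. lra. Qed.

Lemma clamp_id c d x : Rabs (x - c) <= d -> clamp c d x = x.
Proof.
  intros H. apply Rabs_le_between in H. unfold clamp, Rmax, Rmin.
  repeat destruct Rle_dec; lra.
Qed.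

Lemma clamp_lipschitz c d x y :
  Rabs (clamp c d x - clamp c d y) <= Rabs (x - y).
Proof.
  unfold clamp, Rmax, Rmin, Rabs.
  repeat destruct Rle_dec; repeat destruct Rcase_abs; lra.
Qed.

Lemma continuity_2d_pt_lipschitz_comp f (phi psi : R -> R) u v :
  (forall x y, Rabs (phi x - phi y) <= Rabs (x - y)) ->
  (forall x y, Rabs (psi x - psi y) <= Rabs (x - y)) ->
  continuity_2d_pt f (phi u) (psi v) ->
  continuity_2d_pt (fun s t => f (phi s) (psi t)) u v.
Proof.
  intros Hphi Hpsi Hf eps. destruct (Hf eps) as [d Hd]. exists d.
  intros s t Hs Ht. apply Hd.
  - apply Rle_lt_trans with (2 := Hs). auto.
  - apply Rle_lt_trans with (2 := Ht). auto.
Qed.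

(** The integral equation along the path from [(u0, v0)] to [(u, v0)] and then to
    [(u, v)]. The smallness of [d] makes the two integrals together a contraction
    by the factor 1/2. *)
Lemma linear_picard N (A B : nat -> nat -> R -> R -> R) C d u0 v0 y0 :
  0 < d -> 4 * d * (INR (S N) * C) <= 1 ->
  (forall i j, (i <= N)%nat -> (j <= N)%nat -> cont2 (A i j)) ->
  (forall i j, (i <= N)%nat -> (j <= N)%nat -> cont2 (B i j)) ->
  (forall i j u v, (i <= N)%nat -> (j <= N)%nat -> Rabs (A i j u v) <= C) ->
  (forall i j u v, (i <= N)%nat -> (j <= N)%nat -> Rabs (B i j u v) <= C) ->
  exists Y K, (forall i, (i <= N)%nat -> cont2 (Y i)) /\
    (forall i u v, (i <= N)%nat -> Rabs (Y i u v) <= K) /\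
    (forall i u v, (i <= N)%nat ->
       Y i u v = y0 i + RInt (fun s => lin N (A i) Y s v0) u0 (clamp u0 d u)
                 + RInt (fun t => lin N (B i) Y u t) v0 (clamp v0 d v)).
Proof.
  intros Hd HC cA cB bA bB.
  set (T := fun (Y : nat -> R -> R -> R) i u v =>
     y0 i + RInt (fun s => lin N (A i) Y s v0) u0 (clamp u0 d u)
          + RInt (fun t => lin N (B i) Y u t) v0 (clamp v0 d v)).
  set (Y0 := fun (i : nat) (_ _ : R) => y0 i).
  assert (cl : forall Y a, (forall i, (i <= N)%nat -> cont2 (Y i)) ->
     (forall j, (j <= N)%nat -> cont2 (a j)) -> cont2 (lin N a Y)).
  { intros Y a HY Ha u v. apply lin_continuity_2d_pt; intros.
    - now apply Ha. - now apply HY. }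
  assert (cclamp : forall f c, cont2 f ->
            cont2 (fun u v => f u (clamp c d v))).
  { intros f c Hf u v.
    apply (continuity_2d_pt_lipschitz_comp f (fun x => x) (clamp c d));
      auto using clamp_lipschitz; intros; lra. }
  assert (bI : forall Y Z M, (forall i, (i <= N)%nat -> cont2 (Y i)) ->
     (forall i, (i <= N)%nat -> cont2 (Z i)) ->
     (forall i u v, (i <= N)%nat -> Rabs (Y i u v - Z i u v) <= M) ->
     forall i u v, (i <= N)%nat -> Rabs (T Y i u v - T Z i u v) <= M * (1 / 2)).
  { intros Y Z M cY cZ YZ i u v Hi.
    assert (HM : 0 <= M).
    { eapply Rle_trans; [apply Rabs_pos | apply (YZ 0%nat 0 0); lia]. }
    assert (HC0 : 0 <= C).
    { eapply Rle_trans; [apply Rabs_pos | apply (bA 0%nat 0%nat 0 0); lia]. }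
    assert (HN : 0 <= INR (S N)) by apply pos_INR.
    unfold T.
    assert (IU : Rabs (RInt (fun s => lin N (A i) Y s v0 - lin N (A i) Z s v0)
                   u0 (clamp u0 d u)) <= d * (INR (S N) * C * M)).
    { eapply Rle_trans; [apply RInt_abs_le_const with (M := INR (S N) * C * M)|].
      - intros s _. apply (continuous_minus (fun s => lin N (A i) Y s v0)
                             (fun s => lin N (A i) Z s v0));
        apply (continuity_2d_pt_continuous_u (lin N (A i) _)); apply cl; auto.
      - intros s _. rewrite lin_minus. apply lin_bound; auto.
      - apply Rmult_le_compat_r.
        + repeat apply Rmult_le_pos; auto.
        + apply clamp_dist; lra. }
    assert (IV : Rabs (RInt (fun t => lin N (B i) Y u t - lin N (B i) Z u t)
                   v0 (clamp v0 d v)) <= d * (INR (S N) * C * M)).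
    { eapply Rle_trans; [apply RInt_abs_le_const with (M := INR (S N) * C * M)|].
      - intros s _. apply (continuous_minus (fun s => lin N (B i) Y u s)
                             (fun s => lin N (B i) Z u s));
        apply (continuity_2d_pt_continuous_v (lin N (B i) _)); apply cl; auto.
      - intros s _. rewrite lin_minus. apply lin_bound; auto.
      - apply Rmult_le_compat_r.
        + repeat apply Rmult_le_pos; auto.
        + apply clamp_dist; lra. }
    rewrite (RInt_minus (fun s => lin N (A i) Y s v0)
              (fun s => lin N (A i) Z s v0)) in IU;
      try (apply (ex_RInt_continuous (fun s => lin N (A i) _ s v0)); intros s _;
        apply (continuity_2d_pt_continuous_u (lin N (A i) _)); apply cl; auto).
    rewrite (RInt_minus (fun t => lin N (B i) Y u t)
              (fun t => lin N (B i) Z u t)) in IV;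
      try (apply (ex_RInt_continuous (fun t => lin N (B i) _ u t)); intros t _;
        apply (continuity_2d_pt_continuous_v (lin N (B i) _)); apply cl; auto).
    unfold minus, plus, opp in IU, IV; simpl in IU, IV.
    match type of IU with Rabs ?a <= _ => match type of IV with Rabs ?b <= _ =>
      match goal with |- Rabs ?c <= _ => replace c with (a + b) by ring end end end.
    eapply Rle_trans; [apply Rabs_triang|].
    assert (4 * d * (INR (S N) * C) * M <= 1 * M)
      by (apply Rmult_le_compat_r; auto).
    change (match N with 0%nat => 1 | S _ => INR N + 1 end) with (INR (S N)) in *.
    lra. }
  assert (cT : forall Y, (forall i, (i <= N)%nat -> cont2 (Y i)) ->
     forall i, (i <= N)%nat -> cont2 (T Y i)).
  { intros Y cY i Hi u v. unfold T. apply continuity_2d_pt_plus.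
    - apply continuity_2d_pt_plus; [apply continuity_2d_pt_const|].
      apply (continuity_2d_pt_swap
        (fun _ s => RInt (fun s => lin N (A i) Y s v0) u0 (clamp u0 d s))).
      apply (cclamp (fun _ s => RInt (fun s => lin N (A i) Y s v0) u0 s)).
      apply (cont2_RInt_v (fun _ s => lin N (A i) Y s v0)).
      intros x s. apply (continuity_1d_2d_pt_comp (fun s => lin N (A i) Y s v0)
                          (fun _ s => s)).
      + apply continuity_pt_filterlim.
        apply (continuity_2d_pt_continuous_u (lin N (A i) _)); apply cl; auto.
      + apply continuity_2d_pt_id2.
    - apply (cclamp (fun u v => RInt (fun t => lin N (B i) Y u t) v0 v)).
      apply (cont2_RInt_v (lin N (B i) Y)). apply cl; auto. }
  assert (cY0 : forall i, (i <= N)%nat -> cont2 (Y0 i)).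
  { intros i _ u v. apply continuity_2d_pt_const. }
  (* The zero family is mapped to the constant initial values, so the contraction
     property also bounds the first Picard step. *)
  set (K0 := sum_f_R0 (fun i => Rabs (y0 i)) N).
  assert (bY0 : forall i, (i <= N)%nat -> Rabs (y0 i) <= K0).
  { intros i Hi. unfold K0. clear - Hi. induction N; simpl.
    - replace i with 0%nat by lia. lra.
    - destruct (Nat.eq_dec i (S N)) as [-> | H].
      + assert (0 <= sum_f_R0 (fun i => Rabs (y0 i)) N)
          by (apply cond_pos_sum; intros; apply Rabs_pos). lra.
      + assert (H1 := IHN ltac:(lia)). assert (H2 := Rabs_pos (y0 (S N))). lra. }
  destruct (contraction_fixed_point N T Y0 (K0 * (1 / 2))) as (Y & cY & bY & EY);
    auto.
  - intros i u v Hi.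
    assert (H := bI Y0 (fun _ _ _ => 0) K0 cY0
       ltac:(intros ? ? ? ?; apply continuity_2d_pt_const)
       ltac:(intros; rewrite Rminus_0_r; apply bY0; auto) i u v Hi).
    replace (T (fun _ _ _ => 0) i u v) with (Y0 i u v) in H; auto.
    unfold T, Y0.
    assert (L0 : forall a s t, lin N a (fun _ _ _ => 0) s t = 0).
    { intros a s t. unfold lin. rewrite (sum_eq _ (fun _ => 0)) by (intros; ring).
      rewrite sum_cte. ring. }
    rewrite (RInt_ext (fun s => lin N (A i) _ s v0) (fun _ => 0))
      by (intros; apply L0).
    rewrite (RInt_ext (fun t => lin N (B i) _ u t) (fun _ => 0))
      by (intros; apply L0).
    rewrite !RInt_const. unfold scal; simpl. unfold mult; simpl. ring.
  - exists Y, (2 * K0). split; [auto|]. split; [|exact EY].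
    intros i u v Hi. specialize (bY i u v Hi). unfold Y0 in bY.
    assert (H := bY0 i Hi). assert (T1 := Rabs_triang (Y i u v - y0 i) (y0 i)).
    replace (Y i u v - y0 i + y0 i) with (Y i u v) in T1 by ring. lra.
Qed.

(** * The Frobenius theorem for linear systems *)

Definition square (u0 v0 d : R) (p : R * R) : Prop :=
  Rabs (fst p - u0) < d /\ Rabs (snd p - v0) < d.

Lemma between_dist a b x d :
  Rabs (b - a) < d -> Rmin a b <= x <= Rmax a b -> Rabs (x - a) < d.
Proof.
  intros H Hx. apply Rabs_def2 in H. apply Rabs_def1; revert Hx;
  unfold Rmin, Rmax; destruct Rle_dec; lra.
Qed.

Lemma open_square u0 v0 d : open (square u0 v0 d).
Proof.
  intros [u v] [Hu Hv]. simpl in Hu, Hv.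
  apply (locally_2d_locally (fun s t => square u0 v0 d (s, t))).
  assert (He : 0 < Rmin (d - Rabs (u - u0)) (d - Rabs (v - v0)))
    by (apply Rmin_pos; lra).
  exists (mkposreal _ He). simpl. intros s t Hs Ht.
  assert (H1 := Rmin_l (d - Rabs (u - u0)) (d - Rabs (v - v0))).
  assert (H2 := Rmin_r (d - Rabs (u - u0)) (d - Rabs (v - v0))).
  split; simpl.
  - replace (s - u0) with ((s - u) + (u - u0)) by ring.
    eapply Rle_lt_trans; [apply Rabs_triang | lra].
  - replace (t - v0) with ((t - v) + (v - v0)) by ring.
    eapply Rle_lt_trans; [apply Rabs_triang | lra].
Qed.

Lemma square_segment_u u0 v0 d u v s :
  square u0 v0 d (u, v) -> Rmin u0 u <= s <= Rmax u0 u -> square u0 v0 d (s, v).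
Proof.
  intros [Hu Hv] Hs. split; auto. simpl in *. now apply between_dist with (b := u).
Qed.

Lemma square_segment_v u0 v0 d u v t :
  square u0 v0 d (u, v) -> Rmin v0 v <= t <= Rmax v0 v -> square u0 v0 d (u, t).
Proof.
  intros [Hu Hv] Ht. split; auto. simpl in *. now apply between_dist with (b := v).
Qed.

Lemma square_axis_u u0 v0 d u v :
  square u0 v0 d (u, v) -> square u0 v0 d (u0, v).
Proof.
  intros H. apply (square_segment_u u0 v0 d u v); auto.
  split; [apply Rmin_l | apply Rmax_l].
Qed.

Lemma square_axis_v u0 v0 d u v :
  square u0 v0 d (u, v) -> square u0 v0 d (u, v0).
Proof.
  intros H. apply (square_segment_v u0 v0 d u v); auto.
  split; [apply Rmin_l | apply Rmax_l].
Qed.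

Lemma MVT_bound (f df : R -> R) a b M :
  (forall x, Rmin a b <= x <= Rmax a b -> is_derive f x (df x)) ->
  (forall x, Rmin a b <= x <= Rmax a b -> Rabs (df x) <= M) ->
  Rabs (f b - f a) <= Rabs (b - a) * M.
Proof.
  intros Hf HM. destruct (MVT_gen f a b df) as (c & Hc & E).
  - intros x Hx. apply Hf. lra.
  - intros x Hx. apply derivable_continuous_pt. exists (df x).
    apply is_derive_Reals. auto.
  - rewrite E, Rabs_mult, Rmult_comm. apply Rmult_le_compat_l; auto using Rabs_pos.
Qed.

(** The fundamental theorem of calculus for integrands that are continuous only
    near the interval of integration. *)
Lemma is_derive_RInt_continuous (f : R -> R) a b r :
  Rabs (b - a) < r ->
  (forall x, Rabs (x - a) < r -> continuous f x) ->
  is_derive (fun x => RInt f a x) b (f b).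
Proof.
  intros Hb cf. apply (is_derive_RInt f (fun x => RInt f a x) a b); auto.
  exists (mkposreal (r - Rabs (b - a)) ltac:(lra)). intros x Hx.
  apply (RInt_correct f). apply (ex_RInt_continuous f).
  intros t Ht. apply cf. apply between_dist with (b := x); auto.
  change (Rabs (x - b) < r - Rabs (b - a)) in Hx.
  replace (x - a) with ((x - b) + (b - a)) by ring.
  eapply Rle_lt_trans; [apply Rabs_triang | lra].
Qed.

(** [Y] solves the vertical equation on the whole square, but the horizontal one
    only on the line [v = v0]. The function [P] replaces [Y (u, v)] by the value
    obtained by integrating [A Y] horizontally from [(u0, v)]; it satisfies the
    horizontal equation by construction, so the goal is that the defect
    [W = Y - P] vanishes. *)
Section Compatibility.

Variables (N : nat) (A B : nat -> nat -> R -> R -> R) (Y : nat -> R -> R -> R).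
Variables (C K d u0 v0 : R).
Let Q := square u0 v0 d.

Hypothesis d_pos : 0 < d.
Hypothesis d_le_1 : d <= 1.
Hypothesis dC : 4 * d * (INR (S N) * C) <= 1.
Hypothesis A_C1 : forall i j, (i <= N)%nat -> (j <= N)%nat -> Cn Q 1 (A i j).
Hypothesis B_C1 : forall i j, (i <= N)%nat -> (j <= N)%nat -> Cn Q 1 (B i j).
Hypothesis A_le : forall i j u v, (i <= N)%nat -> (j <= N)%nat -> Q (u, v) ->
  Rabs (A i j u v) <= C.
Hypothesis B_le : forall i j u v, (i <= N)%nat -> (j <= N)%nat -> Q (u, v) ->
  Rabs (B i j u v) <= C.
Hypothesis DuB_le : forall i j u v, (i <= N)%nat -> (j <= N)%nat -> Q (u, v) ->
  Rabs (Du (B i j) u v) <= C.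
Hypothesis integrable : forall i k u v, (i <= N)%nat -> (k <= N)%nat -> Q (u, v) ->
  Dv (A i k) u v + sum_f_R0 (fun j => A i j u v * B j k u v) N
  = Du (B i k) u v + sum_f_R0 (fun j => B i j u v * A j k u v) N.
Hypothesis Y_cont : forall i u v, (i <= N)%nat -> Q (u, v) ->
  continuity_2d_pt (Y i) u v.
Hypothesis Y_le : forall i u v, (i <= N)%nat -> Q (u, v) -> Rabs (Y i u v) <= K.
Hypothesis Y_dv : forall i u v, (i <= N)%nat -> Q (u, v) ->
  is_derive (fun t => Y i u t) v (lin N (B i) Y u v).
Hypothesis Y_du0 : forall i u, (i <= N)%nat -> Q (u, v0) ->
  is_derive (fun s => Y i s v0) u (lin N (A i) Y u v0).

Let P i u v := Y i u0 v + RInt (fun s => lin N (A i) Y s v) u0 u.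
Let W i u v := Y i u v - P i u v.

Lemma AY_cont i u v : (i <= N)%nat -> Q (u, v) ->
  continuity_2d_pt (lin N (A i) Y) u v.
Proof.
  intros Hi Hq. apply lin_continuity_2d_pt; auto.
  intros j Hj. apply (Cn_continuity Q 1); auto.
Qed.

Lemma P_du i u v : (i <= N)%nat -> Q (u, v) ->
  is_derive (fun s => P i s v) u (lin N (A i) Y u v).
Proof.
  intros Hi Hq. unfold P.
  replace (lin N (A i) Y u v) with (0 + lin N (A i) Y u v) by ring.
  apply (is_derive_plus (fun _ => Y i u0 v)
           (fun x => RInt (fun s => lin N (A i) Y s v) u0 x)).
  - exact (is_derive_const (K := R_AbsRing) (V := R_NormedModule) (Y i u0 v) u).
  - apply (is_derive_RInt_continuous (fun s => lin N (A i) Y s v) u0 u d).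
    + apply Hq.
    + intros x Hx. apply (continuity_2d_pt_continuous_u (lin N (A i) Y)).
      apply AY_cont; auto. split; auto. apply Hq.
Qed.

Lemma P_u0 i v : P i u0 v = Y i u0 v.
Proof. unfold P. rewrite RInt_point. unfold zero; simpl. ring. Qed.

(** This is the only place where the integrability condition enters: it trades
    [A_v + A B] for [B_u + B A]. *)
Lemma AY_dv i u v : (i <= N)%nat -> Q (u, v) ->
  is_derive (fun t => lin N (A i) Y u t) v
    (lin N (fun j => Du (B i j)) Y u v + lin N (B i) (fun j => lin N (A j) Y) u v).
Proof.
  intros Hi Hq.
  replace (_ + _) with (lin N (fun j => Dv (A i j)) Y u v
                        + lin N (A i) (fun j => lin N (B j) Y) u v).
  - apply lin_is_derive_v; auto. intros j Hj. apply Derive_correct.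
    apply (Cn_ex_derive_v Q 0); auto.
  - rewrite !lin_assoc, !lin_plus_l. apply lin_ext; auto.
Qed.

(** Differentiation under the integral sign gives
    [P_v = B Y (u0, v) + int (B_u Y + B A Y)]. Since [P_u = A Y], the integrand is
    [(B P)_u + B_u (Y - P)], and the first part integrates to the difference of
    the boundary values of [B P]. *)
Lemma P_dv i u v : (i <= N)%nat -> Q (u, v) ->
  is_derive (fun t => P i u t) v
    (lin N (B i) P u v + RInt (fun s => lin N (fun j => Du (B i j)) W s v) u0 u).
Proof.
  intros Hi Hq.
  set (g := fun s v => lin N (fun j => Du (B i j)) Y s v
                       + lin N (B i) (fun j => lin N (A j) Y) s v).
  assert (cDB : forall s j, (j <= N)%nat -> Rmin u0 u <= s <= Rmax u0 u ->
            continuity_2d_pt (Du (B i j)) s v).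
  { intros s j Hj Hs. apply (Cn_continuity Q 0); [apply Cn_Du; auto|].
    now apply (square_segment_u u0 v0 d u). }
  assert (cg : forall x y, Q (x, y) -> continuity_2d_pt g x y).
  { intros x y Hxy. apply continuity_2d_pt_plus; apply lin_continuity_2d_pt; auto.
    - intros j Hj. apply (Cn_continuity Q 0); auto. apply Cn_Du; auto.
    - intros j Hj. apply (Cn_continuity Q 1); auto.
    - intros j Hj. apply AY_cont; auto. }
  assert (cP : forall s j, (j <= N)%nat -> Rmin u0 u <= s <= Rmax u0 u ->
            continuous (fun s => P j s v) s).
  { intros s j Hj Hs. apply (ex_derive_continuous (fun s => P j s v)).
    eexists. apply P_du; auto. now apply (square_segment_u u0 v0 d u). }
  assert (clin : forall a Z s, (forall j, (j <= N)%nat ->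
      continuous (fun s => a j s v) s) ->
    (forall j, (j <= N)%nat -> continuous (fun s => Z j s v) s) ->
    continuous (fun s => lin N a Z s v) s).
  { intros a Z s Ha HZ.
    apply (continuity_2d_pt_continuous_u (fun s _ => lin N a Z s v) s 0).
    apply (lin_continuity_2d_pt N (fun j s _ => a j s v) (fun j s _ => Z j s v));
    intros j Hj.
    - apply (continuity_1d_2d_pt_comp (fun s => a j s v) (fun s _ => s));
      [|apply continuity_2d_pt_id1]. apply continuity_pt_filterlim; now apply Ha.
    - apply (continuity_1d_2d_pt_comp (fun s => Z j s v) (fun s _ => s));
      [|apply continuity_2d_pt_id1]. apply continuity_pt_filterlim; now apply HZ. }
  assert (FTC : is_RInt (fun s => lin N (fun j => Du (B i j)) P s v
                          + lin N (B i) (fun j => lin N (A j) Y) s v) u0 u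
                  (lin N (B i) P u v - lin N (B i) P u0 v)).
  { apply (is_RInt_derive (fun s => lin N (B i) P s v)).
    - intros s Hs. apply lin_is_derive_u; intros j Hj.
      + apply Derive_correct. apply (Cn_ex_derive_u Q 0); auto.
        now apply (square_segment_u u0 v0 d u).
      + apply P_du; auto. now apply (square_segment_u u0 v0 d u).
    - intros s Hs.
      apply (continuous_plus (fun s => lin N (fun j => Du (B i j)) P s v)
               (fun s => lin N (B i) (fun j => lin N (A j) Y) s v)).
      + apply clin; auto. intros j Hj.
        apply (continuity_2d_pt_continuous_u (Du (B i j))). auto.
      + apply (continuity_2d_pt_continuous_u
                 (lin N (B i) (fun j => lin N (A j) Y))).
        assert (Hsv : Q (s, v)) by now apply (square_segment_u u0 v0 d u).
        apply lin_continuity_2d_pt.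
        * intros j Hj. apply (Cn_continuity Q 1); auto.
        * intros j Hj. apply AY_cont; auto. }
  assert (E : lin N (B i) Y u0 v + RInt (fun s => g s v) u0 u
      = lin N (B i) P u v + RInt (fun s => lin N (fun j => Du (B i j)) W s v) u0 u).
  { assert (E1 := is_RInt_unique _ _ _ _ FTC).
    assert (EW : forall s, lin N (fun j => Du (B i j)) W s v
       = g s v - (lin N (fun j => Du (B i j)) P s v
                  + lin N (B i) (fun j => lin N (A j) Y) s v)).
    { intros s. unfold W. rewrite <- lin_minus. unfold g. ring. }
    rewrite (RInt_ext _ _ _ _ (fun s _ => EW s)).
    rewrite (RInt_minus (fun s => g s v)).
    - rewrite E1. unfold minus, plus, opp; simpl.
      rewrite (lin_ext N (B i) (B i) P Y u0 v); auto; [ring|].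
      intros; apply P_u0.
    - apply (ex_RInt_continuous (fun s => g s v)). intros s Hs.
      apply (continuity_2d_pt_continuous_u g). apply cg. now apply (square_segment_u u0 v0 d u).
    - eexists; exact FTC. }
  rewrite <- E. unfold P.
  apply (is_derive_plus (fun t => Y i u0 t)
           (fun t => RInt (fun s => lin N (A i) Y s t) u0 u)).
  { apply Y_dv; auto. now apply (square_axis_u u0 v0 d u). }
  assert (Dg : forall s t, Q (s, t) ->
            Derive (fun z => lin N (A i) Y s z) t = g s t).
  { intros s t Hst. apply is_derive_unique. now apply AY_dv. }
  rewrite <- (RInt_ext (fun s => Derive (fun z => lin N (A i) Y s z) v)).
  2:{ intros s Hs. apply Dg. apply (square_segment_u u0 v0 d u); auto. lra. }
  apply (is_derive_RInt_param (fun t s => lin N (A i) Y s t) u0 u v).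
  - apply filter_imp with (2 := open_locally_v Q u v (open_square _ _ _) Hq).
    intros t Ht s Hs. eexists. apply AY_dv; auto. now apply (square_segment_u u0 v0 d u).
  - intros s Hs. apply (continuity_2d_pt_swap
      (fun s t => Derive (fun z => lin N (A i) Y s z) t)).
    assert (Hsv : Q (s, v)) by now apply (square_segment_u u0 v0 d u).
    apply continuity_2d_pt_ext_loc with g; auto.
    destruct (open_locally_2d Q s v (open_square _ _ _) Hsv) as [e He].
    exists e. intros x y Hx Hy. symmetry. apply Dg. now apply He.
  - apply filter_imp with (2 := open_locally_v Q u v (open_square _ _ _) Hq).
    intros t Ht. apply (ex_RInt_continuous (fun s => lin N (A i) Y s t)).
    intros s Hs. apply (continuity_2d_pt_continuous_u (lin N (A i) Y)).
    apply AY_cont; auto. now apply (square_segment_u u0 v0 d u).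
Qed.

Lemma W_dv i u v : (i <= N)%nat -> Q (u, v) ->
  is_derive (fun t => W i u t) v
    (lin N (B i) W u v - RInt (fun s => lin N (fun j => Du (B i j)) W s v) u0 u).
Proof.
  intros Hi Hq. unfold W at 1 2.
  rewrite <- lin_minus.
  replace (_ - _ - _) with (lin N (B i) Y u v - (lin N (B i) P u v
     + RInt (fun s => lin N (fun j => Du (B i j)) W s v) u0 u)) by ring.
  apply (is_derive_minus (fun t => Y i u t) (fun t => P i u t)); auto.
  apply P_dv; auto.
Qed.

Lemma W_v0 i u : (i <= N)%nat -> Q (u, v0) -> W i u v0 = 0.
Proof.
  intros Hi Hq. unfold W, P.
  rewrite (is_RInt_unique (fun s => lin N (A i) Y s v0) u0 u
             (Y i u v0 - Y i u0 v0)); [ring|].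
  apply (is_RInt_derive (fun s => Y i s v0)).
  - intros s Hs. apply Y_du0; auto. now apply (square_segment_u u0 v0 d u).
  - intros s Hs. apply (continuity_2d_pt_continuous_u (lin N (A i) Y)).
    apply AY_cont; auto. now apply (square_segment_u u0 v0 d u).
Qed.

Lemma W_cont_u i u v : (i <= N)%nat -> Q (u, v) -> continuous (fun s => W i s v) u.
Proof.
  intros Hi Hq. apply (continuous_minus (fun s => Y i s v) (fun s => P i s v)).
  - apply (continuity_2d_pt_continuous_u (Y i)); auto.
  - apply (ex_derive_continuous (fun s => P i s v)). eexists. now apply P_du.
Qed.

Lemma C_nonneg u v : Q (u, v) -> 0 <= C.
Proof.
  intros Hq. eapply Rle_trans; [apply Rabs_pos | apply (B_le 0 0 u v)];
  auto; lia.
Qed.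

(** [W] vanishes on [v = v0], and [W_dv] bounds its vertical derivative by a
    multiple of a bound of [W]. *)
Lemma W_halving M :
  (forall i u v, (i <= N)%nat -> Q (u, v) -> Rabs (W i u v) <= M) ->
  forall i u v, (i <= N)%nat -> Q (u, v) -> Rabs (W i u v) <= M * (1 / 2).
Proof.
  intros HM i u v Hi Hq.
  assert (HN : 0 <= INR (S N)) by apply pos_INR.
  assert (HC := C_nonneg u v Hq).
  assert (M0 : 0 <= M) by (eapply Rle_trans; [apply Rabs_pos | eauto]).
  assert (HNCM : 0 <= INR (S N) * C * M) by (repeat apply Rmult_le_pos; auto).
  replace (W i u v) with (W i u v - W i u v0)
    by (rewrite W_v0; [ring | auto | now apply (square_axis_v u0 v0 d u v)]).
  eapply Rle_trans.
  { apply (MVT_bound (fun t => W i u t)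
      (fun t => lin N (B i) W u t
                - RInt (fun s => lin N (fun j => Du (B i j)) W s t) u0 u)
      v0 v (2 * (INR (S N) * C * M))).
    - intros t Ht. apply W_dv; auto. now apply (square_segment_v u0 v0 d u v).
    - intros t Ht. assert (Hut : Q (u, t)) by now apply (square_segment_v u0 v0 d u v).
      unfold Rminus. eapply Rle_trans; [apply Rabs_triang|]. rewrite Rabs_Ropp.
      assert (H1 : Rabs (lin N (B i) W u t) <= INR (S N) * C * M)
        by (apply lin_bound; auto).
      assert (H2 : Rabs (RInt (fun s => lin N (fun j => Du (B i j)) W s t) u0 u)
                 <= Rabs (u - u0) * (INR (S N) * C * M)).
      { apply RInt_abs_le_const.
        - intros s Hs. assert (Hst : Q (s, t)) by now apply (square_segment_u u0 v0 d u).
          apply (continuity_2d_pt_continuous_u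
            (fun s _ => lin N (fun j => Du (B i j)) W s t) s 0).
          apply (lin_continuity_2d_pt N (fun j s _ => Du (B i j) s t)
            (fun j s _ => W j s t)); intros j Hj.
          + apply (continuity_1d_2d_pt_comp (fun s => Du (B i j) s t)
                     (fun s _ => s)); [|apply continuity_2d_pt_id1].
            apply continuity_pt_filterlim.
            apply (continuity_2d_pt_continuous_u (Du (B i j))).
            apply (Cn_continuity Q 0); auto. apply Cn_Du; auto.
          + apply (continuity_1d_2d_pt_comp (fun s => W j s t)
                     (fun s _ => s)); [|apply continuity_2d_pt_id1].
            apply continuity_pt_filterlim. apply W_cont_u; auto.
        - intros s Hs. assert (Hst : Q (s, t)) by now apply (square_segment_u u0 v0 d u).
          apply lin_bound; auto. }
      assert (H3 : Rabs (u - u0) * (INR (S N) * C * M) <= 1 * (INR (S N) * C * M)).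
      { apply Rmult_le_compat_r; auto. destruct Hq as [Hu _]. simpl in Hu. lra. }
      lra. }
  destruct Hq as [_ Hv]; simpl in Hv.
  apply Rle_trans with (d * (2 * (INR (S N) * C * M))).
  - apply Rmult_le_compat_r; lra.
  - assert (4 * d * (INR (S N) * C) * M <= 1 * M)
      by (apply Rmult_le_compat_r; auto). lra.
Qed.

Lemma W_eq_0 i u v : (i <= N)%nat -> Q (u, v) -> W i u v = 0.
Proof.
  intros Hi Hq. assert (HC := C_nonneg u v Hq).
  assert (HK : 0 <= K) by (eapply Rle_trans; [apply Rabs_pos | eauto]).
  assert (HN : 0 <= INR (S N)) by apply pos_INR.
  assert (HNCK : 0 <= INR (S N) * C * K) by (repeat apply Rmult_le_pos; auto).
  (* The bound of [W] by [M] comes from those of [Y] and of [A Y]; it is then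
     halved indefinitely. *)
  apply le_half_pow_eq_0 with (M := 2 * K + INR (S N) * C * K).
  intros n. revert i u v Hi Hq. induction n; intros i u v Hi Hq.
  - rewrite Rmult_1_r. unfold W, P.
    assert (H1 : Rabs (RInt (fun s => lin N (A i) Y s v) u0 u)
               <= Rabs (u - u0) * (INR (S N) * C * K)).
    { apply RInt_abs_le_const; intros s Hs;
      assert (Hsv : Q (s, v)) by now apply (square_segment_u u0 v0 d u).
      - apply (continuity_2d_pt_continuous_u (lin N (A i) Y)). now apply AY_cont.
      - apply lin_bound; auto. }
    assert (H2 : Rabs (u - u0) * (INR (S N) * C * K) <= 1 * (INR (S N) * C * K)).
    { apply Rmult_le_compat_r; auto. destruct Hq as [Hu _]. simpl in Hu. lra. }
    assert (H3 := Y_le i u v Hi Hq).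
    assert (H4 := Y_le i u0 v Hi (square_axis_u u0 v0 d u v Hq)).
    unfold Rabs in *. repeat destruct Rcase_abs; lra.
  - simpl pow. rewrite (Rmult_comm (1 / 2)), <- Rmult_assoc.
    apply W_halving; auto.
Qed.

Lemma compatible_du i u v : (i <= N)%nat -> Q (u, v) ->
  is_derive (fun s => Y i s v) u (lin N (A i) Y u v).
Proof.
  intros Hi Hq. apply is_derive_ext_loc with (fun s => P i s v).
  - apply filter_imp with (2 := open_locally_u Q u v (open_square _ _ _) Hq).
    intros s Hs. assert (H := W_eq_0 i s v Hi Hs). unfold W in H. lra.
  - now apply P_du.
Qed.

End Compatibility.

Lemma uniform_constant (N : nat) (P : nat -> R -> R -> R -> Prop) u0 v0 :
  (forall i C C' u v, C <= C' -> P i C u v -> P i C' u v) ->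
  (forall i, (i <= N)%nat -> exists C, locally_2d (P i C) u0 v0) ->
  exists C, locally_2d (fun u v => forall i, (i <= N)%nat -> P i C u v) u0 v0.
Proof.
  intros mono. induction N; intros H.
  - destruct (H 0%nat) as [C [e He]]; auto. exists C, e.
    intros u v Hu Hv i Hi. replace i with 0%nat by lia. auto.
  - destruct IHN as [C1 H1]; auto. destruct (H (S N)) as [C2 H2]; auto.
    exists (Rmax C1 C2). destruct (locally_2d_and _ _ _ _ H1 H2) as [e He].
    exists e. intros u v Hu Hv i Hi. destruct (He u v Hu Hv) as [P1 P2].
    destruct (Nat.eq_dec i (S N)) as [-> | Hn].
    + apply (mono _ C2); auto. apply Rmax_r.
    + apply (mono _ C1); [apply Rmax_l | apply P1; lia].
Qed.

Lemma continuity_2d_pt_bounded f u0 v0 :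
  continuity_2d_pt f u0 v0 -> locally_2d
    (fun u v => Rabs (f u v) <= Rabs (f u0 v0) + 1) u0 v0.
Proof.
  intros Hf. destruct (Hf (mkposreal 1 Rlt_0_1)) as [e He]. exists e.
  intros u v Hu Hv. specialize (He u v Hu Hv). simpl in He.
  unfold Rabs in *. repeat destruct Rcase_abs; lra.
Qed.

Lemma bounded_matrix N (f : nat -> nat -> R -> R -> R) u0 v0 :
  (forall i j, (i <= N)%nat -> (j <= N)%nat -> continuity_2d_pt (f i j) u0 v0) ->
  exists C, locally_2d (fun u v => forall i, (i <= N)%nat ->
     forall j, (j <= N)%nat -> Rabs (f i j u v) <= C) u0 v0.
Proof.
  intros Hf.
  apply (uniform_constant N (fun i C u v => forall j, (j <= N)%nat ->
           Rabs (f i j u v) <= C)).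
  - intros i C C' u v HC H j Hj. apply Rle_trans with C; auto.
  - intros i Hi. apply (uniform_constant N (fun j C u v => Rabs (f i j u v) <= C)).
    + intros; eapply Rle_trans; eauto.
    + intros j Hj. eexists. apply continuity_2d_pt_bounded. auto.
Qed.

(** Bootstrapping: a solution of class [C^n] has derivatives of class [C^n]. *)
Lemma linear_system_smooth (D : R * R -> Prop) N A B Y :
  open D ->
  (forall i j, (i <= N)%nat -> (j <= N)%nat -> smooth_on D (A i j)) ->
  (forall i j, (i <= N)%nat -> (j <= N)%nat -> smooth_on D (B i j)) ->
  (forall i u v, (i <= N)%nat -> D (u, v) -> continuity_2d_pt (Y i) u v) ->
  (forall i u v, (i <= N)%nat -> D (u, v) ->
     is_derive (fun s => Y i s v) u (lin N (A i) Y u v)) ->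
  (forall i u v, (i <= N)%nat -> D (u, v) ->
     is_derive (fun t => Y i u t) v (lin N (B i) Y u v)) ->
  forall i, (i <= N)%nat -> smooth_on D (Y i).
Proof.
  intros oD SA SB cY du dv.
  assert (H : forall n i, (i <= N)%nat -> Cn D n (Y i)).
  { induction n; intros i Hi.
    - intros u v Duv. split; auto.
    - apply Cn_S with (lin N (A i) Y) (lin N (B i) Y); auto.
      + apply lin_Cn; auto. intros j Hj. apply smooth_Cn; auto.
      + apply lin_Cn; auto. intros j Hj. apply smooth_Cn; auto. }
  intros i Hi. apply smooth_Cn. auto.
Qed.

(** The size [d] of the square depends on the coefficients only, so that the
    solutions for different initial values live on the same square. *)
Theorem linear_frobenius (D : R * R -> Prop) N (A B : nat -> nat -> R -> R -> R)
    u0 v0 :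
  open D -> D (u0, v0) ->
  (forall i j, (i <= N)%nat -> (j <= N)%nat -> smooth_on D (A i j)) ->
  (forall i j, (i <= N)%nat -> (j <= N)%nat -> smooth_on D (B i j)) ->
  (forall i k u v, (i <= N)%nat -> (k <= N)%nat -> D (u, v) ->
     Dv (A i k) u v + sum_f_R0 (fun j => A i j u v * B j k u v) N
     = Du (B i k) u v + sum_f_R0 (fun j => B i j u v * A j k u v) N) ->
  exists d, 0 < d /\ (forall p, square u0 v0 d p -> D p) /\
    forall y0 : nat -> R, exists Y : nat -> R -> R -> R,
      (forall i, (i <= N)%nat -> Y i u0 v0 = y0 i) /\
      (forall i, (i <= N)%nat -> smooth_on (square u0 v0 d) (Y i)) /\
      (forall i u v, (i <= N)%nat -> square u0 v0 d (u, v) ->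
         is_derive (fun s => Y i s v) u (lin N (A i) Y u v)) /\
      (forall i u v, (i <= N)%nat -> square u0 v0 d (u, v) ->
         is_derive (fun t => Y i u t) v (lin N (B i) Y u v)).
Proof.
  intros oD D0 SA SB int.
  destruct (bounded_matrix N A u0 v0) as [C1 L1].
  { intros. apply (smooth_continuity D); auto. }
  destruct (bounded_matrix N B u0 v0) as [C2 L2].
  { intros. apply (smooth_continuity D); auto. }
  destruct (bounded_matrix N (fun i j => Du (B i j)) u0 v0) as [C3 L3].
  { intros. apply (smooth_continuity D); auto using smooth_Du. }
  set (C := Rabs C1 + Rabs C2 + Rabs C3 + 1).
  assert (A1 := Rle_abs C1). assert (A2 := Rle_abs C2). assert (A3 := Rle_abs C3).
  assert (B1 := Rabs_pos C1). assert (B2 := Rabs_pos C2). assert (B3 := Rabs_pos C3).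
  assert (HC : 0 < C) by (unfold C; lra).
  destruct (locally_2d_and _ _ _ _ (open_locally_2d D u0 v0 oD D0)
             (locally_2d_and _ _ _ _ L1 (locally_2d_and _ _ _ _ L2 L3)))
    as [r Hr].
  assert (HN : 0 < INR (S N)) by (apply lt_0_INR; lia).
  assert (HNC : 0 < INR (S N) * C) by (apply Rmult_lt_0_compat; auto).
  (* The bound required by [linear_picard] and by the compatibility argument. *)
  set (e := / (4 * (INR (S N) * C))).
  assert (He : 0 < e) by (apply Rinv_0_lt_compat; lra).
  set (d := Rmin 1 (Rmin (r / 2) e)).
  assert (r0 := cond_pos r).
  assert (Hd : 0 < d) by (repeat apply Rmin_pos; lra).
  assert (Hd1 : d <= 1) by apply Rmin_l.
  assert (Hdr : d < r).
  { apply Rle_lt_trans with (r / 2); [|lra].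
    eapply Rle_trans; [apply Rmin_r | apply Rmin_l]. }
  assert (HdC : 4 * d * (INR (S N) * C) <= 1).
  { replace 1 with (4 * e * (INR (S N) * C)) by (unfold e; field; split; lra).
    apply Rmult_le_compat_r; [lra|]. apply Rmult_le_compat_l; [lra|].
    eapply Rle_trans; [apply Rmin_r | apply Rmin_r]. }
  set (Q := square u0 v0 d).
  assert (QD : forall u v, Rabs (u - u0) <= d -> Rabs (v - v0) <= d -> D (u, v)).
  { intros u v Hu Hv. apply (Hr u v); lra. }
  assert (QD' : forall p, Q p -> D p).
  { intros [u v] [Hu Hv]. simpl in *. apply QD; lra. }
  exists d. split; auto. split; auto. intros y0.
  set (cl := fun (f : R -> R -> R) u v => f (clamp u0 d u) (clamp v0 d v)).
  assert (ccl : forall f, smooth_on D f -> cont2 (cl f)).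
  { intros f Sf u v. unfold cl.
    apply (continuity_2d_pt_lipschitz_comp f (clamp u0 d) (clamp v0 d));
      auto using clamp_lipschitz.
    apply (smooth_continuity D); auto. apply QD; apply clamp_dist; lra. }
  assert (clQ : forall f u v, Rabs (u - u0) <= d -> Rabs (v - v0) <= d ->
            cl f u v = f u v).
  { intros f u v Hu Hv. unfold cl. now rewrite !clamp_id. }
  assert (bcl : forall u v, Rabs (clamp u0 d u - u0) < r
                         /\ Rabs (clamp v0 d v - v0) < r).
  { intros u v. split; (eapply Rle_lt_trans; [apply clamp_dist; lra | auto]). }
  destruct (linear_picard N (fun i j => cl (A i j)) (fun i j => cl (B i j))
              C d u0 v0 y0) as (Y & K & cY & bY & EY); auto.
  { intros i j u v Hi Hj. destruct (bcl u v) as [b1 b2].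
    apply Rle_trans with C1; [|unfold C; lra].
    apply (Hr (clamp u0 d u) (clamp v0 d v)); auto. }
  { intros i j u v Hi Hj. destruct (bcl u v) as [b1 b2].
    apply Rle_trans with C2; [|unfold C; lra].
    apply (Hr (clamp u0 d u) (clamp v0 d v)); auto. }
  assert (cu0 : clamp u0 d u0 = u0)
    by (apply clamp_id; rewrite Rminus_diag, Rabs_R0; lra).
  assert (cv0 : clamp v0 d v0 = v0)
    by (apply clamp_id; rewrite Rminus_diag, Rabs_R0; lra).
  assert (clin : forall a u v, (forall j, (j <= N)%nat -> smooth_on D (a j)) ->
            continuity_2d_pt (lin N (fun j => cl (a j)) Y) u v).
  { intros a u v Sa. apply lin_continuity_2d_pt; intros j Hj.
    - now apply ccl, Sa. - now apply cY. }
  assert (Ydv : forall i u v, (i <= N)%nat -> Q (u, v) ->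
            is_derive (fun t => Y i u t) v (lin N (B i) Y u v)).
  { intros i u v Hi Hq. assert (Hq' := Hq). destruct Hq' as [Hu Hv]; simpl in Hu, Hv.
    replace (lin N (B i) Y u v) with (lin N (fun j => cl (B i j)) Y u v)
      by (apply lin_ext; auto; intros; apply clQ; lra).
    apply is_derive_ext_loc with (fun t =>
      (y0 i + RInt (fun s => lin N (fun j => cl (A i j)) Y s v0) u0 (clamp u0 d u))
      + RInt (fun t => lin N (fun j => cl (B i j)) Y u t) v0 t).
    - apply filter_imp with (2 := open_locally_v Q u v (open_square _ _ _) Hq).
      intros t [_ Ht]. simpl in Ht. rewrite EY, (clamp_id v0 d t) by (auto; lra).
      reflexivity.
    - rewrite <- (Rplus_0_l (lin N _ Y u v)).
      apply (is_derive_plus (fun _ => _) (fun t => RInt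
               (fun t => lin N (fun j => cl (B i j)) Y u t) v0 t)).
      + exact (is_derive_const (K := R_AbsRing) (V := R_NormedModule) _ v).
      + apply (is_derive_RInt_continuous
                 (fun t => lin N (fun j => cl (B i j)) Y u t) v0 v d); auto.
        intros t _. apply (continuity_2d_pt_continuous_v
                             (lin N (fun j => cl (B i j)) Y)). auto. }
  assert (Ydu0 : forall i u, (i <= N)%nat -> Q (u, v0) ->
            is_derive (fun s => Y i s v0) u (lin N (A i) Y u v0)).
  { intros i u Hi Hq. assert (Hq' := Hq). destruct Hq' as [Hu Hv]; simpl in Hu, Hv.
    replace (lin N (A i) Y u v0) with (lin N (fun j => cl (A i j)) Y u v0)
      by (apply lin_ext; auto; intros; apply clQ; lra).
    apply is_derive_ext_loc with (fun s =>
      y0 i + RInt (fun s => lin N (fun j => cl (A i j)) Y s v0) u0 s).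
    - apply filter_imp with (2 := open_locally_u Q u v0 (open_square _ _ _) Hq).
      intros s [Hs _]. simpl in Hs. rewrite EY, cv0, RInt_point by auto.
      rewrite (clamp_id u0 d s) by lra. unfold zero; simpl. ring.
    - rewrite <- (Rplus_0_l (lin N _ Y u v0)).
      apply (is_derive_plus (fun _ => _) (fun s => RInt
               (fun s => lin N (fun j => cl (A i j)) Y s v0) u0 s)).
      + exact (is_derive_const (K := R_AbsRing) (V := R_NormedModule) _ u).
      + apply (is_derive_RInt_continuous
                 (fun s => lin N (fun j => cl (A i j)) Y s v0) u0 u d); auto.
        intros s _. apply (continuity_2d_pt_continuous_u
                             (lin N (fun j => cl (A i j)) Y)). auto. }
  assert (SQ : forall f, smooth_on D f -> smooth_on Q f).
  { intros f. now apply smooth_subset. }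
  assert (Ydu : forall i u v, (i <= N)%nat -> Q (u, v) ->
            is_derive (fun s => Y i s v) u (lin N (A i) Y u v)).
  { assert (QL : forall u v, Q (u, v) -> Rabs (u - u0) < r /\ Rabs (v - v0) < r).
    { intros u v [Hu Hv]; simpl in *; lra. }
    apply (compatible_du N A B Y C K d u0 v0); auto.
    - intros i j Hi Hj. apply (proj1 (smooth_Cn Q _)); auto.
    - intros i j Hi Hj. apply (proj1 (smooth_Cn Q _)); auto.
    - intros i j u v Hi Hj Hq. destruct (QL u v Hq). apply Rle_trans with C1;
      [|unfold C; lra]. apply (Hr u v); auto.
    - intros i j u v Hi Hj Hq. destruct (QL u v Hq). apply Rle_trans with C2;
      [|unfold C; lra]. apply (Hr u v); auto.
    - intros i j u v Hi Hj Hq. destruct (QL u v Hq). apply Rle_trans with C3;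
      [|unfold C; lra]. apply (Hr u v); auto.
    - intros i u v Hi _. now apply cY. }
  exists Y. split; [|split; [|now split]].
  - intros i Hi. rewrite EY, cu0, cv0, !RInt_point by auto.
    unfold zero; simpl. ring.
  - apply (linear_system_smooth Q N A B); auto.
    + apply open_square.
    + intros i u v Hi _. now apply cY.
Qed.

(** * Squares are plane domains *)

(** A separation of [D] would give a continuous function along a path with values
    in [{1, -1}] that takes both values. *)
Lemma path_connected2 (D : R * R -> Prop) :
  (forall p q, D p -> D q -> exists phi : R -> R * R,
     (forall t, continuous phi t) /\ (forall t, D (phi t)) /\
     phi 0 = p /\ phi 1 = q) ->
  connected2 D.
Proof.
  intros HD U V oU oV cov [p [Dp Up]] [q [Dq Vq]].
  destruct (classic (exists r, D r /\ U r /\ V r)) as [|no]; auto. exfalso.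
  destruct (HD p q Dp Dq) as (phi & cphi & Dphi & phi0 & phi1).
  set (f := fun t => if excluded_middle_informative (U (phi t)) then 1 else -1).
  assert (fU : forall t, U (phi t) -> f t = 1).
  { intros t Ht. unfold f. destruct excluded_middle_informative; tauto. }
  assert (fV : forall t, V (phi t) -> f t = -1).
  { intros t Ht. unfold f. destruct excluded_middle_informative; auto.
    exfalso. apply no. eauto. }
  assert (cf : continuity f).
  { intros t. apply continuity_pt_filterlim.
    destruct (cov (phi t) (Dphi t)) as [H | H].
    - apply (continuous_ext_loc f (fun _ => 1)); [|apply continuous_const].
      assert (L : locally t (fun s => U (phi s))) by exact (cphi t U (oU _ H)).
      apply filter_imp with (2 := L). intros s Hs. symmetry. now apply fU.
    - apply (continuous_ext_loc f (fun _ => -1)); [|apply continuous_const].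
      assert (L : locally t (fun s => V (phi s))) by exact (cphi t V (oV _ H)).
      apply filter_imp with (2 := L). intros s Hs. symmetry. now apply fV. }
  assert (f0 : f 0 = 1) by (apply fU; now rewrite phi0).
  assert (f1 : f 1 = -1) by (apply fV; now rewrite phi1).
  destruct (IVT_gen f 0 1 0 cf) as (t & _ & Ht).
  - rewrite f0, f1. split; [rewrite Rmin_right | rewrite Rmax_left]; lra.
  - unfold f in Ht. destruct excluded_middle_informative; lra.
Qed.

Lemma square_plane_domain u0 v0 d : 0 < d -> plane_domain (square u0 v0 d).
Proof.
  intros Hd. split; [apply open_square|]. split.
  { exists (u0, v0). split; simpl; rewrite Rminus_diag, Rabs_R0; auto. }
  apply path_connected2. intros [a b] [a' b'] [Ha Hb] [Ha' Hb']; simpl in *.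
  (* The segment is made constant outside the parameter interval [0,1]. *)
  set (c := clamp (1 / 2) (1 / 2)).
  assert (cc : forall t, continuous c t).
  { intros t. apply filterlim_locally. intros eps. exists eps. intros s Hs.
    eapply Rle_lt_trans; [apply clamp_lipschitz | exact Hs]. }
  assert (ci : forall t, 0 <= c t <= 1).
  { intros t. assert (H := clamp_in (1 / 2) (1 / 2) t ltac:(lra)).
    unfold c. lra. }
  assert (conv : forall x y z t, Rabs (x - z) < d -> Rabs (y - z) < d ->
            Rabs (x + c t * (y - x) - z) < d).
  { intros x y z t Hx Hy. specialize (ci t).
    replace (x + c t * (y - x) - z)
      with ((1 - c t) * (x - z) + c t * (y - z)) by ring.
    eapply Rle_lt_trans; [apply Rabs_triang|]. rewrite !Rabs_mult.
    rewrite (Rabs_pos_eq (c t)), (Rabs_pos_eq (1 - c t)) by lra.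
    destruct (Rle_dec (c t) (1 / 2)); nra. }
  assert (cl : forall x y t, continuous (fun t => x + c t * (y - x)) t).
  { intros x y t.
    apply (continuous_plus (fun _ => x) (fun t => c t * (y - x)));
      [apply continuous_const|].
    apply (continuous_mult c (fun _ => y - x)); auto. apply continuous_const. }
  exists (fun t => (a + c t * (a' - a), b + c t * (b' - b))).
  split; [|split; [|split]].
  - intros t. apply filterlim_locally. intros eps.
    assert (H1 := proj1 (filterlim_locally _ _) (cl a a' t) eps).
    assert (H2 := proj1 (filterlim_locally _ _) (cl b b' t) eps).
    apply filter_imp with (2 := filter_and _ _ H1 H2).
    intros s [Hs1 Hs2]. split; auto.
  - intros t. split; simpl; auto.
  - assert (c 0 = 0) as -> by (apply clamp_id; rewrite Rabs_left; lra).
    f_equal; ring.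
  - assert (c 1 = 1) as -> by (apply clamp_id; rewrite Rabs_pos_eq; lra).
    f_equal; ring.
Qed.

Lemma constant_on_square (f : R -> R -> R) u0 v0 d u v :
  (forall u v, square u0 v0 d (u, v) -> is_derive (fun s => f s v) u 0) ->
  (forall u v, square u0 v0 d (u, v) -> is_derive (fun t => f u t) v 0) ->
  square u0 v0 d (u, v) -> f u v = f u0 v0.
Proof.
  intros Hu Hv Hq.
  assert (H1 : Rabs (f u v - f u0 v) <= Rabs (u - u0) * 0).
  { apply (MVT_bound (fun s => f s v) (fun _ => 0)).
    - intros s Hs. apply Hu. now apply (square_segment_u u0 v0 d u).
    - intros; rewrite Rabs_R0; lra. }
  assert (H2 : Rabs (f u0 v - f u0 v0) <= Rabs (v - v0) * 0).
  { apply (MVT_bound (fun t => f u0 t) (fun _ => 0)).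
    - intros t Ht. apply Hv. apply (square_segment_v u0 v0 d u0 v); auto.
      now apply (square_axis_u u0 v0 d u).
    - intros; rewrite Rabs_R0; lra. }
  rewrite Rmult_0_r in H1, H2.
  unfold Rabs in *; repeat destruct Rcase_abs; lra.
Qed.

(** * Calculus of functions with values in Minkowski space *)

Lemma vec4_ext a b :
  c1 a = c1 b -> c2 a = c2 b -> c3 a = c3 b -> c4 a = c4 b -> a = b.
Proof. destruct a, b; simpl; intros; subst; reflexivity. Qed.

Section Vector_calculus.

Variable D : R * R -> Prop.
Hypothesis oD : open D.

Lemma vsmooth_VDu z : vsmooth_on D z -> vsmooth_on D (VDu z).
Proof. intros (H1 & H2 & H3 & H4). repeat apply conj; apply (smooth_Du D (fun s t => _ (z s t))); auto. Qed.

Lemma vsmooth_VDv z : vsmooth_on D z -> vsmooth_on D (VDv z).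
Proof. intros (H1 & H2 & H3 & H4). repeat apply conj; apply (smooth_Dv D (fun s t => _ (z s t))); auto. Qed.

Lemma vsmooth_vadd a b : vsmooth_on D a -> vsmooth_on D b ->
  vsmooth_on D (fun u v => vadd (a u v) (b u v)).
Proof.
  intros (H1 & H2 & H3 & H4) (K1 & K2 & K3 & K4).
  repeat apply conj; apply (smooth_plus D (fun s t => _ (a s t)) (fun s t => _ (b s t))); auto.
Qed.

Lemma vsmooth_vscal k a : smooth_on D k -> vsmooth_on D a ->
  vsmooth_on D (fun u v => vscal (k u v) (a u v)).
Proof.
  intros Hk (H1 & H2 & H3 & H4). repeat apply conj; apply (smooth_mult D k (fun s t => _ (a s t))); auto.
Qed.

Lemma smooth_mink a b : vsmooth_on D a -> vsmooth_on D b ->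
  smooth_on D (fun u v => mink (a u v) (b u v)).
Proof.
  intros (H1 & H2 & H3 & H4) (K1 & K2 & K3 & K4).
  apply smooth_minus; auto; [|now apply smooth_mult].
  repeat apply smooth_plus; auto; now apply smooth_mult.
Qed.

Lemma vsmooth_ext a b : (forall u v, D (u, v) -> a u v = b u v) ->
  vsmooth_on D a -> vsmooth_on D b.
Proof.
  intros ab (H1 & H2 & H3 & H4).
  assert (E : forall (c : vec4 -> R), smooth_on D (fun s t => c (a s t)) ->
            smooth_on D (fun s t => c (b s t))).
  { intros c. apply smooth_ext; auto. intros s t Dst. now rewrite ab. }
  repeat apply conj; now apply E.
Qed.

Lemma VDu_ext_on a b u v : (forall s t, D (s, t) -> a s t = b s t) ->
  D (u, v) -> VDu a u v = VDu b u v.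
Proof.
  intros ab Duv. unfold VDu.
  f_equal; apply (Du_ext_on D); auto; intros; now rewrite ab.
Qed.

Lemma VDv_ext_on a b u v : (forall s t, D (s, t) -> a s t = b s t) ->
  D (u, v) -> VDv a u v = VDv b u v.
Proof.
  intros ab Duv. unfold VDv.
  f_equal; apply (Dv_ext_on D); auto; intros; now rewrite ab.
Qed.

Lemma VDv_VDu z u v : vsmooth_on D z -> D (u, v) ->
  VDv (VDu z) u v = VDu (VDv z) u v.
Proof.
  intros (H1 & H2 & H3 & H4) Duv.
  unfold VDv at 1, VDu at 5. f_equal; simpl;
  apply (smooth_Dv_Du D (fun s t => _ (z s t))); auto.
Qed.

Lemma Du_mult f g u v : smooth_on D f -> smooth_on D g -> D (u, v) ->
  Du (fun s t => f s t * g s t) u v = Du f u v * g u v + f u v * Du g u v.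
Proof.
  intros Hf Hg Duv. apply Derive_mult; eexists; eapply smooth_is_derive_u; eauto.
Qed.

Lemma Dv_mult f g u v : smooth_on D f -> smooth_on D g -> D (u, v) ->
  Dv (fun s t => f s t * g s t) u v = Dv f u v * g u v + f u v * Dv g u v.
Proof.
  intros Hf Hg Duv. apply Derive_mult; eexists; eapply smooth_is_derive_v; eauto.
Qed.

Lemma VDu_vscal k a u v : smooth_on D k -> vsmooth_on D a -> D (u, v) ->
  VDu (fun s t => vscal (k s t) (a s t)) u v
  = vadd (vscal (Du k u v) (a u v)) (vscal (k u v) (VDu a u v)).
Proof.
  intros Hk (H1 & H2 & H3 & H4) Duv.
  apply vec4_ext; simpl; apply (Du_mult k (fun s t => _ (a s t))); auto.
Qed.

Lemma VDv_vscal k a u v : smooth_on D k -> vsmooth_on D a -> D (u, v) ->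
  VDv (fun s t => vscal (k s t) (a s t)) u v
  = vadd (vscal (Dv k u v) (a u v)) (vscal (k u v) (VDv a u v)).
Proof.
  intros Hk (H1 & H2 & H3 & H4) Duv.
  apply vec4_ext; simpl; apply (Dv_mult k (fun s t => _ (a s t))); auto.
Qed.

Lemma Derive_mink_curves (f1 f2 f3 f4 g1 g2 g3 g4 : R -> R) x :
  ex_derive f1 x -> ex_derive f2 x -> ex_derive f3 x -> ex_derive f4 x ->
  ex_derive g1 x -> ex_derive g2 x -> ex_derive g3 x -> ex_derive g4 x ->
  Derive (fun s => f1 s * g1 s + f2 s * g2 s + f3 s * g3 s - f4 s * g4 s) x
  = (Derive f1 x * g1 x + Derive f2 x * g2 x + Derive f3 x * g3 x
     - Derive f4 x * g4 x)
    + (f1 x * Derive g1 x + f2 x * Derive g2 x + f3 x * Derive g3 x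
       - f4 x * Derive g4 x).
Proof.
  intros. apply is_derive_unique. auto_derive; [tauto|].
  change (fun y => f1 y) with f1. change (fun y => f2 y) with f2.
  change (fun y => f3 y) with f3. change (fun y => f4 y) with f4.
  change (fun y => g1 y) with g1. change (fun y => g2 y) with g2.
  change (fun y => g3 y) with g3. change (fun y => g4 y) with g4.
  ring.
Qed.

Lemma Du_mink a b u v : vsmooth_on D a -> vsmooth_on D b -> D (u, v) ->
  Du (fun s t => mink (a s t) (b s t)) u v
  = mink (VDu a u v) (b u v) + mink (a u v) (VDu b u v).
Proof.
  intros (H1 & H2 & H3 & H4) (K1 & K2 & K3 & K4) Duv.
  apply (Derive_mink_curves
    (fun s => c1 (a s v)) (fun s => c2 (a s v)) (fun s => c3 (a s v))
    (fun s => c4 (a s v)) (fun s => c1 (b s v)) (fun s => c2 (b s v))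
    (fun s => c3 (b s v)) (fun s => c4 (b s v)));
  eexists; apply (smooth_is_derive_u D (fun s t => _ (_ s t))); eauto.
Qed.

Lemma Dv_mink a b u v : vsmooth_on D a -> vsmooth_on D b -> D (u, v) ->
  Dv (fun s t => mink (a s t) (b s t)) u v
  = mink (VDv a u v) (b u v) + mink (a u v) (VDv b u v).
Proof.
  intros (H1 & H2 & H3 & H4) (K1 & K2 & K3 & K4) Duv.
  apply (Derive_mink_curves
    (fun t => c1 (a u t)) (fun t => c2 (a u t)) (fun t => c3 (a u t))
    (fun t => c4 (a u t)) (fun t => c1 (b u t)) (fun t => c2 (b u t))
    (fun t => c3 (b u t)) (fun t => c4 (b u t)));
  eexists; apply (smooth_is_derive_v D (fun s t => _ (_ s t))); eauto.
Qed.

End Vector_calculus.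

(** * Orthonormal frames of Minkowski space *)

Definition comb4 (p q r s : R) (x y b l : vec4) : vec4 :=
  vadd (vadd (vscal p x) (vscal q y)) (vadd (vscal r b) (vscal s l)).

Lemma mink_sym a b : mink a b = mink b a.
Proof. unfold mink; ring. Qed.

Lemma mink_vadd_l a b w : mink (vadd a b) w = mink a w + mink b w.
Proof. unfold mink; simpl; ring. Qed.

Lemma mink_vscal_l k a w : mink (vscal k a) w = k * mink a w.
Proof. unfold mink; simpl; ring. Qed.

Lemma mink_vscal_r k a w : mink w (vscal k a) = k * mink w a.
Proof. unfold mink; simpl; ring. Qed.

Lemma mink_mk4 p q r s p' q' r' s' :
  mink (mk4 p q r s) (mk4 p' q' r' s') = p * p' + q * q' + r * r' - s * s'.
Proof. reflexivity. Qed.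

Lemma mink_comb4_l p q r s x y b l w :
  mink (comb4 p q r s x y b l) w
  = p * mink x w + q * mink y w + r * mink b w + s * mink l w.
Proof. unfold mink, comb4; simpl; ring. Qed.

Lemma mink_separates a b : (forall w, mink a w = mink b w) -> a = b.
Proof.
  intros H. apply vec4_ext.
  - generalize (H (mk4 1 0 0 0)). unfold mink; simpl; lra.
  - generalize (H (mk4 0 1 0 0)). unfold mink; simpl; lra.
  - generalize (H (mk4 0 0 1 0)). unfold mink; simpl; lra.
  - generalize (H (mk4 0 0 0 1)). unfold mink; simpl; lra.
Qed.

(** Cramer's rule for the system with rows [x, y, b, l]. *)
Lemma mink_frame_nondegenerate x y b l r :
  det4 x y b l <> 0 ->
  mink r x = 0 -> mink r y = 0 -> mink r b = 0 -> mink r l = 0 ->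
  r = mk4 0 0 0 0.
Proof.
  intros Hd Hx Hy Hb Hl.
  assert (E : forall t, det4 x y b l * t = 0 -> t = 0).
  { intros t Ht. apply Rmult_integral in Ht. tauto. }
  apply vec4_ext; simpl; apply E.
  - transitivity
      (mink r x * det3 (c2 y) (c3 y) (c4 y) (c2 b) (c3 b) (c4 b) (c2 l) (c3 l) (c4 l)
     - mink r y * det3 (c2 x) (c3 x) (c4 x) (c2 b) (c3 b) (c4 b) (c2 l) (c3 l) (c4 l)
     + mink r b * det3 (c2 x) (c3 x) (c4 x) (c2 y) (c3 y) (c4 y) (c2 l) (c3 l) (c4 l)
     - mink r l * det3 (c2 x) (c3 x) (c4 x) (c2 y) (c3 y) (c4 y) (c2 b) (c3 b) (c4 b)).
    + unfold det4, det3, mink; ring.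
    + rewrite Hx, Hy, Hb, Hl; ring.
  - transitivity
      (- mink r x * det3 (c1 y) (c3 y) (c4 y) (c1 b) (c3 b) (c4 b) (c1 l) (c3 l) (c4 l)
     + mink r y * det3 (c1 x) (c3 x) (c4 x) (c1 b) (c3 b) (c4 b) (c1 l) (c3 l) (c4 l)
     - mink r b * det3 (c1 x) (c3 x) (c4 x) (c1 y) (c3 y) (c4 y) (c1 l) (c3 l) (c4 l)
     + mink r l * det3 (c1 x) (c3 x) (c4 x) (c1 y) (c3 y) (c4 y) (c1 b) (c3 b) (c4 b)).
    + unfold det4, det3, mink; ring.
    + rewrite Hx, Hy, Hb, Hl; ring.
  - transitivity
      (mink r x * det3 (c1 y) (c2 y) (c4 y) (c1 b) (c2 b) (c4 b) (c1 l) (c2 l) (c4 l)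
     - mink r y * det3 (c1 x) (c2 x) (c4 x) (c1 b) (c2 b) (c4 b) (c1 l) (c2 l) (c4 l)
     + mink r b * det3 (c1 x) (c2 x) (c4 x) (c1 y) (c2 y) (c4 y) (c1 l) (c2 l) (c4 l)
     - mink r l * det3 (c1 x) (c2 x) (c4 x) (c1 y) (c2 y) (c4 y) (c1 b) (c2 b) (c4 b)).
    + unfold det4, det3, mink; ring.
    + rewrite Hx, Hy, Hb, Hl; ring.
  - transitivity
      (mink r x * det3 (c1 y) (c2 y) (c3 y) (c1 b) (c2 b) (c3 b) (c1 l) (c2 l) (c3 l)
     - mink r y * det3 (c1 x) (c2 x) (c3 x) (c1 b) (c2 b) (c3 b) (c1 l) (c2 l) (c3 l)
     + mink r b * det3 (c1 x) (c2 x) (c3 x) (c1 y) (c2 y) (c3 y) (c1 l) (c2 l) (c3 l)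
     - mink r l * det3 (c1 x) (c2 x) (c3 x) (c1 y) (c2 y) (c3 y) (c1 b) (c2 b) (c3 b)).
    + unfold det4, det3, mink; ring.
    + rewrite Hx, Hy, Hb, Hl; ring.
Qed.

(** Cramer's rule for the system with columns [x, y, b, l]. *)
Lemma frame_independent x y b l p q r s :
  det4 x y b l <> 0 -> comb4 p q r s x y b l = mk4 0 0 0 0 ->
  p = 0 /\ q = 0 /\ r = 0 /\ s = 0.
Proof.
  intros Hd H.
  assert (E : forall t w, w = mk4 0 0 0 0 ->
            (det4 w y b l = t * det4 x y b l \/ det4 x w b l = t * det4 x y b l \/
             det4 x y w l = t * det4 x y b l \/ det4 x y b w = t * det4 x y b l) ->
            t = 0).
  { intros t w -> Hw. apply Rmult_eq_reg_r with (det4 x y b l); auto.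
    rewrite Rmult_0_l.
    destruct Hw as [Hw | [Hw | [Hw | Hw]]]; rewrite <- Hw;
    unfold det4, det3; simpl; ring. }
  repeat split; apply (E _ _ H).
  - left. unfold det4, det3, comb4; simpl; ring.
  - right; left. unfold det4, det3, comb4; simpl; ring.
  - right; right; left. unfold det4, det3, comb4; simpl; ring.
  - right; right; right. unfold det4, det3, comb4; simpl; ring.
Qed.

Lemma orthonormal_expansion x y b l w :
  orthonormal x y b l -> det4 x y b l <> 0 ->
  w = comb4 (mink w x) (mink w y) (mink w b) (- mink w l) x y b l.
Proof.
  intros (xx & yy & bb & ll & xy & xb & xl & yb & yl & bl) Hd.
  set (z := comb4 _ _ _ _ _ _ _ _).
  assert (E : vadd w (vscal (-1) z) = mk4 0 0 0 0).
  { apply (mink_frame_nondegenerate x y b l); auto;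
    rewrite mink_vadd_l, mink_vscal_l; unfold z; rewrite mink_comb4_l.
    - rewrite xx, (mink_sym y x), (mink_sym b x), (mink_sym l x), xy, xb, xl. ring.
    - rewrite yy, (mink_sym b y), (mink_sym l y), xy, yb, yl. ring.
    - rewrite bb, (mink_sym l b), xb, yb, bl. ring.
    - rewrite ll, xl, yl, bl. ring. }
  clearbody z. apply vec4_ext.
  - generalize (f_equal c1 E); simpl; lra.
  - generalize (f_equal c2 E); simpl; lra.
  - generalize (f_equal c3 E); simpl; lra.
  - generalize (f_equal c4 E); simpl; lra.
Qed.

(** The products of [w] with the frame. With the signs of the metric these are the
    components of [w] in an orthonormal frame, which is why the Minkowski product
    is used to pair two such vectors. *)
Definition coords (x y b l w : vec4) : vec4 :=
  mk4 (mink x w) (mink y w) (mink b w) (mink l w).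

(** Parseval's identity. Unlike orthonormality, it involves the frame only through
    the pairing that moving frames conserve. *)
Lemma orthonormal_parseval x y b l w w' :
  orthonormal x y b l -> det4 x y b l <> 0 ->
  mink (coords x y b l w) (coords x y b l w') = mink w w'.
Proof.
  intros ON Hd. rewrite (orthonormal_expansion x y b l w ON Hd) at 2.
  rewrite mink_comb4_l, !(mink_sym w). unfold coords. rewrite mink_mk4. ring.
Qed.

Lemma parseval_orthonormal x y b l :
  det4 x y b l <> 0 ->
  (forall w w', mink (coords x y b l w) (coords x y b l w') = mink w w') ->
  orthonormal x y b l.
Proof.
  intros Hd H.
  (* By [H], every [w] is a combination of the frame with its own products as
     coefficients; for [w] in the frame, independence identifies them. *)
  assert (E : forall w, w = comb4 (mink x w) (mink y w) (mink b w) (- mink l w)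
                              x y b l).
  { intros w. apply mink_separates. intros w'. rewrite <- H, mink_comb4_l.
    unfold coords. rewrite mink_mk4. ring. }
  assert (I : forall p q r s p' q' r' s',
     comb4 p q r s x y b l = comb4 p' q' r' s' x y b l ->
     p = p' /\ q = q' /\ r = r' /\ s = s').
  { intros p q r s p' q' r' s' e.
    destruct (frame_independent x y b l (p - p') (q - q') (r - r') (s - s') Hd)
      as (? & ? & ? & ?); [|repeat split; lra].
    apply vec4_ext.
    - generalize (f_equal c1 e); simpl; lra.
    - generalize (f_equal c2 e); simpl; lra.
    - generalize (f_equal c3 e); simpl; lra.
    - generalize (f_equal c4 e); simpl; lra. }
  assert (X : x = comb4 1 0 0 0 x y b l) by (apply vec4_ext; simpl; ring).
  assert (Y : y = comb4 0 1 0 0 x y b l) by (apply vec4_ext; simpl; ring).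
  assert (B : b = comb4 0 0 1 0 x y b l) by (apply vec4_ext; simpl; ring).
  assert (L : l = comb4 0 0 0 1 x y b l) by (apply vec4_ext; simpl; ring).
  destruct (I _ _ _ _ _ _ _ _ (eq_trans (eq_sym X) (E x))) as (x1 & x2 & x3 & x4).
  destruct (I _ _ _ _ _ _ _ _ (eq_trans (eq_sym Y) (E y))) as (y1 & y2 & y3 & y4).
  destruct (I _ _ _ _ _ _ _ _ (eq_trans (eq_sym B) (E b))) as (b1 & b2 & b3 & b4).
  destruct (I _ _ _ _ _ _ _ _ (eq_trans (eq_sym L) (E l))) as (l1 & l2 & l3 & l4).
  repeat split; lra.
Qed.

(** Applied to a vector [w] of the first frame, whose coordinates are known, the
    identity reads off the corresponding vector of the second one. *)
Lemma parseval_unique x y b l x' y' b' l' :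
  orthonormal x y b l ->
  (forall w w', mink (coords x y b l w) (coords x' y' b' l' w') = mink w w') ->
  x' = x /\ y' = y /\ b' = b /\ l' = l.
Proof.
  intros (xx & yy & bb & ll & xy & xb & xl & yb & yl & bl) H.
  assert (E : forall e w, mink e w
     = mink x e * mink x' w + mink y e * mink y' w + mink b e * mink b' w
       - mink l e * mink l' w) by (intros; now rewrite <- H).
  repeat split; apply mink_separates; intros w; symmetry; rewrite E.
  - rewrite xx, (mink_sym y x), (mink_sym b x), (mink_sym l x), xy, xb, xl. ring.
  - rewrite yy, (mink_sym b y), (mink_sym l y), xy, yb, yl. ring.
  - rewrite bb, (mink_sym l b), xb, yb, bl. ring.
  - rewrite ll, xl, yl, bl. ring.
Qed.

(** * Moving frames *)

(** The coefficients are the products [<dx, y>], [<dx, b>], [<dx, l>], [<dy, b>],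
    [<dy, l>], [<db, l>]; for an orthonormal frame the remaining ones are forced by
    differentiating the orthonormality relations, with a change of sign for the timelike vector [l]. *)
Definition moving_frame (x y b l dx dy db dl : vec4)
    (xy xb xl yb yl bl : R) : Prop :=
  dx = comb4 0 xy xb (- xl) x y b l /\
  dy = comb4 (- xy) 0 yb (- yl) x y b l /\
  db = comb4 (- xb) (- yb) 0 (- bl) x y b l /\
  dl = comb4 (- xl) (- yl) (- bl) 0 x y b l.

Lemma moving_frame_orthonormal x y b l dx dy db dl :
  orthonormal x y b l -> det4 x y b l <> 0 ->
  mink dx x = 0 -> mink dy y = 0 -> mink db b = 0 -> mink dl l = 0 ->
  mink dx y + mink x dy = 0 -> mink dx b + mink x db = 0 ->
  mink dx l + mink x dl = 0 -> mink dy b + mink y db = 0 ->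
  mink dy l + mink y dl = 0 -> mink db l + mink b dl = 0 ->
  moving_frame x y b l dx dy db dl (mink dx y) (mink dx b) (mink dx l)
    (mink dy b) (mink dy l) (mink db l).
Proof.
  intros ON Hd xx yy bb ll xy xb xl yb yl bl.
  rewrite (mink_sym x dy) in xy. rewrite (mink_sym x db) in xb.
  rewrite (mink_sym x dl) in xl. rewrite (mink_sym y db) in yb.
  rewrite (mink_sym y dl) in yl. rewrite (mink_sym b dl) in bl.
  repeat split.
  - rewrite (orthonormal_expansion x y b l dx ON Hd) at 1. f_equal; lra.
  - rewrite (orthonormal_expansion x y b l dy ON Hd) at 1. f_equal; lra.
  - rewrite (orthonormal_expansion x y b l db ON Hd) at 1. f_equal; lra.
  - rewrite (orthonormal_expansion x y b l dl ON Hd) at 1. f_equal; lra.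
Qed.

(** An infinitesimal isometry common to both frames does not change the pairing. *)
Lemma moving_frame_coords x y b l dx dy db dl xy xb xl yb yl bl
    x' y' b' l' dx' dy' db' dl' w w' :
  moving_frame x y b l dx dy db dl xy xb xl yb yl bl ->
  moving_frame x' y' b' l' dx' dy' db' dl' xy xb xl yb yl bl ->
  mink (coords dx dy db dl w) (coords x' y' b' l' w')
  + mink (coords x y b l w) (coords dx' dy' db' dl' w') = 0.
Proof.
  intros (-> & -> & -> & ->) (-> & -> & -> & ->).
  unfold coords. rewrite !mink_mk4, !mink_comb4_l. ring.
Qed.

(** The coefficient matrix of a moving frame has trace zero. *)
Lemma moving_frame_det x y b l dx dy db dl xy xb xl yb yl bl :
  moving_frame x y b l dx dy db dl xy xb xl yb yl bl ->
  det4 dx y b l + det4 x dy b l + det4 x y db l + det4 x y b dl = 0.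
Proof.
  intros (-> & -> & -> & ->). unfold det4, det3, comb4; simpl. ring.
Qed.

Lemma is_derive_det4_curves (x1 x2 x3 x4 y1 y2 y3 y4 b1 b2 b3 b4 l1 l2 l3 l4 : R -> R) t
    (x := fun s => mk4 (x1 s) (x2 s) (x3 s) (x4 s))
    (y := fun s => mk4 (y1 s) (y2 s) (y3 s) (y4 s))
    (b := fun s => mk4 (b1 s) (b2 s) (b3 s) (b4 s))
    (l := fun s => mk4 (l1 s) (l2 s) (l3 s) (l4 s))
    (dx := mk4 (Derive x1 t) (Derive x2 t) (Derive x3 t) (Derive x4 t))
    (dy := mk4 (Derive y1 t) (Derive y2 t) (Derive y3 t) (Derive y4 t))
    (db := mk4 (Derive b1 t) (Derive b2 t) (Derive b3 t) (Derive b4 t))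
    (dl := mk4 (Derive l1 t) (Derive l2 t) (Derive l3 t) (Derive l4 t)) :
  ex_derive x1 t -> ex_derive x2 t -> ex_derive x3 t -> ex_derive x4 t ->
  ex_derive y1 t -> ex_derive y2 t -> ex_derive y3 t -> ex_derive y4 t ->
  ex_derive b1 t -> ex_derive b2 t -> ex_derive b3 t -> ex_derive b4 t ->
  ex_derive l1 t -> ex_derive l2 t -> ex_derive l3 t -> ex_derive l4 t ->
  is_derive (fun s => det4 (x s) (y s) (b s) (l s)) t
    (det4 dx (y t) (b t) (l t) + det4 (x t) dy (b t) (l t)
     + det4 (x t) (y t) db (l t) + det4 (x t) (y t) (b t) dl).
Proof.
  intros. unfold det4, det3, x, y, b, l, dx, dy, db, dl; simpl.
  auto_derive; [tauto|].
  change (fun s => x1 s) with x1. change (fun s => x2 s) with x2.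
  change (fun s => x3 s) with x3. change (fun s => x4 s) with x4.
  change (fun s => y1 s) with y1. change (fun s => y2 s) with y2.
  change (fun s => y3 s) with y3. change (fun s => y4 s) with y4.
  change (fun s => b1 s) with b1. change (fun s => b2 s) with b2.
  change (fun s => b3 s) with b3. change (fun s => b4 s) with b4.
  change (fun s => l1 s) with l1. change (fun s => l2 s) with l2.
  change (fun s => l3 s) with l3. change (fun s => l4 s) with l4.
  ring.
Qed.

Lemma is_derive_det4_u D x y b l u v :
  vsmooth_on D x -> vsmooth_on D y -> vsmooth_on D b -> vsmooth_on D l ->
  D (u, v) ->
  is_derive (fun s => det4 (x s v) (y s v) (b s v) (l s v)) u
    (det4 (VDu x u v) (y u v) (b u v) (l u v)
     + det4 (x u v) (VDu y u v) (b u v) (l u v)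
     + det4 (x u v) (y u v) (VDu b u v) (l u v)
     + det4 (x u v) (y u v) (b u v) (VDu l u v)).
Proof.
  intros (? & ? & ? & ?) (? & ? & ? & ?) (? & ? & ? & ?) (? & ? & ? & ?) Duv.
  apply (is_derive_det4_curves
    (fun s => c1 (x s v)) (fun s => c2 (x s v)) (fun s => c3 (x s v))
    (fun s => c4 (x s v)) (fun s => c1 (y s v)) (fun s => c2 (y s v))
    (fun s => c3 (y s v)) (fun s => c4 (y s v)) (fun s => c1 (b s v))
    (fun s => c2 (b s v)) (fun s => c3 (b s v)) (fun s => c4 (b s v))
    (fun s => c1 (l s v)) (fun s => c2 (l s v)) (fun s => c3 (l s v))
    (fun s => c4 (l s v)));
  eexists; apply (smooth_is_derive_u D (fun s t => _ (_ s t))); eauto.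
Qed.

Lemma is_derive_det4_v D x y b l u v :
  vsmooth_on D x -> vsmooth_on D y -> vsmooth_on D b -> vsmooth_on D l ->
  D (u, v) ->
  is_derive (fun t => det4 (x u t) (y u t) (b u t) (l u t)) v
    (det4 (VDv x u v) (y u v) (b u v) (l u v)
     + det4 (x u v) (VDv y u v) (b u v) (l u v)
     + det4 (x u v) (y u v) (VDv b u v) (l u v)
     + det4 (x u v) (y u v) (b u v) (VDv l u v)).
Proof.
  intros (? & ? & ? & ?) (? & ? & ? & ?) (? & ? & ? & ?) (? & ? & ? & ?) Duv.
  apply (is_derive_det4_curves
    (fun t => c1 (x u t)) (fun t => c2 (x u t)) (fun t => c3 (x u t))
    (fun t => c4 (x u t)) (fun t => c1 (y u t)) (fun t => c2 (y u t))
    (fun t => c3 (y u t)) (fun t => c4 (y u t)) (fun t => c1 (b u t))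
    (fun t => c2 (b u t)) (fun t => c3 (b u t)) (fun t => c4 (b u t))
    (fun t => c1 (l u t)) (fun t => c2 (l u t)) (fun t => c3 (l u t))
    (fun t => c4 (l u t)));
  eexists; apply (smooth_is_derive_v D (fun s t => _ (_ s t))); eauto.
Qed.

(** The argument [dif] is [VDu] or [VDv]. *)
Definition frame_motion (dif : (R -> R -> vec4) -> R -> R -> vec4)
    (x y b l : R -> R -> vec4) (u v : R) : R -> R -> R -> R -> R -> R -> Prop :=
  moving_frame (x u v) (y u v) (b u v) (l u v)
    (dif x u v) (dif y u v) (dif b u v) (dif l u v).

Section Moving_frames_on_a_square.

Variables u0 v0 d : R.
Let Q := square u0 v0 d.
Variables x y b l : R -> R -> vec4.
Hypothesis sx : vsmooth_on Q x.
Hypothesis sy : vsmooth_on Q y.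
Hypothesis sb : vsmooth_on Q b.
Hypothesis sl : vsmooth_on Q l.
Variables xyu xbu xlu ybu ylu blu xyv xbv xlv ybv ylv blv : R -> R -> R.
Hypothesis motion_u : forall u v, Q (u, v) ->
  frame_motion VDu x y b l u v (xyu u v) (xbu u v) (xlu u v) (ybu u v) (ylu u v)
    (blu u v).
Hypothesis motion_v : forall u v, Q (u, v) ->
  frame_motion VDv x y b l u v (xyv u v) (xbv u v) (xlv u v) (ybv u v) (ylv u v)
    (blv u v).

Lemma moving_frame_det_constant u v : Q (u, v) ->
  det4 (x u v) (y u v) (b u v) (l u v) = det4 (x u0 v0) (y u0 v0) (b u0 v0) (l u0 v0).
Proof.
  apply (constant_on_square
    (fun u v => det4 (x u v) (y u v) (b u v) (l u v)) u0 v0 d).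
  - intros s t Hq. rewrite <- (moving_frame_det _ _ _ _ _ _ _ _ _ _ _ _ _ _ (motion_u s t Hq)).
    apply (is_derive_det4_u Q); auto.
  - intros s t Hq. rewrite <- (moving_frame_det _ _ _ _ _ _ _ _ _ _ _ _ _ _ (motion_v s t Hq)).
    apply (is_derive_det4_v Q); auto.
Qed.

Lemma vsmooth_coords x1 y1 b1 l1 w :
  vsmooth_on Q x1 -> vsmooth_on Q y1 -> vsmooth_on Q b1 -> vsmooth_on Q l1 ->
  vsmooth_on Q (fun u v => coords (x1 u v) (y1 u v) (b1 u v) (l1 u v) w).
Proof.
  intros s1 s2 s3 s4.
  assert (sw : vsmooth_on Q (fun _ _ => w))
    by (repeat apply conj; apply smooth_const).
  repeat apply conj; apply (smooth_mink Q (open_square _ _ _) _ (fun _ _ => w)); auto.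
Qed.

Lemma VDu_coords x1 y1 b1 l1 w u v :
  vsmooth_on Q x1 -> vsmooth_on Q y1 -> vsmooth_on Q b1 -> vsmooth_on Q l1 ->
  Q (u, v) -> VDu (fun u v => coords (x1 u v) (y1 u v) (b1 u v) (l1 u v) w) u v
  = coords (VDu x1 u v) (VDu y1 u v) (VDu b1 u v) (VDu l1 u v) w.
Proof.
  intros s1 s2 s3 s4 Hq.
  assert (E : forall a, vsmooth_on Q a ->
            Du (fun s t => mink (a s t) w) u v = mink (VDu a u v) w).
  { intros a sa. rewrite (Du_mink Q a (fun _ _ => w)); auto.
    - unfold VDu at 2, Du, mink; simpl. rewrite !Derive_const. ring.
    - repeat apply conj; apply smooth_const. }
  unfold coords. apply vec4_ext; apply E; auto.
Qed.

Lemma VDv_coords x1 y1 b1 l1 w u v :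
  vsmooth_on Q x1 -> vsmooth_on Q y1 -> vsmooth_on Q b1 -> vsmooth_on Q l1 ->
  Q (u, v) -> VDv (fun u v => coords (x1 u v) (y1 u v) (b1 u v) (l1 u v) w) u v
  = coords (VDv x1 u v) (VDv y1 u v) (VDv b1 u v) (VDv l1 u v) w.
Proof.
  intros s1 s2 s3 s4 Hq.
  assert (E : forall a, vsmooth_on Q a ->
            Dv (fun s t => mink (a s t) w) u v = mink (VDv a u v) w).
  { intros a sa. rewrite (Dv_mink Q a (fun _ _ => w)); auto.
    - unfold VDv at 2, Dv, mink; simpl. rewrite !Derive_const. ring.
    - repeat apply conj; apply smooth_const. }
  unfold coords. apply vec4_ext; apply E; auto.
Qed.

Lemma comoving_frames_pairing_constant x' y' b' l' w w' u v :
  vsmooth_on Q x' -> vsmooth_on Q y' -> vsmooth_on Q b' -> vsmooth_on Q l' ->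
  (forall u v, Q (u, v) ->
     frame_motion VDu x' y' b' l' u v (xyu u v) (xbu u v) (xlu u v) (ybu u v)
       (ylu u v) (blu u v)) ->
  (forall u v, Q (u, v) ->
     frame_motion VDv x' y' b' l' u v (xyv u v) (xbv u v) (xlv u v) (ybv u v)
       (ylv u v) (blv u v)) ->
  Q (u, v) ->
  mink (coords (x u v) (y u v) (b u v) (l u v) w)
       (coords (x' u v) (y' u v) (b' u v) (l' u v) w')
  = mink (coords (x u0 v0) (y u0 v0) (b u0 v0) (l u0 v0) w)
         (coords (x' u0 v0) (y' u0 v0) (b' u0 v0) (l' u0 v0) w').
Proof.
  intros sx' sy' sb' sl' motion_u' motion_v'.
  set (p := fun u v => coords (x u v) (y u v) (b u v) (l u v) w).
  set (q := fun u v => coords (x' u v) (y' u v) (b' u v) (l' u v) w').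
  assert (sp : vsmooth_on Q p) by (apply vsmooth_coords; auto).
  assert (sq : vsmooth_on Q q) by (apply vsmooth_coords; auto).
  assert (spq := smooth_mink Q (open_square _ _ _) p q sp sq).
  apply (constant_on_square (fun u v => mink (p u v) (q u v)) u0 v0 d).
  - intros s t Hq. replace 0 with (Du (fun s t => mink (p s t) (q s t)) s t).
    + now apply (smooth_is_derive_u Q _ s t spq).
    + rewrite (Du_mink Q p q) by auto. unfold p, q at 2.
      rewrite !VDu_coords by auto.
      eapply moving_frame_coords; [apply motion_u | apply motion_u']; auto.
  - intros s t Hq. replace 0 with (Dv (fun s t => mink (p s t) (q s t)) s t).
    + now apply (smooth_is_derive_v Q _ s t spq).
    + rewrite (Dv_mink Q p q) by auto. unfold p, q at 2.
      rewrite !VDv_coords by auto.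
      eapply moving_frame_coords; [apply motion_v | apply motion_v']; auto.
Qed.

End Moving_frames_on_a_square.

(** * The second fundamental tensor *)

Lemma mink_normal_part z u v w n :
  mink (VDu z u v) n = 0 -> mink (VDv z u v) n = 0 ->
  mink (normal_part z u v w) n = mink w n.
Proof.
  intros Hu Hv. unfold normal_part.
  rewrite !mink_vadd_l, !mink_vscal_l, Hu, Hv. ring.
Qed.

Lemma normal_part_orthogonal z u v w :
  EE z u v * GG z u v - FF z u v * FF z u v <> 0 ->
  mink (normal_part z u v w) (VDu z u v) = 0 /\
  mink (normal_part z u v w) (VDv z u v) = 0.
Proof.
  intros HW. unfold normal_part.
  rewrite !mink_vadd_l, !mink_vscal_l, (mink_sym (VDv z u v) (VDu z u v)).
  change (mink (VDu z u v) (VDu z u v)) with (EE z u v).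
  change (mink (VDu z u v) (VDv z u v)) with (FF z u v).
  change (mink (VDv z u v) (VDv z u v)) with (GG z u v).
  split; field; auto.
Qed.

Lemma mink_sigma z u v X Y n :
  mink (VDu z u v) n = 0 -> mink (VDv z u v) n = 0 ->
  mink (sigma z u v X Y) n
  = fst X * fst Y * mink (VDu (VDu z) u v) n
    + (fst X * snd Y + snd X * fst Y) * mink (VDv (VDu z) u v) n
    + snd X * snd Y * mink (VDv (VDv z) u v) n.
Proof.
  intros Hu Hv. unfold sigma. rewrite mink_normal_part by auto.
  rewrite !mink_vadd_l, !mink_vscal_l. ring.
Qed.

Lemma sigma_orthogonal z u v X Y :
  EE z u v * GG z u v - FF z u v * FF z u v <> 0 ->
  mink (sigma z u v X Y) (VDu z u v) = 0 /\
  mink (sigma z u v X Y) (VDv z u v) = 0.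
Proof. intros. now apply normal_part_orthogonal. Qed.

(** For [F = 0] the Gram-Schmidt frame is the frame of the principal directions. *)
Lemma HH_principal z u v :
  0 < EE z u v -> 0 < GG z u v -> FF z u v = 0 ->
  HH z u v = vscal (/ 2) (vadd (sigma z u v (tx z u v) (tx z u v))
                               (sigma z u v (ty z u v) (ty z u v))).
Proof.
  intros HE HG HF.
  assert (0 < sqrt (EE z u v)) by (now apply sqrt_lt_R0).
  assert (0 < sqrt (GG z u v)) by (now apply sqrt_lt_R0).
  unfold HH. do 3 f_equal; unfold tx, ty; rewrite HF;
  rewrite Rmult_0_l, Rminus_0_r, sqrt_mult_alt by lra;
  f_equal; field; split; lra.
Qed.

Lemma mink_HH z u v n :
  0 < EE z u v -> 0 < GG z u v -> FF z u v = 0 ->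
  mink (VDu z u v) n = 0 -> mink (VDv z u v) n = 0 ->
  mink (HH z u v) n = / 2 * (mink (VDu (VDu z) u v) n / EE z u v
                             + mink (VDv (VDv z) u v) n / GG z u v).
Proof.
  intros HE HG HF Hu Hv. rewrite HH_principal by auto.
  rewrite mink_vscal_l, mink_vadd_l, !mink_sigma by auto.
  unfold tx, ty; simpl.
  assert (isq : forall r, 0 < r -> / r = / sqrt r * / sqrt r).
  { intros r Hr. rewrite <- Rinv_mult, sqrt_sqrt; lra. }
  unfold Rdiv. rewrite (isq (EE z u v)), (isq (GG z u v)) by auto. ring.
Qed.

Lemma det4_vscal2 p q x y b l :
  det4 (vscal p x) (vscal q y) b l = p * q * det4 x y b l.
Proof. unfold det4, det3; simpl; ring. Qed.

Lemma Du_ln (D : R * R -> Prop) f u v :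
  smooth_on D f -> D (u, v) -> 0 < f u v ->
  Du (fun s t => ln (f s t)) u v = Du f u v / f u v.
Proof.
  intros Sf Duv Hf. apply is_derive_unique. unfold Rdiv.
  apply (is_derive_comp ln (fun s => f s v)).
  - now apply is_derive_ln.
  - now apply (smooth_is_derive_u D).
Qed.

Lemma Dv_ln (D : R * R -> Prop) f u v :
  smooth_on D f -> D (u, v) -> 0 < f u v ->
  Dv (fun s t => ln (f s t)) u v = Dv f u v / f u v.
Proof.
  intros Sf Duv Hf. apply is_derive_unique. unfold Rdiv.
  apply (is_derive_comp ln (fun t => f u t)).
  - now apply is_derive_ln.
  - now apply (smooth_is_derive_v D).
Qed.

(** * Frame equations of a surface in principal parameters *)

(** The frame equations follow from the geometric functions as far as these are
    products of second derivatives with [b] and [l]; the tangential products come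
    from [F = 0] and from the logarithmic derivatives of [sqrt E] and [sqrt G],
    and two products with [b] vanish by [pure_derivatives_b]. *)
Section Surface_equations.

Variables (D : R * R -> Prop) (z b : R -> R -> vec4).
Variables gamma1 gamma2 nu1 nu2 lambda mu beta1 beta2 : R -> R -> R.
Hypothesis oD : open D.
Hypothesis sz : vsmooth_on D z.
Hypothesis spacelike : spacelike_on z D.
Hypothesis timelike : timelike_H_on z D.
Hypothesis principal : principal_on z D.
Hypothesis frame_b : is_frame_b z D b.
Hypothesis data : forall u v, D (u, v) ->
  geo_gamma1 z u v = gamma1 u v /\ geo_gamma2 z u v = gamma2 u v /\
  geo_nu1 z u v = nu1 u v /\ geo_nu2 z u v = nu2 u v /\
  geo_lambda z u v = lambda u v /\ geo_mu z b u v = mu u v /\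
  geo_beta1 z b u v = beta1 u v /\ geo_beta2 z b u v = beta2 u v.

Let e u v := sqrt (EE z u v).
Let g u v := sqrt (GG z u v).
Let x := frame_x z.
Let y := frame_y z.
Let l := frame_l z.

Lemma FF_eq_0 u v : D (u, v) -> FF z u v = 0.
Proof. intros Duv. apply (principal u v Duv). Qed.

Lemma EE_pos u v : D (u, v) -> 0 < EE z u v.
Proof. intros Duv. apply (spacelike u v Duv). Qed.

Lemma GG_pos u v : D (u, v) -> 0 < GG z u v.
Proof.
  intros Duv. destruct (spacelike u v Duv) as [HE HW].
  rewrite (FF_eq_0 u v Duv), Rmult_0_l, Rminus_0_r in HW.
  apply Rmult_lt_reg_l with (EE z u v); lra.
Qed.

Lemma e_pos u v : D (u, v) -> 0 < e u v.
Proof. intros Duv. apply sqrt_lt_R0, EE_pos, Duv. Qed.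

Lemma g_pos u v : D (u, v) -> 0 < g u v.
Proof. intros Duv. apply sqrt_lt_R0, GG_pos, Duv. Qed.

Lemma e_sqr u v : D (u, v) -> e u v * e u v = EE z u v.
Proof. intros Duv. apply sqrt_sqrt. left. apply EE_pos, Duv. Qed.

Lemma g_sqr u v : D (u, v) -> g u v * g u v = GG z u v.
Proof. intros Duv. apply sqrt_sqrt. left. apply GG_pos, Duv. Qed.

Lemma smooth_EE : smooth_on D (EE z).
Proof. apply smooth_mink; auto; now apply vsmooth_VDu. Qed.

Lemma smooth_GG : smooth_on D (GG z).
Proof. apply smooth_mink; auto; now apply vsmooth_VDv. Qed.

Lemma smooth_FF : smooth_on D (FF z).
Proof. apply smooth_mink; auto; [now apply vsmooth_VDu | now apply vsmooth_VDv]. Qed.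

Lemma smooth_e : smooth_on D e.
Proof. apply smooth_sqrt; auto using smooth_EE, EE_pos. Qed.

Lemma smooth_g : smooth_on D g.
Proof. apply smooth_sqrt; auto using smooth_GG, GG_pos. Qed.

Lemma smooth_inv_e : smooth_on D (fun u v => / e u v).
Proof.
  apply smooth_inv; auto using smooth_e. intros u v Duv.
  apply Rgt_not_eq, e_pos, Duv.
Qed.

Lemma smooth_inv_g : smooth_on D (fun u v => / g u v).
Proof.
  apply smooth_inv; auto using smooth_g. intros u v Duv.
  apply Rgt_not_eq, g_pos, Duv.
Qed.

Lemma frame_x_eq u v : x u v = vscal (/ e u v) (VDu z u v).
Proof. apply vec4_ext; simpl; unfold e; ring. Qed.

Lemma frame_y_eq u v : y u v = vscal (/ g u v) (VDv z u v).
Proof. apply vec4_ext; simpl; unfold g; ring. Qed.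

Lemma VDu_z u v : D (u, v) -> VDu z u v = vscal (e u v) (x u v).
Proof.
  intros Duv. assert (H := e_pos u v Duv). rewrite frame_x_eq.
  apply vec4_ext; simpl; field; lra.
Qed.

Lemma VDv_z u v : D (u, v) -> VDv z u v = vscal (g u v) (y u v).
Proof.
  intros Duv. assert (H := g_pos u v Duv). rewrite frame_y_eq.
  apply vec4_ext; simpl; field; lra.
Qed.

Lemma vsmooth_x : vsmooth_on D x.
Proof.
  apply (vsmooth_ext D oD (fun u v => vscal (/ e u v) (VDu z u v))).
  - intros; symmetry; apply frame_x_eq.
  - apply (vsmooth_vscal D oD (fun u v => / e u v)); auto using smooth_inv_e.
    now apply vsmooth_VDu.
Qed.

Lemma vsmooth_y : vsmooth_on D y.
Proof.
  apply (vsmooth_ext D oD (fun u v => vscal (/ g u v) (VDv z u v))).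
  - intros; symmetry; apply frame_y_eq.
  - apply (vsmooth_vscal D oD (fun u v => / g u v)); auto using smooth_inv_g.
    now apply vsmooth_VDv.
Qed.

Lemma vsmooth_normal_part w : vsmooth_on D w ->
  vsmooth_on D (fun u v => normal_part z u v (w u v)).
Proof.
  intros sw. unfold normal_part.
  assert (su := vsmooth_VDu D z sz). assert (sv := vsmooth_VDv D z sz).
  assert (swu := smooth_mink D oD w _ sw su).
  assert (swv := smooth_mink D oD w _ sw sv).
  assert (iW : smooth_on D
            (fun u v => / (EE z u v * GG z u v - FF z u v * FF z u v))).
  { apply smooth_inv; auto.
    - intros u v Duv. apply Rgt_not_eq. apply (spacelike u v Duv).
    - apply smooth_minus; auto; apply smooth_mult;
      auto using smooth_EE, smooth_GG, smooth_FF. }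
  apply (vsmooth_vadd D oD w); auto.
  apply (vsmooth_vadd D oD (fun u v => vscal _ (VDu z u v))
           (fun u v => vscal _ (VDv z u v)));
  (apply (vsmooth_vscal D oD); [|assumption]);
  (apply smooth_opp; auto; unfold Rdiv; apply smooth_mult; auto;
   apply smooth_minus; auto; apply smooth_mult;
   auto using smooth_EE, smooth_GG, smooth_FF).
Qed.

Lemma vsmooth_sigma_diag (p q : R -> R -> R) :
  smooth_on D p -> smooth_on D q ->
  vsmooth_on D (fun u v => sigma z u v (p u v, q u v) (p u v, q u v)).
Proof.
  intros sp sq. apply vsmooth_normal_part. simpl.
  assert (su := vsmooth_VDu D z sz). assert (sv := vsmooth_VDv D z sz).
  apply (vsmooth_vadd D oD (fun u v => vscal _ (VDu (VDu z) u v))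
           (fun u v => vadd _ _)).
  - apply (vsmooth_vscal D oD (fun u v => p u v * p u v)).
    + apply smooth_mult; auto. + now apply vsmooth_VDu.
  - apply (vsmooth_vadd D oD (fun u v => vscal _ (VDv (VDu z) u v))
           (fun u v => vscal _ (VDv (VDv z) u v))).
    + apply (vsmooth_vscal D oD (fun u v => p u v * q u v + q u v * p u v)).
      * apply smooth_plus; auto; apply smooth_mult; auto.
      * now apply vsmooth_VDv.
    + apply (vsmooth_vscal D oD (fun u v => q u v * q u v)).
      * apply smooth_mult; auto. * now apply vsmooth_VDv.
Qed.

Lemma vsmooth_HH : vsmooth_on D (HH z).
Proof.
  apply (vsmooth_ext D oD (fun u v => vscal (/ 2)
    (vadd (sigma z u v (tx z u v) (tx z u v)) (sigma z u v (ty z u v) (ty z u v))))).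
  - intros u v Duv. symmetry. apply HH_principal; auto using EE_pos, GG_pos, FF_eq_0.
  - apply (vsmooth_vscal D oD (fun _ _ => / 2)); [apply smooth_const|].
    apply (vsmooth_vadd D oD (fun u v => sigma z u v (tx z u v) (tx z u v))
             (fun u v => sigma z u v (ty z u v) (ty z u v))).
    + apply (vsmooth_sigma_diag (fun u v => / e u v) (fun _ _ => 0));
      auto using smooth_inv_e, smooth_const.
    + apply (vsmooth_sigma_diag (fun _ _ => 0) (fun u v => / g u v));
      auto using smooth_inv_g, smooth_const.
Qed.

Lemma vsmooth_l : vsmooth_on D l.
Proof.
  assert (sm : smooth_on D (fun u v => - mink (HH z u v) (HH z u v))).
  { apply smooth_opp; auto. apply smooth_mink; auto using vsmooth_HH. }
  assert (pos : forall u v, D (u, v) -> 0 < - mink (HH z u v) (HH z u v)).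
  { intros u v Duv. specialize (timelike u v Duv). lra. }
  apply (vsmooth_vscal D oD (fun u v => - / sqrt (- mink (HH z u v) (HH z u v)))
           (HH z)); auto using vsmooth_HH.
  apply smooth_opp; auto. apply smooth_inv; auto.
  - intros u v Duv. apply Rgt_not_eq, sqrt_lt_R0. auto.
  - apply smooth_sqrt; auto.
Qed.

Lemma vsmooth_b : vsmooth_on D b.
Proof. apply frame_b. Qed.

Lemma frame_on u v : D (u, v) -> orthonormal (x u v) (y u v) (b u v) (l u v).
Proof. intros Duv. now apply frame_b. Qed.

Lemma frame_det u v : D (u, v) -> 0 < det4 (x u v) (y u v) (b u v) (l u v).
Proof. intros Duv. now apply frame_b. Qed.

Lemma normal_b u v : D (u, v) ->
  mink (VDu z u v) (b u v) = 0 /\ mink (VDv z u v) (b u v) = 0.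
Proof.
  intros Duv. rewrite VDu_z, VDv_z, !mink_vscal_l by auto.
  destruct (frame_on u v Duv) as (_ & _ & _ & _ & _ & -> & _ & -> & _ & _).
  split; ring.
Qed.

Lemma normal_l u v : D (u, v) ->
  mink (VDu z u v) (l u v) = 0 /\ mink (VDv z u v) (l u v) = 0.
Proof.
  intros Duv. rewrite VDu_z, VDv_z, !mink_vscal_l by auto.
  destruct (frame_on u v Duv) as (_ & _ & _ & _ & _ & _ & -> & _ & -> & _).
  split; ring.
Qed.

Lemma second_derivatives_l u v : D (u, v) ->
  mink (VDu (VDu z) u v) (l u v) = EE z u v * nu1 u v /\
  mink (VDv (VDu z) u v) (l u v) = e u v * g u v * lambda u v /\
  mink (VDv (VDv z) u v) (l u v) = GG z u v * nu2 u v.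
Proof.
  intros Duv. destruct (normal_l u v Duv) as [n1 n2].
  destruct (data u v Duv) as (_ & _ & <- & <- & <- & _ & _ & _).
  unfold geo_nu1, geo_nu2, geo_lambda. rewrite !mink_sigma by auto.
  unfold tx, ty; simpl. fold (e u v) (g u v).
  change (frame_l z u v) with (l u v).
  assert (He := e_pos u v Duv). assert (Hg := g_pos u v Duv).
  rewrite <- (e_sqr u v Duv), <- (g_sqr u v Duv).
  repeat split; field; lra.
Qed.

Lemma mixed_derivative_b u v : D (u, v) ->
  mink (VDv (VDu z) u v) (b u v) = e u v * g u v * mu u v.
Proof.
  intros Duv. destruct (normal_b u v Duv) as [n1 n2].
  destruct (data u v Duv) as (_ & _ & _ & _ & _ & <- & _ & _).
  unfold geo_mu. rewrite !mink_sigma by auto.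
  unfold tx, ty; simpl. fold (e u v) (g u v).
  assert (He := e_pos u v Duv). assert (Hg := g_pos u v Duv).
  field; lra.
Qed.

(** Collinearity of [sigma (z_u, z_u)] and [sigma (z_v, z_v)], orthogonality of
    [H] to [b] and [H <> 0] force both vectors to be orthogonal to [b]. *)
Lemma pure_derivatives_b u v : D (u, v) ->
  mink (VDu (VDu z) u v) (b u v) = 0 /\ mink (VDv (VDv z) u v) (b u v) = 0.
Proof.
  intros Duv.
  destruct (normal_b u v Duv) as [nb1 nb2]. destruct (normal_l u v Duv) as [nl1 nl2].
  destruct (second_derivatives_l u v Duv) as (l1 & _ & l2).
  assert (HE := EE_pos u v Duv). assert (HG := GG_pos u v Duv).
  assert (HF := FF_eq_0 u v Duv).
  assert (He := e_pos u v Duv). assert (Hg := g_pos u v Duv).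
  destruct (frame_on u v Duv) as (_ & _ & bb & ll & _ & _ & _ & _ & _ & bl).
  assert (Hb := mink_HH z u v (b u v) HE HG HF nb1 nb2).
  assert (Hl := mink_HH z u v (l u v) HE HG HF nl1 nl2).
  rewrite l1, l2 in Hl.
  set (k := - / sqrt (- mink (HH z u v) (HH z u v))) in *.
  assert (Hk : k <> 0).
  { unfold k. apply Ropp_neq_0_compat, Rinv_neq_0_compat, Rgt_not_eq, sqrt_lt_R0.
    specialize (timelike u v Duv). lra. }
  assert (lH : l u v = vscal k (HH z u v)) by reflexivity.
  assert (Hb0 : mink (HH z u v) (b u v) = 0).
  { apply Rmult_eq_reg_l with k; auto. rewrite <- mink_vscal_l, <- lH, mink_sym, bl.
    ring. }
  assert (Hl0 : k * mink (HH z u v) (l u v) = -1).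
  { now rewrite <- mink_vscal_l, <- lH. }
  assert (sum : nu1 u v + nu2 u v <> 0).
  { intros s. replace (/ 2 * _) with (/ 2 * (nu1 u v + nu2 u v)) in Hl
      by (field; lra).
    rewrite Hl, s in Hl0. lra. }
  assert (NF : normal_frame z u v (b u v) (l u v)).
  { unfold normal_frame. rewrite !(mink_sym (b u v) (VDu _ _ _)),
      !(mink_sym (b u v) (VDv _ _ _)), !(mink_sym (l u v) (VDu _ _ _)),
      !(mink_sym (l u v) (VDv _ _ _)).
    repeat split; auto. unfold positively_oriented.
    rewrite VDu_z, VDv_z, det4_vscal2 by auto.
    repeat apply Rmult_lt_0_compat; auto. now apply frame_det. }
  destruct (principal u v Duv) as [_ M0].
  specialize (M0 _ _ NF). unfold MM in M0.
  rewrite HF, Rmult_0_l, Rminus_0_r, sqrt_mult_alt, l1, l2 in M0 by lra.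
  fold (e u v) (g u v) in M0.
  apply Rmult_integral in M0. destruct M0 as [M0 | M0].
  { exfalso. apply (Rinv_neq_0_compat (e u v * g u v)); auto.
    apply Rgt_not_eq, Rmult_lt_0_compat; auto. }
  rewrite Hb in Hb0.
  set (p := mink (VDu (VDu z) u v) (b u v)) in *.
  set (q := mink (VDv (VDv z) u v) (b u v)) in *.
  assert (Hpq : p * GG z u v + q * EE z u v = 0).
  { apply Rmult_eq_reg_l with (/ 2 * / EE z u v * / GG z u v).
    - rewrite Rmult_0_r, <- Hb0. field. lra.
    - repeat apply Rmult_integral_contrapositive_currified;
      try apply Rinv_neq_0_compat; lra. }
  assert (Hp : p = 0).
  { apply Rmult_eq_reg_r with (GG z u v * (nu1 u v + nu2 u v)).
    - rewrite Rmult_0_l.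
      replace (p * (GG z u v * (nu1 u v + nu2 u v)))
        with (nu1 u v * (p * GG z u v + q * EE z u v)
              + (p * (GG z u v * nu2 u v) - EE z u v * nu1 u v * q)) by ring.
      rewrite Hpq, M0. ring.
    - apply Rmult_integral_contrapositive_currified; lra. }
  split; auto. rewrite Hp in Hpq.
  apply Rmult_eq_reg_r with (EE z u v); lra.
Qed.

Lemma Dv_e u v : D (u, v) -> Dv e u v = - gamma1 u v * e u v * g u v.
Proof.
  intros Duv. destruct (data u v Duv) as (<- & _).
  assert (He := e_pos u v Duv). assert (Hg := g_pos u v Duv).
  unfold geo_gamma1, dir, ty; simpl.
  change (fun s t => ln (sqrt (EE z s t))) with (fun s t => ln (e s t)).
  rewrite (Dv_ln D e) by (auto using smooth_e). fold (g u v). field. lra.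
Qed.

Lemma Du_g u v : D (u, v) -> Du g u v = - gamma2 u v * e u v * g u v.
Proof.
  intros Duv. destruct (data u v Duv) as (_ & <- & _).
  assert (He := e_pos u v Duv). assert (Hg := g_pos u v Duv).
  unfold geo_gamma2, dir, tx; simpl.
  change (fun s t => ln (sqrt (GG z s t))) with (fun s t => ln (g s t)).
  rewrite (Du_ln D g) by (auto using smooth_g). fold (e u v). field. lra.
Qed.

Lemma second_derivatives_tangent u v : D (u, v) ->
  mink (VDu (VDu z) u v) (VDv z u v)
    = gamma1 u v * e u v * e u v * g u v /\
  mink (VDv (VDv z) u v) (VDu z u v)
    = gamma2 u v * e u v * g u v * g u v.
Proof.
  intros Duv.
  assert (su := vsmooth_VDu D z sz). assert (sv := vsmooth_VDv D z sz).
  assert (E1 : Dv (EE z) u v = 2 * mink (VDv (VDu z) u v) (VDu z u v)).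
  { unfold EE. rewrite (Dv_mink D (VDu z) (VDu z)) by auto.
    rewrite (mink_sym (VDu z u v)). ring. }
  assert (E2 : Dv (EE z) u v = 2 * e u v * Dv e u v).
  { rewrite (Dv_ext_on D (EE z) (fun s t => e s t * e s t)); auto.
    - rewrite (Dv_mult D e e) by auto using smooth_e. ring.
    - intros; symmetry; now apply e_sqr. }
  assert (G1 : Du (GG z) u v = 2 * mink (VDu (VDv z) u v) (VDv z u v)).
  { unfold GG. rewrite (Du_mink D (VDv z) (VDv z)) by auto.
    rewrite (mink_sym (VDv z u v)). ring. }
  assert (G2 : Du (GG z) u v = 2 * g u v * Du g u v).
  { rewrite (Du_ext_on D (GG z) (fun s t => g s t * g s t)); auto.
    - rewrite (Du_mult D g g) by auto using smooth_g. ring.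
    - intros; symmetry; now apply g_sqr. }
  assert (F1 : Du (FF z) u v = 0).
  { rewrite (Du_ext_on D (FF z) (fun _ _ => 0)); auto using FF_eq_0.
    exact (Derive_const _ _). }
  assert (F2 : Dv (FF z) u v = 0).
  { rewrite (Dv_ext_on D (FF z) (fun _ _ => 0)); auto using FF_eq_0.
    exact (Derive_const _ _). }
  unfold FF in F1, F2. rewrite (Du_mink D (VDu z) (VDv z)) in F1 by auto.
  rewrite (Dv_mink D (VDu z) (VDv z)) in F2 by auto.
  rewrite Dv_e in E2 by auto. rewrite Du_g in G2 by auto.
  rewrite <- (VDv_VDu D oD) in F1, G1 by auto.
  rewrite (mink_sym (VDu z u v)) in F1, F2.
  split; lra.
Qed.

(** Differentiation of the ten orthonormality relations. Both partial derivatives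
    satisfy the two rules that are used here. *)
Lemma frame_derivative_relations (dif : (R -> R -> R) -> R -> R -> R)
    (vdif : (R -> R -> vec4) -> R -> R -> vec4) u v :
  (forall f c, (forall s t, D (s, t) -> f s t = c) -> dif f u v = 0) ->
  (forall p q, vsmooth_on D p -> vsmooth_on D q ->
     dif (fun s t => mink (p s t) (q s t)) u v
     = mink (vdif p u v) (q u v) + mink (p u v) (vdif q u v)) ->
  D (u, v) ->
  moving_frame (x u v) (y u v) (b u v) (l u v)
    (vdif x u v) (vdif y u v) (vdif b u v) (vdif l u v)
    (mink (vdif x u v) (y u v)) (mink (vdif x u v) (b u v))
    (mink (vdif x u v) (l u v)) (mink (vdif y u v) (b u v))
    (mink (vdif y u v) (l u v)) (mink (vdif b u v) (l u v)).
Proof.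
  intros const product Duv.
  assert (R : forall p q c, vsmooth_on D p -> vsmooth_on D q ->
     (forall s t, D (s, t) -> mink (p s t) (q s t) = c) ->
     mink (vdif p u v) (q u v) + mink (p u v) (vdif q u v) = 0).
  { intros p q c sp sq H. rewrite <- product by auto. now apply (const _ c). }
  assert (R' : forall p c, vsmooth_on D p ->
     (forall s t, D (s, t) -> mink (p s t) (p s t) = c) ->
     mink (vdif p u v) (p u v) = 0).
  { intros p c sp H. assert (E := R p p c sp sp H).
    rewrite (mink_sym (p u v)) in E. lra. }
  assert (sx := vsmooth_x). assert (sy := vsmooth_y).
  assert (sb := vsmooth_b). assert (sl := vsmooth_l).
  apply moving_frame_orthonormal.
  - now apply frame_on.
  - apply Rgt_not_eq. now apply frame_det.
  - apply (R' x 1); auto. intros s t Dst; apply (frame_on s t Dst).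
  - apply (R' y 1); auto. intros s t Dst; apply (frame_on s t Dst).
  - apply (R' b 1); auto. intros s t Dst; apply (frame_on s t Dst).
  - apply (R' l (-1)); auto. intros s t Dst; apply (frame_on s t Dst).
  - apply (R x y 0); auto. intros s t Dst; apply (frame_on s t Dst).
  - apply (R x b 0); auto. intros s t Dst; apply (frame_on s t Dst).
  - apply (R x l 0); auto. intros s t Dst; apply (frame_on s t Dst).
  - apply (R y b 0); auto. intros s t Dst; apply (frame_on s t Dst).
  - apply (R y l 0); auto. intros s t Dst; apply (frame_on s t Dst).
  - apply (R b l 0); auto. intros s t Dst; apply (frame_on s t Dst).
Qed.

Lemma frame_motion_u u v : D (u, v) ->
  frame_motion VDu x y b l u v (e u v * gamma1 u v) 0 (e u v * nu1 u v)
    (e u v * mu u v) (e u v * lambda u v) (e u v * beta1 u v).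
Proof.
  intros Duv.
  assert (M := frame_derivative_relations Du VDu u v).
  assert (su := vsmooth_VDu D z sz). assert (sv := vsmooth_VDv D z sz).
  assert (He := e_pos u v Duv). assert (Hg := g_pos u v Duv).
  assert (dx : forall n, mink (VDu z u v) n = 0 ->
            mink (VDu x u v) n = / e u v * mink (VDu (VDu z) u v) n).
  { intros n Hn. rewrite (VDu_ext_on D oD x (fun s t => vscal (/ e s t) (VDu z s t)));
      auto using frame_x_eq.
    rewrite (VDu_vscal D (fun s t => / e s t)) by auto using smooth_inv_e.
    rewrite mink_vadd_l, !mink_vscal_l, Hn. ring. }
  assert (dy : forall n, mink (VDv z u v) n = 0 ->
            mink (VDu y u v) n = / g u v * mink (VDv (VDu z) u v) n).
  { intros n Hn. rewrite (VDu_ext_on D oD y (fun s t => vscal (/ g s t) (VDv z s t)));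
      auto using frame_y_eq.
    rewrite (VDu_vscal D (fun s t => / g s t)) by auto using smooth_inv_g.
    rewrite (VDv_VDu D oD), mink_vadd_l, !mink_vscal_l, Hn by auto. ring. }
  destruct (normal_b u v Duv) as [nb1 nb2]. destruct (normal_l u v Duv) as [nl1 nl2].
  destruct (second_derivatives_l u v Duv) as (l1 & l2 & _).
  destruct (pure_derivatives_b u v Duv) as (b1 & _).
  rewrite <- (e_sqr u v Duv) in l1.
  unfold frame_motion.
  replace (e u v * gamma1 u v) with (mink (VDu x u v) (y u v)).
  2:{ rewrite dx.
      - rewrite frame_y_eq, mink_vscal_r, (proj1 (second_derivatives_tangent u v Duv)).
        field; lra.
      - rewrite VDu_z, mink_vscal_l by auto.
        destruct (frame_on u v Duv) as (_ & _ & _ & _ & -> & _). ring. }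
  replace 0 with (mink (VDu x u v) (b u v)) by (rewrite dx, b1 by auto; ring).
  replace (e u v * nu1 u v) with (mink (VDu x u v) (l u v))
    by (rewrite dx, l1 by auto; field; lra).
  replace (e u v * mu u v) with (mink (VDu y u v) (b u v))
    by (rewrite dy, mixed_derivative_b by auto; field; lra).
  replace (e u v * lambda u v) with (mink (VDu y u v) (l u v))
    by (rewrite dy, l2 by auto; field; lra).
  replace (e u v * beta1 u v) with (mink (VDu b u v) (l u v)).
  2:{ destruct (data u v Duv) as (_ & _ & _ & _ & _ & _ & <- & _).
      unfold geo_beta1, nabla, tx; simpl. fold (e u v).
      rewrite mink_vadd_l, !mink_vscal_l. change (frame_l z u v) with (l u v).
      field; lra. }
  apply M; auto.
  - intros f c Hf. rewrite (Du_ext_on D f (fun _ _ => c)); auto. exact (Derive_const _ _).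
  - intros p q sp sq. now apply (Du_mink D).
Qed.

Lemma frame_motion_v u v : D (u, v) ->
  frame_motion VDv x y b l u v (- (g u v * gamma2 u v)) (g u v * mu u v)
    (g u v * lambda u v) 0 (g u v * nu2 u v) (g u v * beta2 u v).
Proof.
  intros Duv.
  assert (M := frame_derivative_relations Dv VDv u v).
  assert (su := vsmooth_VDu D z sz). assert (sv := vsmooth_VDv D z sz).
  assert (He := e_pos u v Duv). assert (Hg := g_pos u v Duv).
  assert (dx : forall n, mink (VDu z u v) n = 0 ->
            mink (VDv x u v) n = / e u v * mink (VDv (VDu z) u v) n).
  { intros n Hn. rewrite (VDv_ext_on D oD x (fun s t => vscal (/ e s t) (VDu z s t)));
      auto using frame_x_eq.
    rewrite (VDv_vscal D (fun s t => / e s t)) by auto using smooth_inv_e.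
    rewrite mink_vadd_l, !mink_vscal_l, Hn. ring. }
  assert (dy : forall n, mink (VDv z u v) n = 0 ->
            mink (VDv y u v) n = / g u v * mink (VDv (VDv z) u v) n).
  { intros n Hn. rewrite (VDv_ext_on D oD y (fun s t => vscal (/ g s t) (VDv z s t)));
      auto using frame_y_eq.
    rewrite (VDv_vscal D (fun s t => / g s t)) by auto using smooth_inv_g.
    rewrite mink_vadd_l, !mink_vscal_l, Hn by auto. ring. }
  assert (product : forall p q, vsmooth_on D p -> vsmooth_on D q ->
     Dv (fun s t => mink (p s t) (q s t)) u v
     = mink (VDv p u v) (q u v) + mink (p u v) (VDv q u v)).
  { intros p q sp sq. now apply (Dv_mink D). }
  assert (const : forall f c, (forall s t, D (s, t) -> f s t = c) ->
            Dv f u v = 0).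
  { intros f c Hf. rewrite (Dv_ext_on D f (fun _ _ => c)); auto. exact (Derive_const _ _). }
  destruct (normal_b u v Duv) as [nb1 nb2]. destruct (normal_l u v Duv) as [nl1 nl2].
  destruct (second_derivatives_l u v Duv) as (_ & l1 & l2).
  destruct (pure_derivatives_b u v Duv) as (_ & b2).
  rewrite <- (g_sqr u v Duv) in l2.
  unfold frame_motion.
  replace (- (g u v * gamma2 u v)) with (mink (VDv x u v) (y u v)).
  2:{ assert (xy : Dv (fun s t => mink (x s t) (y s t)) u v = 0).
      { apply (const _ 0). intros s t Dst; apply (frame_on s t Dst). }
      rewrite product in xy by auto using vsmooth_x, vsmooth_y.
      rewrite (mink_sym (x u v)), dy in xy.
      - rewrite frame_x_eq, mink_vscal_r,
          (proj2 (second_derivatives_tangent u v Duv)) in xy.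
        replace (/ g u v * _) with (g u v * gamma2 u v) in xy by (field; lra). lra.
      - rewrite VDv_z, mink_vscal_l, (mink_sym (y u v)) by auto.
        destruct (frame_on u v Duv) as (_ & _ & _ & _ & -> & _). ring. }
  replace 0 with (mink (VDv y u v) (b u v)) by (rewrite dy, b2 by auto; ring).
  replace (g u v * nu2 u v) with (mink (VDv y u v) (l u v))
    by (rewrite dy, l2 by auto; field; lra).
  replace (g u v * mu u v) with (mink (VDv x u v) (b u v))
    by (rewrite dx, mixed_derivative_b by auto; field; lra).
  replace (g u v * lambda u v) with (mink (VDv x u v) (l u v))
    by (rewrite dx, l1 by auto; field; lra).
  replace (g u v * beta2 u v) with (mink (VDv b u v) (l u v)).
  2:{ destruct (data u v Duv) as (_ & _ & _ & _ & _ & _ & _ & <-).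
      unfold geo_beta2, nabla, ty; simpl. fold (g u v).
      rewrite mink_vadd_l, !mink_vscal_l. change (frame_l z u v) with (l u v).
      field; lra. }
  apply M; auto.
Qed.

Lemma mink_comb4_frame u v p q r s p' q' r' s' : D (u, v) ->
  mink (comb4 p q r s (x u v) (y u v) (b u v) (l u v))
       (comb4 p' q' r' s' (x u v) (y u v) (b u v) (l u v))
  = p * p' + q * q' + r * r' - s * s'.
Proof.
  intros Duv.
  destruct (frame_on u v Duv) as (xx & yy & bb & ll & xy & xb & xl & yb & yl & bl).
  rewrite mink_comb4_l, !(mink_sym _ (comb4 _ _ _ _ _ _ _ _)), !mink_comb4_l.
  rewrite (mink_sym (y u v) (x u v)), (mink_sym (b u v) (x u v)),
    (mink_sym (l u v) (x u v)), (mink_sym (b u v) (y u v)),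
    (mink_sym (l u v) (y u v)), (mink_sym (l u v) (b u v)).
  rewrite xx, yy, bb, ll, xy, xb, xl, yb, yl, bl. ring.
Qed.

(** The [b]-component of [x_uv = x_vu]. As [<x_u, b> = 0] and
    [<x_v, b> = sqrt G mu], both mixed derivatives are known up to products of
    first derivatives of the frame, and [(sqrt G)_u] is known as well. *)
Lemma codazzi_mu_u u v : smooth_on D mu -> D (u, v) ->
  Du mu u v = e u v * (2 * mu u v * gamma2 u v + nu1 u v * beta2 u v
                       - lambda u v * beta1 u v).
Proof.
  intros smu Duv.
  assert (sx := vsmooth_x). assert (sb := vsmooth_b).
  assert (xub : forall s t, D (s, t) -> mink (VDu x s t) (b s t) = 0).
  { intros s t Dst. destruct (frame_motion_u s t Dst) as (-> & _).
    destruct (frame_on s t Dst) as (_ & _ & _ & _ & _ & xb & _ & yb & _ & bl).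
    rewrite mink_comb4_l, xb, yb, (mink_sym (l s t)), bl. ring. }
  assert (xvb : forall s t, D (s, t) ->
            mink (VDv x s t) (b s t) = g s t * mu s t).
  { intros s t Dst. destruct (frame_motion_v s t Dst) as (-> & _).
    destruct (frame_on s t Dst) as (_ & _ & bb & _ & _ & xb & _ & yb & _ & bl).
    rewrite mink_comb4_l, xb, yb, bb, (mink_sym (l s t)), bl. ring. }
  assert (E1 : mink (VDv (VDu x) u v) (b u v) + mink (VDu x u v) (VDv b u v) = 0).
  { rewrite <- (Dv_mink D (VDu x) b) by auto using vsmooth_VDu.
    rewrite (Dv_ext_on D _ (fun _ _ => 0)); auto. exact (Derive_const _ _). }
  assert (E2 : mink (VDu (VDv x) u v) (b u v) + mink (VDv x u v) (VDu b u v)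
               = Du g u v * mu u v + g u v * Du mu u v).
  { rewrite <- (Du_mink D (VDv x) b) by auto using vsmooth_VDv.
    rewrite (Du_ext_on D _ (fun s t => g s t * mu s t)); auto.
    apply (Du_mult D); auto using smooth_g. }
  rewrite <- (VDv_VDu D oD) in E2 by auto.
  destruct (frame_motion_u u v Duv) as (Xu & _ & Bu & _).
  destruct (frame_motion_v u v Duv) as (Xv & _ & Bv & _).
  rewrite Xu, Bv, mink_comb4_frame in E1 by auto.
  rewrite Xv, Bu, mink_comb4_frame, Du_g in E2 by auto.
  apply Rmult_eq_reg_l with (g u v); [lra|].
  apply Rgt_not_eq. now apply g_pos.
Qed.

(** The [b]-component of [y_uv = y_vu], in the same way. *)
Lemma codazzi_mu_v u v : smooth_on D mu -> D (u, v) ->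
  Dv mu u v = g u v * (2 * mu u v * gamma1 u v - lambda u v * beta2 u v
                       + nu2 u v * beta1 u v).
Proof.
  intros smu Duv.
  assert (sy := vsmooth_y). assert (sb := vsmooth_b).
  assert (yvb : forall s t, D (s, t) -> mink (VDv y s t) (b s t) = 0).
  { intros s t Dst. destruct (frame_motion_v s t Dst) as (_ & -> & _).
    destruct (frame_on s t Dst) as (_ & _ & _ & _ & _ & xb & _ & yb & _ & bl).
    rewrite mink_comb4_l, xb, yb, (mink_sym (l s t)), bl. ring. }
  assert (yub : forall s t, D (s, t) ->
            mink (VDu y s t) (b s t) = e s t * mu s t).
  { intros s t Dst. destruct (frame_motion_u s t Dst) as (_ & -> & _).
    destruct (frame_on s t Dst) as (_ & _ & bb & _ & _ & xb & _ & yb & _ & bl).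
    rewrite mink_comb4_l, xb, yb, bb, (mink_sym (l s t)), bl. ring. }
  assert (E1 : mink (VDu (VDv y) u v) (b u v) + mink (VDv y u v) (VDu b u v) = 0).
  { rewrite <- (Du_mink D (VDv y) b) by auto using vsmooth_VDv.
    rewrite (Du_ext_on D _ (fun _ _ => 0)); auto. exact (Derive_const _ _). }
  assert (E2 : mink (VDv (VDu y) u v) (b u v) + mink (VDu y u v) (VDv b u v)
               = Dv e u v * mu u v + e u v * Dv mu u v).
  { rewrite <- (Dv_mink D (VDu y) b) by auto using vsmooth_VDu.
    rewrite (Dv_ext_on D _ (fun s t => e s t * mu s t)); auto.
    apply (Dv_mult D); auto using smooth_e. }
  rewrite <- (VDv_VDu D oD) in E1 by auto.
  destruct (frame_motion_u u v Duv) as (_ & Yu & Bu & _).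
  destruct (frame_motion_v u v Duv) as (_ & Yv & Bv & _).
  rewrite Yv, Bu, mink_comb4_frame in E1 by auto.
  rewrite Yu, Bv, mink_comb4_frame, Dv_e in E2 by auto.
  apply Rmult_eq_reg_l with (e u v); [lra|].
  apply Rgt_not_eq. now apply e_pos.
Qed.

End Surface_equations.

(** * The surface carried by a moving frame *)

(** Conversely, a surface with [z_u = e x] and [z_v = g y], for an orthonormal
    frame that moves with the prescribed coefficients, has that frame as its
    geometric frame. Here [e] and [g] play the part of [sqrt E] and [sqrt G]. *)
Section Surface_of_a_frame.

Variables (D : R * R -> Prop) (z x y b l : R -> R -> vec4).
Variables gamma1 gamma2 nu1 nu2 lambda mu beta1 beta2 e g : R -> R -> R.
Hypothesis oD : open D.
Hypothesis sx : vsmooth_on D x.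
Hypothesis sy : vsmooth_on D y.
Hypothesis se : smooth_on D e.
Hypothesis sg : smooth_on D g.
Hypothesis e_gt0 : forall u v, D (u, v) -> 0 < e u v.
Hypothesis g_gt0 : forall u v, D (u, v) -> 0 < g u v.
Hypothesis e_v : forall u v, D (u, v) -> Dv e u v = - gamma1 u v * e u v * g u v.
Hypothesis g_u : forall u v, D (u, v) -> Du g u v = - gamma2 u v * e u v * g u v.
Hypothesis nu_pos : forall u v, D (u, v) -> 0 < nu1 u v + nu2 u v.
Hypothesis z_u : forall u v, D (u, v) -> VDu z u v = vscal (e u v) (x u v).
Hypothesis z_v : forall u v, D (u, v) -> VDv z u v = vscal (g u v) (y u v).
Hypothesis orthonormal_D : forall u v, D (u, v) ->
  orthonormal (x u v) (y u v) (b u v) (l u v).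
Hypothesis det_D : forall u v, D (u, v) ->
  0 < det4 (x u v) (y u v) (b u v) (l u v).
Hypothesis motion_u : forall u v, D (u, v) ->
  frame_motion VDu x y b l u v (e u v * gamma1 u v) 0 (e u v * nu1 u v)
    (e u v * mu u v) (e u v * lambda u v) (e u v * beta1 u v).
Hypothesis motion_v : forall u v, D (u, v) ->
  frame_motion VDv x y b l u v (- (g u v * gamma2 u v)) (g u v * mu u v)
    (g u v * lambda u v) 0 (g u v * nu2 u v) (g u v * beta2 u v).

Lemma carried_EE u v : D (u, v) -> EE z u v = e u v * e u v.
Proof.
  intros Duv. unfold EE. rewrite z_u, mink_vscal_l, mink_vscal_r by auto.
  destruct (orthonormal_D u v Duv) as (-> & _). ring.
Qed.

Lemma carried_GG u v : D (u, v) -> GG z u v = g u v * g u v.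
Proof.
  intros Duv. unfold GG. rewrite z_v, mink_vscal_l, mink_vscal_r by auto.
  destruct (orthonormal_D u v Duv) as (_ & -> & _). ring.
Qed.

Lemma carried_FF u v : D (u, v) -> FF z u v = 0.
Proof.
  intros Duv. unfold FF. rewrite z_u, z_v, mink_vscal_l, mink_vscal_r by auto.
  destruct (orthonormal_D u v Duv) as (_ & _ & _ & _ & -> & _). ring.
Qed.

Lemma carried_root_EE u v : D (u, v) -> sqrt (EE z u v) = e u v.
Proof. intros Duv. rewrite carried_EE by auto. apply sqrt_square. left; auto. Qed.

Lemma carried_root_GG u v : D (u, v) -> sqrt (GG z u v) = g u v.
Proof. intros Duv. rewrite carried_GG by auto. apply sqrt_square. left; auto. Qed.

Lemma carried_EE_pos u v : D (u, v) -> 0 < EE z u v.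
Proof. intros Duv. rewrite carried_EE by auto. apply Rmult_lt_0_compat; auto. Qed.

Lemma carried_GG_pos u v : D (u, v) -> 0 < GG z u v.
Proof. intros Duv. rewrite carried_GG by auto. apply Rmult_lt_0_compat; auto. Qed.

Lemma carried_spacelike : spacelike_on z D.
Proof.
  intros u v Duv. split; [now apply carried_EE_pos|].
  rewrite (carried_FF u v Duv), Rmult_0_l, Rminus_0_r.
  apply Rmult_lt_0_compat; [now apply carried_EE_pos | now apply carried_GG_pos].
Qed.

Lemma carried_frame_x u v : D (u, v) -> frame_x z u v = x u v.
Proof.
  intros Duv. unfold frame_x, tangent, tx. rewrite carried_root_EE, z_u by auto.
  assert (H := e_gt0 u v Duv). apply vec4_ext; simpl; field; lra.
Qed.

Lemma carried_frame_y u v : D (u, v) -> frame_y z u v = y u v.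
Proof.
  intros Duv. unfold frame_y, tangent, ty. rewrite carried_root_GG, z_v by auto.
  assert (H := g_gt0 u v Duv). apply vec4_ext; simpl; field; lra.
Qed.

Lemma carried_z_uu u v n : D (u, v) -> mink (x u v) n = 0 -> mink (y u v) n = 0 ->
  mink (VDu (VDu z) u v) n = - (EE z u v * nu1 u v * mink (l u v) n).
Proof.
  intros Duv nx ny.
  rewrite (VDu_ext_on D oD (VDu z) (fun s t => vscal (e s t) (x s t))) by auto.
  rewrite (VDu_vscal D e x), mink_vadd_l, !mink_vscal_l by auto.
  destruct (motion_u u v Duv) as (-> & _).
  rewrite mink_comb4_l, nx, ny, carried_EE by auto. ring.
Qed.

Lemma carried_z_vv u v n : D (u, v) -> mink (x u v) n = 0 -> mink (y u v) n = 0 ->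
  mink (VDv (VDv z) u v) n = - (GG z u v * nu2 u v * mink (l u v) n).
Proof.
  intros Duv nx ny.
  rewrite (VDv_ext_on D oD (VDv z) (fun s t => vscal (g s t) (y s t))) by auto.
  rewrite (VDv_vscal D g y), mink_vadd_l, !mink_vscal_l by auto.
  destruct (motion_v u v Duv) as (_ & -> & _).
  rewrite mink_comb4_l, nx, ny, carried_GG by auto. ring.
Qed.

Lemma carried_z_uv u v n : D (u, v) -> mink (x u v) n = 0 -> mink (y u v) n = 0 ->
  mink (VDv (VDu z) u v) n
  = e u v * g u v * (mu u v * mink (b u v) n - lambda u v * mink (l u v) n).
Proof.
  intros Duv nx ny.
  rewrite (VDv_ext_on D oD (VDu z) (fun s t => vscal (e s t) (x s t))) by auto.
  rewrite (VDv_vscal D e x), mink_vadd_l, !mink_vscal_l by auto.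
  destruct (motion_v u v Duv) as (-> & _).
  rewrite mink_comb4_l, nx, ny. ring.
Qed.

Lemma carried_normal u v n : D (u, v) -> mink (x u v) n = 0 -> mink (y u v) n = 0 ->
  mink (VDu z u v) n = 0 /\ mink (VDv z u v) n = 0.
Proof.
  intros Duv nx ny. rewrite z_u, z_v, !mink_vscal_l, nx, ny by auto. split; ring.
Qed.

(** [H] is determined by its products with the orthonormal frame, of which only the
    one with [l] is not zero. *)
Lemma carried_HH u v : D (u, v) ->
  HH z u v = vscal (- ((nu1 u v + nu2 u v) / 2)) (l u v).
Proof.
  intros Duv.
  assert (ON := orthonormal_D u v Duv). assert (Hd := det_D u v Duv).
  assert (HE := carried_EE_pos u v Duv). assert (HG := carried_GG_pos u v Duv).
  assert (HF := carried_FF u v Duv).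
  assert (He := e_gt0 u v Duv). assert (Hg := g_gt0 u v Duv).
  destruct (carried_spacelike u v Duv) as [_ HW].
  rewrite (orthonormal_expansion _ _ _ _ (HH z u v) ON ltac:(lra)).
  destruct ON as (xx & yy & bb & ll & xy & xb & xl & yb & yl & bl).
  assert (T : mink (HH z u v) (VDu z u v) = 0 /\ mink (HH z u v) (VDv z u v) = 0).
  { unfold HH. rewrite !mink_vscal_l, !mink_vadd_l.
    split.
    - rewrite !(fun X Y => proj1 (sigma_orthogonal z u v X Y ltac:(lra))). ring.
    - rewrite !(fun X Y => proj2 (sigma_orthogonal z u v X Y ltac:(lra))). ring. }
  rewrite z_u, z_v, !mink_vscal_r in T by auto. destruct T as [T1 T2].
  assert (Hx : mink (HH z u v) (x u v) = 0)
    by (apply Rmult_eq_reg_l with (e u v); lra).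
  assert (Hy : mink (HH z u v) (y u v) = 0)
    by (apply Rmult_eq_reg_l with (g u v); lra).
  assert (Hb : mink (HH z u v) (b u v) = 0).
  { destruct (carried_normal u v _ Duv xb yb). rewrite mink_HH by auto.
    rewrite carried_z_uu, carried_z_vv, (mink_sym (l u v)), bl by auto.
    field; lra. }
  assert (Hl : mink (HH z u v) (l u v) = (nu1 u v + nu2 u v) / 2).
  { destruct (carried_normal u v _ Duv xl yl). rewrite mink_HH by auto.
    rewrite carried_z_uu, carried_z_vv, ll by auto. field; lra. }
  rewrite Hx, Hy, Hb, Hl. apply vec4_ext; simpl; ring.
Qed.

Lemma carried_HH_square u v : D (u, v) ->
  - mink (HH z u v) (HH z u v) = Rsqr ((nu1 u v + nu2 u v) / 2).
Proof.
  intros Duv. rewrite carried_HH, mink_vscal_l, mink_vscal_r by auto.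
  destruct (orthonormal_D u v Duv) as (_ & _ & _ & -> & _). unfold Rsqr. ring.
Qed.

Lemma carried_timelike : timelike_H_on z D.
Proof.
  intros u v Duv. assert (E := carried_HH_square u v Duv).
  assert (H := nu_pos u v Duv).
  assert (0 < Rsqr ((nu1 u v + nu2 u v) / 2)) by (apply Rsqr_pos_lt; lra). lra.
Qed.

(** Here the sign of [nu1 + nu2] matters: for a negative sum the result would
    be [- l]. *)
Lemma carried_frame_l u v : D (u, v) -> frame_l z u v = l u v.
Proof.
  intros Duv. assert (H := nu_pos u v Duv). unfold frame_l.
  rewrite carried_HH_square, sqrt_Rsqr, carried_HH by (auto; lra).
  apply vec4_ext; simpl; field; lra.
Qed.

Lemma carried_principal : principal_on z D.
Proof.
  intros u v Duv. split; [now apply carried_FF|].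
  intros n1 n2 (n1u & n1v & n2u & n2v & _).
  assert (He := e_gt0 u v Duv). assert (Hg := g_gt0 u v Duv).
  rewrite mink_sym, z_u, mink_vscal_l in n1u, n2u by auto.
  rewrite mink_sym, z_v, mink_vscal_l in n1v, n2v by auto.
  apply Rmult_integral in n1u, n2u, n1v, n2v.
  destruct n1u as [|n1u]; [lra|]. destruct n2u as [|n2u]; [lra|].
  destruct n1v as [|n1v]; [lra|]. destruct n2v as [|n2v]; [lra|].
  unfold MM. rewrite !carried_z_uu, !carried_z_vv by auto. ring.
Qed.

Lemma carried_data u v : D (u, v) ->
  geo_gamma1 z u v = gamma1 u v /\ geo_gamma2 z u v = gamma2 u v /\
  geo_nu1 z u v = nu1 u v /\ geo_nu2 z u v = nu2 u v /\
  geo_lambda z u v = lambda u v /\ geo_mu z b u v = mu u v /\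
  geo_beta1 z b u v = beta1 u v /\ geo_beta2 z b u v = beta2 u v.
Proof.
  intros Duv.
  assert (He := e_gt0 u v Duv). assert (Hg := g_gt0 u v Duv).
  destruct (orthonormal_D u v Duv)
    as (xx & yy & bb & ll & xy & xb & xl & yb & yl & bl).
  destruct (carried_normal u v _ Duv xl yl) as [nl1 nl2].
  destruct (carried_normal u v _ Duv xb yb) as [nb1 nb2].
  unfold geo_gamma1, geo_gamma2, geo_nu1, geo_nu2, geo_lambda, geo_mu, geo_beta1,
    geo_beta2, nabla, dir.
  rewrite !carried_frame_l, !mink_sigma by auto.
  rewrite !mink_vadd_l, !mink_vscal_l.
  rewrite !carried_z_uu, !carried_z_vv, !carried_z_uv by auto.
  rewrite carried_EE, carried_GG, ll, bb, bl, (mink_sym (l u v)), bl by auto.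
  unfold tx, ty; cbn [fst snd]. rewrite carried_root_EE, carried_root_GG by auto.
  rewrite (Dv_ext_on D (fun s t => ln (sqrt (EE z s t))) (fun s t => ln (e s t)))
    by (auto; intros; now rewrite carried_root_EE).
  rewrite (Du_ext_on D (fun s t => ln (sqrt (GG z s t))) (fun s t => ln (g s t)))
    by (auto; intros; now rewrite carried_root_GG).
  rewrite (Dv_ln D e), (Du_ln D g), e_v, g_u by auto.
  destruct (motion_u u v Duv) as (_ & _ & -> & _).
  destruct (motion_v u v Duv) as (_ & _ & -> & _).
  rewrite !mink_comb4_l, xl, yl, bl, ll.
  repeat split; field; lra.
Qed.

End Surface_of_a_frame.

(** * Integrability of the frame equations *)

(** Coefficients for the unknowns in the order [z, x, y, b, l]: the first row holds
    the derivative of [z], and the other rows are those of [moving_frame]. *)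
Definition frame_matrix (zx zy xy xb xl yb yl bl : R -> R -> R) (i j : nat) :
    R -> R -> R :=
  match i, j with
  | 0%nat, 1%nat => zx | 0%nat, 2%nat => zy
  | 1%nat, 2%nat => xy | 1%nat, 3%nat => xb | 1%nat, 4%nat => fun u v => - xl u v
  | 2%nat, 1%nat => fun u v => - xy u v | 2%nat, 3%nat => yb
  | 2%nat, 4%nat => fun u v => - yl u v
  | 3%nat, 1%nat => fun u v => - xb u v | 3%nat, 2%nat => fun u v => - yb u v
  | 3%nat, 4%nat => fun u v => - bl u v
  | 4%nat, 1%nat => fun u v => - xl u v | 4%nat, 2%nat => fun u v => - yl u v
  | 4%nat, 3%nat => fun u v => - bl u v
  | _, _ => fun _ _ => 0
  end.

Lemma smooth_frame_matrix D zx zy xy xb xl yb yl bl i j :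
  open D -> smooth_on D zx -> smooth_on D zy -> smooth_on D xy ->
  smooth_on D xb -> smooth_on D xl -> smooth_on D yb -> smooth_on D yl ->
  smooth_on D bl -> smooth_on D (frame_matrix zx zy xy xb xl yb yl bl i j).
Proof.
  intros. destruct i as [|[|[|[|[|i]]]]], j as [|[|[|[|[|j]]]]]; simpl;
  auto using smooth_const, smooth_opp.
Qed.

Lemma Du_opp f u v : Du (fun s t => - f s t) u v = - Du f u v.
Proof. exact (Derive_opp (fun s => f s v) u). Qed.

Lemma Dv_opp f u v : Dv (fun s t => - f s t) u v = - Dv f u v.
Proof. exact (Derive_opp (fun t => f u t) v). Qed.

Lemma Du_const c u v : Du (fun _ _ => c) u v = 0.
Proof. exact (Derive_const c u). Qed.

Lemma Dv_const c u v : Dv (fun _ _ => c) u v = 0.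
Proof. exact (Derive_const c v). Qed.

(** Row [z] is the condition [z_uv = z_vu], hence the equations for the derivatives
    of [e] and [g]. The entry [(x, y)] is the Gauss equation, [(x, b)] and
    [(y, b)] are the Codazzi equations for [mu], [(x, l)] and [(y, l)] the other
    two Codazzi equations, and [(b, l)] is the Ricci equation. The remaining
    entries are identities or repeat these up to sign. *)
Lemma frame_equations_integrable (D : R * R -> Prop)
    (e g gamma1 gamma2 nu1 nu2 lambda mu beta1 beta2 : R -> R -> R) u v
    (A := frame_matrix e (fun _ _ => 0) (fun u v => e u v * gamma1 u v)
            (fun _ _ => 0) (fun u v => e u v * nu1 u v) (fun u v => e u v * mu u v)
            (fun u v => e u v * lambda u v) (fun u v => e u v * beta1 u v))
    (B := frame_matrix (fun _ _ => 0) g (fun u v => - (g u v * gamma2 u v))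
            (fun u v => g u v * mu u v) (fun u v => g u v * lambda u v)
            (fun _ _ => 0) (fun u v => g u v * nu2 u v)
            (fun u v => g u v * beta2 u v)) :
  smooth_on D e -> smooth_on D g -> smooth_on D gamma1 -> smooth_on D gamma2 ->
  smooth_on D nu1 -> smooth_on D nu2 -> smooth_on D lambda -> smooth_on D mu ->
  smooth_on D beta1 -> smooth_on D beta2 -> D (u, v) ->
  0 < e u v -> 0 < g u v ->
  Dv e u v = - gamma1 u v * e u v * g u v ->
  Du g u v = - gamma2 u v * e u v * g u v ->
  Du mu u v = e u v * (2 * mu u v * gamma2 u v + nu1 u v * beta2 u v
                       - lambda u v * beta1 u v) ->
  Dv mu u v = g u v * (2 * mu u v * gamma1 u v - lambda u v * beta2 u v
                       + nu2 u v * beta1 u v) ->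
  - nu1 u v * nu2 u v + lambda u v ^ 2 - mu u v ^ 2 =
    1 / e u v * Du gamma2 u v + 1 / g u v * Dv gamma1 u v
    - (gamma1 u v ^ 2 + gamma2 u v ^ 2) ->
  2 * lambda u v * gamma2 u v - mu u v * beta1 u v
    - (nu1 u v - nu2 u v) * gamma1 u v =
    1 / e u v * Du lambda u v - 1 / g u v * Dv nu1 u v ->
  2 * lambda u v * gamma1 u v - mu u v * beta2 u v
    + (nu1 u v - nu2 u v) * gamma2 u v =
    - (1 / e u v) * Du nu2 u v + 1 / g u v * Dv lambda u v ->
  gamma1 u v * beta1 u v - gamma2 u v * beta2 u v
    - (nu1 u v - nu2 u v) * mu u v =
    - (1 / e u v) * Du beta2 u v + 1 / g u v * Dv beta1 u v ->
  forall i k, (i <= 4)%nat -> (k <= 4)%nat ->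
    Dv (A i k) u v + sum_f_R0 (fun j => A i j u v * B j k u v) 4
    = Du (B i k) u v + sum_f_R0 (fun j => B i j u v * A j k u v) 4.
Proof.
  intros se sg s1 s2 s3 s4 s5 s6 s7 s8 Duv He Hg ev gu muu muv gauss cod1 cod2
    ricci i k Hi Hk.
  (* Without denominators the equations are linear in the derivatives of the
     geometric functions, as are the entries to be compared. *)
  apply (f_equal (Rmult (e u v * g u v))) in gauss, cod1, cod2, ricci.
  replace (e u v * g u v * (1 / e u v * _ + 1 / g u v * _ - _))
    with (g u v * Du gamma2 u v + e u v * Dv gamma1 u v
          - e u v * g u v * (gamma1 u v ^ 2 + gamma2 u v ^ 2)) in gauss
    by (field; lra).
  replace (e u v * g u v * (1 / e u v * _ - 1 / g u v * _))
    with (g u v * Du lambda u v - e u v * Dv nu1 u v) in cod1 by (field; lra).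
  replace (e u v * g u v * (- (1 / e u v) * _ + 1 / g u v * _))
    with (- (g u v * Du nu2 u v) + e u v * Dv lambda u v) in cod2 by (field; lra).
  replace (e u v * g u v * (- (1 / e u v) * _ + 1 / g u v * _))
    with (- (g u v * Du beta2 u v) + e u v * Dv beta1 u v) in ricci
    by (field; lra).
  unfold A, B. clear A B.
  destruct i as [|[|[|[|[|i]]]]], k as [|[|[|[|[|k]]]]]; try lia; simpl;
  rewrite ?Du_opp, ?Dv_opp, ?Du_const, ?Dv_const;
  rewrite ?(Du_mult D) by auto; rewrite ?(Dv_mult D) by auto;
  rewrite ?ev, ?gu, ?muu, ?muv; lra.
Qed.

Lemma VDu_mk4 (f1 f2 f3 f4 : R -> R -> R) u v d1 d2 d3 d4 :
  is_derive (fun s => f1 s v) u d1 -> is_derive (fun s => f2 s v) u d2 ->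
  is_derive (fun s => f3 s v) u d3 -> is_derive (fun s => f4 s v) u d4 ->
  VDu (fun s t => mk4 (f1 s t) (f2 s t) (f3 s t) (f4 s t)) u v = mk4 d1 d2 d3 d4.
Proof.
  intros. apply vec4_ext; now apply is_derive_unique.
Qed.

Lemma VDv_mk4 (f1 f2 f3 f4 : R -> R -> R) u v d1 d2 d3 d4 :
  is_derive (fun t => f1 u t) v d1 -> is_derive (fun t => f2 u t) v d2 ->
  is_derive (fun t => f3 u t) v d3 -> is_derive (fun t => f4 u t) v d4 ->
  VDv (fun s t => mk4 (f1 s t) (f2 s t) (f3 s t) (f4 s t)) u v = mk4 d1 d2 d3 d4.
Proof.
  intros. apply vec4_ext; now apply is_derive_unique.
Qed.

Lemma linear_frobenius_vec4 (D : R * R -> Prop) N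
    (A B : nat -> nat -> R -> R -> R) u0 v0 :
  open D -> D (u0, v0) ->
  (forall i j, (i <= N)%nat -> (j <= N)%nat -> smooth_on D (A i j)) ->
  (forall i j, (i <= N)%nat -> (j <= N)%nat -> smooth_on D (B i j)) ->
  (forall i k u v, (i <= N)%nat -> (k <= N)%nat -> D (u, v) ->
     Dv (A i k) u v + sum_f_R0 (fun j => A i j u v * B j k u v) N
     = Du (B i k) u v + sum_f_R0 (fun j => B i j u v * A j k u v) N) ->
  exists d, 0 < d /\ (forall p, square u0 v0 d p -> D p) /\
    forall w0 : nat -> vec4, exists w : nat -> R -> R -> vec4,
      (forall i, (i <= N)%nat -> w i u0 v0 = w0 i) /\
      (forall i, (i <= N)%nat -> vsmooth_on (square u0 v0 d) (w i)) /\
      (forall i u v, (i <= N)%nat -> square u0 v0 d (u, v) ->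
         VDu (w i) u v = mk4 (lin N (A i) (fun j s t => c1 (w j s t)) u v)
                             (lin N (A i) (fun j s t => c2 (w j s t)) u v)
                             (lin N (A i) (fun j s t => c3 (w j s t)) u v)
                             (lin N (A i) (fun j s t => c4 (w j s t)) u v)) /\
      (forall i u v, (i <= N)%nat -> square u0 v0 d (u, v) ->
         VDv (w i) u v = mk4 (lin N (B i) (fun j s t => c1 (w j s t)) u v)
                             (lin N (B i) (fun j s t => c2 (w j s t)) u v)
                             (lin N (B i) (fun j s t => c3 (w j s t)) u v)
                             (lin N (B i) (fun j s t => c4 (w j s t)) u v)).
Proof.
  intros oD D0 SA SB int.
  destruct (linear_frobenius D N A B u0 v0 oD D0 SA SB int) as (d & Hd & sub & sol).
  exists d. split; auto. split; auto. intros w0.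
  destruct (sol (fun i => c1 (w0 i))) as (Y1 & i1 & S1 & U1 & V1).
  destruct (sol (fun i => c2 (w0 i))) as (Y2 & i2 & S2 & U2 & V2).
  destruct (sol (fun i => c3 (w0 i))) as (Y3 & i3 & S3 & U3 & V3).
  destruct (sol (fun i => c4 (w0 i))) as (Y4 & i4 & S4 & U4 & V4).
  exists (fun i u v => mk4 (Y1 i u v) (Y2 i u v) (Y3 i u v) (Y4 i u v)).
  split; [|split; [|split]].
  - intros i Hi. apply vec4_ext; simpl; auto.
  - intros i Hi. split; [|split; [|split]]; simpl.
    + now apply S1. + now apply S2. + now apply S3. + now apply S4.
  - intros i u v Hi Hq. apply VDu_mk4; simpl;
    [apply U1 | apply U2 | apply U3 | apply U4]; auto.
  - intros i u v Hi Hq. apply VDv_mk4; simpl;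
    [apply V1 | apply V2 | apply V3 | apply V4]; auto.
Qed.

(** * Surfaces with adapted frames *)

Section Adapted_frames.

Variables gamma1 gamma2 nu1 nu2 lambda mu beta1 beta2 : R -> R -> R.

(** The form of the frame equations that holds both for the integrated solution
    and for a given surface with its geometric frame. *)
Definition adapted_frame (D : R * R -> Prop) (e g : R -> R -> R)
    (z x y b l : R -> R -> vec4) : Prop :=
  (vsmooth_on D z /\ vsmooth_on D x /\ vsmooth_on D y /\ vsmooth_on D b /\
   vsmooth_on D l) /\
  forall u v, D (u, v) ->
    VDu z u v = vscal (e u v) (x u v) /\ VDv z u v = vscal (g u v) (y u v) /\
    frame_motion VDu x y b l u v (e u v * gamma1 u v) 0 (e u v * nu1 u v)
      (e u v * mu u v) (e u v * lambda u v) (e u v * beta1 u v) /\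
    frame_motion VDv x y b l u v (- (g u v * gamma2 u v)) (g u v * mu u v)
      (g u v * lambda u v) 0 (g u v * nu2 u v) (g u v * beta2 u v).

Lemma adapted_frame_ext D e g e' g' z x y b l :
  (forall u v, D (u, v) -> e' u v = e u v /\ g' u v = g u v) ->
  adapted_frame D e g z x y b l -> adapted_frame D e' g' z x y b l.
Proof.
  intros H [S F]. split; auto. intros u v Duv.
  destruct (H u v Duv) as [-> ->]. now apply F.
Qed.

Lemma adapted_frames_pairing u0 v0 d e g z x y b l z' x' y' b' l' w w' u v
    (Q := square u0 v0 d) :
  adapted_frame Q e g z x y b l -> adapted_frame Q e g z' x' y' b' l' ->
  Q (u, v) ->
  mink (coords (x u v) (y u v) (b u v) (l u v) w)
       (coords (x' u v) (y' u v) (b' u v) (l' u v) w')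
  = mink (coords (x u0 v0) (y u0 v0) (b u0 v0) (l u0 v0) w)
         (coords (x' u0 v0) (y' u0 v0) (b' u0 v0) (l' u0 v0) w').
Proof.
  intros [(_ & sx & sy & sb & sl) F] [(_ & sx' & sy' & sb' & sl') F'] Hq.
  apply (comoving_frames_pairing_constant u0 v0 d x y b l sx sy sb sl
    (fun u v => e u v * gamma1 u v) (fun _ _ => 0) (fun u v => e u v * nu1 u v)
    (fun u v => e u v * mu u v) (fun u v => e u v * lambda u v)
    (fun u v => e u v * beta1 u v)
    (fun u v => - (g u v * gamma2 u v)) (fun u v => g u v * mu u v)
    (fun u v => g u v * lambda u v) (fun _ _ => 0) (fun u v => g u v * nu2 u v)
    (fun u v => g u v * beta2 u v)); auto; intros s t Hst;
  [apply (F s t Hst) | apply (F s t Hst) | apply (F' s t Hst) | apply (F' s t Hst)].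
Qed.

Lemma adapted_frame_orthonormal u0 v0 d e g z x y b l u v (Q := square u0 v0 d) :
  adapted_frame Q e g z x y b l ->
  orthonormal (x u0 v0) (y u0 v0) (b u0 v0) (l u0 v0) ->
  0 < det4 (x u0 v0) (y u0 v0) (b u0 v0) (l u0 v0) ->
  Q (u, v) ->
  orthonormal (x u v) (y u v) (b u v) (l u v) /\
  0 < det4 (x u v) (y u v) (b u v) (l u v).
Proof.
  intros AF ON Hd Hq.
  assert (Hd' : 0 < det4 (x u v) (y u v) (b u v) (l u v)).
  { destruct AF as [(_ & sx & sy & sb & sl) F].
    rewrite (moving_frame_det_constant u0 v0 d x y b l sx sy sb sl
      (fun u v => e u v * gamma1 u v) (fun _ _ => 0) (fun u v => e u v * nu1 u v)
      (fun u v => e u v * mu u v) (fun u v => e u v * lambda u v)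
      (fun u v => e u v * beta1 u v)
      (fun u v => - (g u v * gamma2 u v)) (fun u v => g u v * mu u v)
      (fun u v => g u v * lambda u v) (fun _ _ => 0) (fun u v => g u v * nu2 u v)
      (fun u v => g u v * beta2 u v)); auto; intros s t Hst; apply (F s t Hst). }
  split; auto. apply parseval_orthonormal; [lra|]. intros w w'.
  rewrite (adapted_frames_pairing u0 v0 d e g z x y b l z x y b l) by auto.
  apply orthonormal_parseval; auto; lra.
Qed.

Lemma adapted_frames_unique u0 v0 d e g z x y b l z' x' y' b' l' u v
    (Q := square u0 v0 d) :
  adapted_frame Q e g z x y b l -> adapted_frame Q e g z' x' y' b' l' ->
  orthonormal (x u0 v0) (y u0 v0) (b u0 v0) (l u0 v0) ->
  0 < det4 (x u0 v0) (y u0 v0) (b u0 v0) (l u0 v0) ->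
  z' u0 v0 = z u0 v0 -> x' u0 v0 = x u0 v0 -> y' u0 v0 = y u0 v0 ->
  b' u0 v0 = b u0 v0 -> l' u0 v0 = l u0 v0 ->
  Q (u, v) -> z' u v = z u v.
Proof.
  intros AF AF' ON Hd z0 x0 y0 b0 l0 Hq.
  assert (E : forall s t, Q (s, t) -> x' s t = x s t /\ y' s t = y s t /\
                          b' s t = b s t /\ l' s t = l s t).
  { intros s t Hst.
    destruct (adapted_frame_orthonormal u0 v0 d e g z x y b l s t AF ON Hd Hst)
      as [ON' _].
    apply parseval_unique; auto. intros w w'.
    rewrite (adapted_frames_pairing u0 v0 d e g z x y b l z' x' y' b' l') by auto.
    rewrite x0, y0, b0, l0. apply orthonormal_parseval; auto; lra. }
  destruct AF as [(sz & _) F]. destruct AF' as [(sz' & _) F'].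
  assert (Ez : forall s t, Q (s, t) ->
            VDu z' s t = VDu z s t /\ VDv z' s t = VDv z s t).
  { intros s t Hst. destruct (E s t Hst) as (Ex & Ey & _).
    destruct (F s t Hst) as (-> & -> & _). destruct (F' s t Hst) as (-> & -> & _).
    now rewrite Ex, Ey. }
  assert (C : forall c : vec4 -> R,
    smooth_on Q (fun s t => c (z s t)) -> smooth_on Q (fun s t => c (z' s t)) ->
    (forall s t, Q (s, t) -> Du (fun s t => c (z' s t)) s t
                             = Du (fun s t => c (z s t)) s t) ->
    (forall s t, Q (s, t) -> Dv (fun s t => c (z' s t)) s t
                             = Dv (fun s t => c (z s t)) s t) ->
    c (z' u v) = c (z u v)).
  { intros c sc sc' cu cv. apply Rminus_diag_uniq.
    rewrite (constant_on_square (fun s t => c (z' s t) - c (z s t)) u0 v0 d u v);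
      auto.
    - rewrite z0. ring.
    - intros s t Hst. replace 0 with (Du (fun s t => c (z' s t)) s t
                                      - Du (fun s t => c (z s t)) s t)
        by (rewrite cu; auto; ring).
      apply (is_derive_minus (fun s => c (z' s t)) (fun s => c (z s t)));
      [apply (smooth_is_derive_u Q (fun s t => c (z' s t)))
      |apply (smooth_is_derive_u Q (fun s t => c (z s t)))]; auto.
    - intros s t Hst. replace 0 with (Dv (fun s t => c (z' s t)) s t
                                      - Dv (fun s t => c (z s t)) s t)
        by (rewrite cv; auto; ring).
      apply (is_derive_minus (fun t => c (z' s t)) (fun t => c (z s t)));
      [apply (smooth_is_derive_v Q (fun s t => c (z' s t)))
      |apply (smooth_is_derive_v Q (fun s t => c (z s t)))]; auto. }
  destruct sz as (sz1 & sz2 & sz3 & sz4). destruct sz' as (sz1' & sz2' & sz3' & sz4').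
  apply vec4_ext; apply C; auto; intros s t Hst; destruct (Ez s t Hst) as [Eu Ev].
  - exact (f_equal c1 Eu). - exact (f_equal c1 Ev).
  - exact (f_equal c2 Eu). - exact (f_equal c2 Ev).
  - exact (f_equal c3 Eu). - exact (f_equal c3 Ev).
  - exact (f_equal c4 Eu). - exact (f_equal c4 Ev).
Qed.

Lemma adapted_frame_surface D e g z x y b l u0 v0 :
  open D -> adapted_frame D e g z x y b l ->
  smooth_on D e -> smooth_on D g ->
  (forall u v, D (u, v) -> 0 < e u v) -> (forall u v, D (u, v) -> 0 < g u v) ->
  (forall u v, D (u, v) -> Dv e u v = - gamma1 u v * e u v * g u v) ->
  (forall u v, D (u, v) -> Du g u v = - gamma2 u v * e u v * g u v) ->
  (forall u v, D (u, v) -> 0 < nu1 u v + nu2 u v) ->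
  (forall u v, D (u, v) -> orthonormal (x u v) (y u v) (b u v) (l u v)) ->
  (forall u v, D (u, v) -> 0 < det4 (x u v) (y u v) (b u v) (l u v)) ->
  D (u0, v0) ->
  surface_with_data D gamma1 gamma2 nu1 nu2 lambda mu beta1 beta2 u0 v0
    (z u0 v0) (x u0 v0) (y u0 v0) (b u0 v0) (l u0 v0) z.
Proof.
  intros oD [(sz & sx & sy & sb & sl) F] se sg He Hg ev gu Hnu ON Hd D0.
  assert (zu : forall u v, D (u, v) -> VDu z u v = vscal (e u v) (x u v))
    by (intros; now apply F).
  assert (zv : forall u v, D (u, v) -> VDv z u v = vscal (g u v) (y u v))
    by (intros; now apply F).
  assert (fu := fun u v Duv => proj1 (proj2 (proj2 (F u v Duv)))).
  assert (fv := fun u v Duv => proj2 (proj2 (proj2 (F u v Duv)))).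
  assert (fx : forall u v, D (u, v) -> frame_x z u v = x u v)
    by exact (carried_frame_x D z x y b l e He zu ON).
  assert (fy : forall u v, D (u, v) -> frame_y z u v = y u v)
    by exact (carried_frame_y D z x y b l g Hg zv ON).
  assert (fl : forall u v, D (u, v) -> frame_l z u v = l u v)
    by exact (carried_frame_l D z x y b l gamma1 gamma2 nu1 nu2 lambda mu beta1
                beta2 e g oD sx sy se sg He Hg Hnu zu zv ON Hd fu fv).
  split; auto. split; [exact (carried_spacelike D z x y b l e g He Hg zu zv ON)|].
  split.
  { exact (carried_timelike D z x y b l gamma1 gamma2 nu1 nu2 lambda mu beta1
             beta2 e g oD sx sy se sg He Hg Hnu zu zv ON Hd fu fv). }
  split.
  { exact (carried_principal D z x y b l gamma1 gamma2 nu1 nu2 lambda mu beta1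
             beta2 e g oD sx sy se sg He Hg zu zv ON fu fv). }
  exists b. split; [|split].
  2:{ exact (carried_data D z x y b l gamma1 gamma2 nu1 nu2 lambda mu beta1
               beta2 e g oD sx sy se sg He Hg ev gu Hnu zu zv ON Hd fu fv). }
  - split; auto. intros u v Duv. rewrite fx, fy, fl by auto. split; auto.
    now apply Hd.
  - repeat split; auto.
Qed.

Lemma surface_adapted_frame D z b :
  open D -> vsmooth_on D z -> spacelike_on z D -> timelike_H_on z D ->
  principal_on z D -> is_frame_b z D b ->
  (forall u v, D (u, v) ->
     geo_gamma1 z u v = gamma1 u v /\ geo_gamma2 z u v = gamma2 u v /\
     geo_nu1 z u v = nu1 u v /\ geo_nu2 z u v = nu2 u v /\
     geo_lambda z u v = lambda u v /\ geo_mu z b u v = mu u v /\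
     geo_beta1 z b u v = beta1 u v /\ geo_beta2 z b u v = beta2 u v) ->
  adapted_frame D (fun u v => sqrt (EE z u v)) (fun u v => sqrt (GG z u v))
    z (frame_x z) (frame_y z) b (frame_l z).
Proof.
  intros oD sz sp ti pr fb data. split.
  - split; auto. split; [eapply vsmooth_x; eauto|].
    split; [eapply vsmooth_y; eauto|]. split; [apply fb|].
    eapply vsmooth_l; eauto.
  - intros u v Duv. split; [now apply (VDu_z D)|]. split; [now apply (VDv_z D)|].
    split; [eapply frame_motion_u; eauto | eapply frame_motion_v; eauto].
Qed.

End Adapted_frames.

Lemma smooth_root_E D gamma2 nu1 lambda mu beta1 beta2 :
  open D -> smooth_on D gamma2 -> smooth_on D nu1 -> smooth_on D lambda ->
  smooth_on D mu -> smooth_on D beta1 -> smooth_on D beta2 ->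
  (forall u v, D (u, v) -> 0 < root_E gamma2 nu1 lambda mu beta1 beta2 u v) ->
  smooth_on D (root_E gamma2 nu1 lambda mu beta1 beta2).
Proof.
  intros oD s1 s2 s3 s4 s5 s6 pos. unfold root_E, Rdiv. apply smooth_mult; auto.
  - now apply smooth_Du.
  - apply smooth_inv; auto.
    + intros u v Duv E. specialize (pos u v Duv). unfold root_E, Rdiv in pos.
      rewrite E, Rinv_0 in pos. lra.
    + apply smooth_minus; auto; [apply smooth_plus; auto|];
      repeat (apply smooth_mult; auto using smooth_const).
Qed.

Lemma smooth_root_G D gamma1 nu2 lambda mu beta1 beta2 :
  open D -> smooth_on D gamma1 -> smooth_on D nu2 -> smooth_on D lambda ->
  smooth_on D mu -> smooth_on D beta1 -> smooth_on D beta2 ->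
  (forall u v, D (u, v) -> 0 < root_G gamma1 nu2 lambda mu beta1 beta2 u v) ->
  smooth_on D (root_G gamma1 nu2 lambda mu beta1 beta2).
Proof.
  intros oD s1 s2 s3 s4 s5 s6 pos. unfold root_G, Rdiv. apply smooth_mult; auto.
  - now apply smooth_Dv.
  - apply smooth_inv; auto.
    + intros u v Duv E. specialize (pos u v Duv). unfold root_G, Rdiv in pos.
      rewrite E, Rinv_0 in pos. lra.
    + apply smooth_plus; auto; [apply smooth_minus; auto|];
      repeat (apply smooth_mult; auto using smooth_const).
Qed.

(** Positivity of the quotient excludes a vanishing denominator, as [/ 0 = 0]. *)
Lemma quotient_pos_eq a c s : 0 < a / c -> (a = s * c <-> s = a / c).
Proof.
  intros H. assert (c <> 0).
  { intros ->. unfold Rdiv in H. rewrite Rinv_0, Rmult_0_r in H. lra. }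
  split; intros ->; field; auto.
Qed.

Theorem theorem6p1
  (D : R * R -> Prop)
  (gamma1 gamma2 nu1 nu2 lambda mu beta1 beta2 : R -> R -> R)
  (u0 v0 : R) (p0 x0 y0 b0 l0 : vec4)
  (sE := root_E gamma2 nu1 lambda mu beta1 beta2)
  (sG := root_G gamma1 nu2 lambda mu beta1 beta2) :
  plane_domain D ->
  smooth_on D gamma1 -> smooth_on D gamma2 ->
  smooth_on D nu1 -> smooth_on D nu2 ->
  smooth_on D lambda -> smooth_on D mu ->
  smooth_on D beta1 -> smooth_on D beta2 ->
  (forall u v, D (u, v) -> 0 < sE u v) ->
  (forall u v, D (u, v) -> 0 < sG u v) ->
  (forall u v, D (u, v) -> - gamma1 u v * sE u v * sG u v = Dv sE u v) ->
  (forall u v, D (u, v) -> - gamma2 u v * sE u v * sG u v = Du sG u v) ->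
  (forall u v, D (u, v) ->
     - nu1 u v * nu2 u v + lambda u v ^ 2 - mu u v ^ 2 =
     1 / sE u v * Du gamma2 u v + 1 / sG u v * Dv gamma1 u v
     - (gamma1 u v ^ 2 + gamma2 u v ^ 2)) ->
  (forall u v, D (u, v) ->
     2 * lambda u v * gamma2 u v - mu u v * beta1 u v
     - (nu1 u v - nu2 u v) * gamma1 u v =
     1 / sE u v * Du lambda u v - 1 / sG u v * Dv nu1 u v) ->
  (forall u v, D (u, v) ->
     2 * lambda u v * gamma1 u v - mu u v * beta2 u v
     + (nu1 u v - nu2 u v) * gamma2 u v =
     - (1 / sE u v) * Du nu2 u v + 1 / sG u v * Dv lambda u v) ->
  (forall u v, D (u, v) ->
     gamma1 u v * beta1 u v - gamma2 u v * beta2 u v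
     - (nu1 u v - nu2 u v) * mu u v =
     - (1 / sE u v) * Du beta2 u v + 1 / sG u v * Dv beta1 u v) ->
  D (u0, v0) ->
  (* forced by l = - H / sqrt (- <H,H>), i.e. H = - (nu1 + nu2) / 2 * l *)
  0 < nu1 u0 v0 + nu2 u0 v0 ->
  orthonormal x0 y0 b0 l0 -> positively_oriented x0 y0 b0 l0 ->
  exists D0 : R * R -> Prop,
    plane_domain D0 /\ (forall p, D0 p -> D p) /\ D0 (u0, v0) /\
    exists z : R -> R -> vec4,
      surface_with_data D0 gamma1 gamma2 nu1 nu2 lambda mu beta1 beta2
        u0 v0 p0 x0 y0 b0 l0 z /\
      (forall z' : R -> R -> vec4,
         surface_with_data D0 gamma1 gamma2 nu1 nu2 lambda mu beta1 beta2
           u0 v0 p0 x0 y0 b0 l0 z' ->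
         forall u v, D0 (u, v) -> z' u v = z u v).
Proof.
  intros [oD _] s1 s2 s3 s4 s5 s6 s7 s8 HE HG Ev Gu gauss cod1 cod2 ricci D0 nu0
    ON0 Hd0.
  assert (sse : smooth_on D sE) by (apply smooth_root_E; auto).
  assert (ssg : smooth_on D sG) by (apply smooth_root_G; auto).
  (* On the surface to be found, [nu1 + nu2 = 2 sqrt (- <H,H>)]. *)
  set (D1 := fun p => D p /\ 0 < nu1 (fst p) (snd p) + nu2 (fst p) (snd p)).
  assert (oD1 : open D1).
  { intros [u v] [Duv Hnu]. apply filter_and; [now apply oD|].
    apply (locally_2d_locally (fun s t => 0 < nu1 s t + nu2 s t)).
    assert (c := smooth_continuity D _ u v (smooth_plus D _ _ oD s3 s4) Duv).
    destruct (c (mkposreal _ Hnu)) as [r Hr]. exists r. intros s t Hs Ht.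
    specialize (Hr s t Hs Ht). simpl in Hr. apply Rabs_def2 in Hr. lra. }
  set (A := frame_matrix sE (fun _ _ => 0) (fun u v => sE u v * gamma1 u v)
        (fun _ _ => 0) (fun u v => sE u v * nu1 u v) (fun u v => sE u v * mu u v)
        (fun u v => sE u v * lambda u v) (fun u v => sE u v * beta1 u v)).
  set (B := frame_matrix (fun _ _ => 0) sG (fun u v => - (sG u v * gamma2 u v))
        (fun u v => sG u v * mu u v) (fun u v => sG u v * lambda u v)
        (fun _ _ => 0) (fun u v => sG u v * nu2 u v)
        (fun u v => sG u v * beta2 u v)).
  assert (sub1 : forall p, D1 p -> D p) by (intros p Hp; apply Hp).
  destruct (linear_frobenius_vec4 D1 4 A B u0 v0) as (d & Hd & subQ & sol); auto.
  { now split. }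
  { intros i j _ _. apply (smooth_subset D); auto. apply smooth_frame_matrix;
    auto using smooth_const, smooth_mult. }
  { intros i j _ _. apply (smooth_subset D); auto. apply smooth_frame_matrix;
    auto using smooth_const, smooth_mult, smooth_opp. }
  { intros i k u v Hi Hk [Duv _].
    apply (frame_equations_integrable D sE sG gamma1 gamma2 nu1 nu2 lambda mu
             beta1 beta2 u v); auto.
    - symmetry; auto.
    - symmetry; auto.
    - apply quotient_pos_eq; [apply (HE u v Duv) | reflexivity].
    - apply quotient_pos_eq; [apply (HG u v Duv) | reflexivity]. }
  set (Q := square u0 v0 d).
  assert (Q0 : Q (u0, v0)) by (split; simpl; rewrite Rminus_diag, Rabs_R0; auto).
  assert (QD : forall u v, Q (u, v) -> D (u, v)) by (intros u v Hq; now apply subQ).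
  assert (SQ : forall f, smooth_on D f -> smooth_on Q f).
  { intros f. apply smooth_subset. intros [u v]; apply QD. }
  destruct (sol (fun i => match i with 0%nat => p0 | 1%nat => x0 | 2%nat => y0
                          | 3%nat => b0 | _ => l0 end))
    as (w & w0 & sw & wu & wv).
  assert (AF : adapted_frame gamma1 gamma2 nu1 nu2 lambda mu beta1 beta2 Q sE sG
                 (w 0%nat) (w 1%nat) (w 2%nat) (w 3%nat) (w 4%nat)).
  { split; [repeat apply conj; apply sw; lia|].
    intros u v Hq. unfold frame_motion, moving_frame.
    rewrite !wu, !wv by (auto; lia).
    repeat split; apply vec4_ext; unfold lin; simpl; ring. }
  exists Q. split; [now apply square_plane_domain|].
  split; [intros [u v]; apply QD|]. split; auto. exists (w 0%nat).
  assert (W0 := w0 0%nat ltac:(lia)). assert (W1 := w0 1%nat ltac:(lia)).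
  assert (W2 := w0 2%nat ltac:(lia)). assert (W3 := w0 3%nat ltac:(lia)).
  assert (W4 := w0 4%nat ltac:(lia)). simpl in W0, W1, W2, W3, W4.
  rewrite <- W1, <- W2, <- W3, <- W4 in ON0, Hd0.
  split.
  - rewrite <- W0, <- W1, <- W2, <- W3, <- W4.
    apply (adapted_frame_surface _ _ _ _ _ _ _ _ Q sE sG (w 0%nat) (w 1%nat)
             (w 2%nat) (w 3%nat) (w 4%nat)); auto.
    + apply open_square.
    + intros u v Hq. symmetry. auto.
    + intros u v Hq. symmetry. auto.
    + intros u v Hq. apply (subQ _ Hq).
    + intros u v Hq. now apply (adapted_frame_orthonormal _ _ _ _ _ _ _ _ u0 v0 d
        sE sG (w 0%nat) (w 1%nat) (w 2%nat) (w 3%nat) (w 4%nat) u v AF).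
    + intros u v Hq. now apply (adapted_frame_orthonormal _ _ _ _ _ _ _ _ u0 v0 d
        sE sG (w 0%nat) (w 1%nat) (w 2%nat) (w 3%nat) (w 4%nat) u v AF).
  - intros z' (sz & sp & ti & pr & b & fb & data & E0 & Ex & Ey & Eb & El) u v Hq.
    assert (oQ := open_square u0 v0 d : open Q).
    assert (AF' := surface_adapted_frame _ _ _ _ _ _ _ _ Q z' b oQ sz sp ti pr fb
                     data).
    apply (adapted_frames_unique gamma1 gamma2 nu1 nu2 lambda mu beta1 beta2
      u0 v0 d sE sG (w 0%nat) (w 1%nat) (w 2%nat) (w 3%nat) (w 4%nat)
      z' (frame_x z') (frame_y z') b (frame_l z') u v AF); auto.
    + apply (adapted_frame_ext _ _ _ _ _ _ _ _ Q (fun u v => sqrt (EE z' u v))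
               (fun u v => sqrt (GG z' u v))); auto.
      intros s t Hst. split; symmetry.
      * apply (proj1 (quotient_pos_eq _ _ _ (HE s t (QD s t Hst)))).
        apply (codazzi_mu_u Q z' b gamma1 gamma2 nu1 nu2 lambda mu beta1 beta2); auto.
      * apply (proj1 (quotient_pos_eq _ _ _ (HG s t (QD s t Hst)))).
        apply (codazzi_mu_v Q z' b gamma1 gamma2 nu1 nu2 lambda mu beta1 beta2); auto.
    + congruence.
    + congruence.
    + congruence.
    + congruence.
    + congruence.
Qed.
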